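(* Let $\mathbf w=\{w_n\}_{n=1}^\infty$ be a sequence of positive numbers, let $\varphi$ be a multiplier of $\mathcal H^{\mathbf w}$, and let $0\le\Delta\le\Delta'$ be real numbers. (A) Suppose that $\sum_{n=1}^\infty w_n^{-1}n^{-2\sigma'}<\infty$ whenever $\sigma'>\Delta'$, and that for each positive integer $N$, $\sum_{n\in\langle P_N\rangle}w_n^{-1}n^{-2\sigma}<\infty$ whenever $\sigma>\Delta$. Then: (1) each $f\in\mathcal H^{\mathbf w}$ converges absolutely in $\Omega_{\Delta'}$; (2) for each $N$, each $f\in\mathcal H^{\mathbf w}_N$ converges absolutely in $\Omega_\Delta$; (3) $\mathcal H^{\mathbf w}$ is a reproducing kernel Hilbert space, with point evaluations being continuous at every point of $\Omega_{\Delta'}$; (4) the sequence $\{\pi_N\varphi\}_{N=1}^\infty$ is uniformly bounded in sup norm on $\Omega_\Delta$ by $\|M_\varphi\|$; (5) the Dirichlet series of $\varphi$ converges in $\Omega_\Delta$, and $|\varphi|_{\Omega_\Delta}\le\|M_\varphi\|$. (B) In the other direction, suppose that $\delta\ge 0$ is a real number, that $\{w_n\}_{n=1}^\infty$ is multiplicative, and that $w_{p^{k-1}}p^{-2\delta}\ge w_{p^k}$ for each prime $p$ and each positive integer $k$. Then $\|M_\varphi\|\le|\varphi|_{\Omega_\delta}$.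
   Context: For real $\delta$, $\Omega_\delta=\{z\in\mathbb C:\mathrm{Re}(z)>\delta\}$. A Dirichlet series is a series $\sum_{n=1}^\infty a_nn^{-s}$ with complex $a_n$ and complex variable $s$. Standing assumption on weights: $w_n>0$ for all $n\ge1$ and there is a real $\sigma_0>0$ such that $\sum_{n=1}^\infty w_n^{-1}n^{-2\sigma}<\infty$ for all $\sigma>\sigma_0$. (In part (A), $\Delta'$ may play the role of $\sigma_0$.) $\mathcal H^{\mathbf w}=\{\sum_{n=1}^\infty a_nn^{-s}:\sum_{n=1}^\infty|a_n|^2w_n<\infty\}$ is the Hilbert space with inner product $\langle\sum a_nn^{-s},\sum b_nn^{-s}\rangle_{\mathbf w}=\sum a_n\overline{b_n}w_n$; its elements converge absolutely in $\Omega_{\sigma_0}$ and are regarded as functions there. A multiplier of $\mathcal H^{\mathbf w}$ is a function $\varphi$ with domain containing $\Omega_{\sigma_0}$ such that $\varphi f\in\mathcal H^{\mathbf w}$ for every $f\in\mathcal H^{\mathbf w}$ (equality of functions on $\Omega_{\sigma_0}$). Then $\varphi$ itself is (on $\Omega_{\sigma_0}$) an element of $\mathcal H^{\mathbf w}$, and $\varphi$ is identified with its Dirichlet series. $M_\varphi:\mathcal H^{\mathbf w}\to\mathcal H^{\mathbf w}$, $M_\varphi f=\varphi f$, is a bounded operator and $\|M_\varphi\|$ is its operator norm. $|\varphi|_{\Omega_\sigma}$ denotes $\sup_{s\in\Omega_\sigma}|\varphi(s)|$, where $\varphi$ is understood as analytically continued to $\Omega_\sigma$; it is $+\infty$ if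 $\varphi$ is unbounded on $\Omega_\sigma$ or has no analytic continuation to $\Omega_\sigma$. $P_N$ is the set of the first $N$ primes $p_1<\dots<p_N$, and $\langle P_N\rangle=\{p_1^{\alpha_1}\cdots p_N^{\alpha_N}:\alpha_j\in\{0,1,2,\dots\}\}$. $\mathcal H^{\mathbf w}_N$ is the closed subspace of $\mathcal H^{\mathbf w}$ of those series whose coefficients vanish for $n\notin\langle P_N\rangle$, and $\pi_N$ is the orthogonal projection of $\mathcal H^{\mathbf w}$ onto $\mathcal H^{\mathbf w}_N$; thus $\pi_N(\sum_{n\ge1} a_nn^{-s})=\sum_{n\in\langle P_N\rangle}a_nn^{-s}$. A sequence $\{w_n\}$ is multiplicative if $w_{mn}=w_mw_n$ for all relatively prime $m,n$ (and, for positive weights, $w_1=1$). *)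

(* Defs.v *)
From Stdlib Require Import Reals Lra Lia List Znumtheory ZArith Arith ClassicalEpsilon.
From Coquelicot Require Import Coquelicot.
Open Scope R_scope.

(* A series sum_{n>=1} a_n n^{-s} is given by its coefficients a : nat -> C;
   index 0 carries no term.  Sums over n >= 1 are written over k >= 0 with
   n = S k. *)

Definition half_plane (delta : R) (s : C) : Prop := delta < Re s.

(* n^{-s} = e^{-s ln n}, for n >= 1 *)
Definition npow (n : nat) (s : C) : C :=
  let r := exp (- (Re s * ln (INR n))) in
  let t := Im s * ln (INR n) in
  (r * cos t, - (r * sin t)).

Definition CSeries (u : nat -> C) : C :=
  (Series (fun k => Re (u k)), Series (fun k => Im (u k))).

Definition dterm (a : nat -> C) (s : C) (k : nat) : C :=
  (a (S k) * npow (S k) s)%C.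

Definition dconverges (a : nat -> C) (s : C) : Prop :=
  ex_series (K := C_AbsRing) (V := C_NormedModule) (dterm a s).

Definition dconverges_abs (a : nat -> C) (s : C) : Prop :=
  ex_series (fun k => Cmod (dterm a s k)).

(* the sum of the series; meaningful where the series converges *)
Definition dsum (a : nat -> C) (s : C) : C := CSeries (dterm a s).

(* w_n^{-1} n^{-2 sigma} *)
Definition wterm (w : nat -> R) (sigma : R) (n : nat) : R :=
  / w n * Rpower (INR n) (- (2 * sigma)).

Definition seq_zero : nat -> C := fun _ => RtoC 0.
Definition seq_plus (a b : nat -> C) : nat -> C := fun n => (a n + b n)%C.
Definition seq_minus (a b : nat -> C) : nat -> C := fun n => (a n - b n)%C.
Definition seq_scal (c : C) (a : nat -> C) : nat -> C := fun n => (c * a n)%C.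

(* The unused coefficient a 0 is normalized to 0, so that a is determined by
   the series it stands for. *)
Definition in_H (w : nat -> R) (a : nat -> C) : Prop :=
  a O = RtoC 0 /\ ex_series (fun k => Cmod (a (S k)) ^ 2 * w (S k)).

Definition ip (w : nat -> R) (a b : nat -> C) : C :=
  CSeries (fun k => (a (S k) * Cconj (b (S k)) * RtoC (w (S k)))%C).

Definition norm_of (inner : (nat -> C) -> (nat -> C) -> C) (a : nat -> C) : R :=
  sqrt (Re (inner a a)).

Definition normH (w : nat -> R) (a : nat -> C) : R := norm_of (ip w) a.

(* H is a complex Hilbert space for the pointwise operations and the inner
   product [inner] (conjugate-linear in the second argument). *)
Record is_hilbert_space (H : (nat -> C) -> Prop)
    (inner : (nat -> C) -> (nat -> C) -> C) : Prop := {
  hilbert_zero : H seq_zero;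
  hilbert_plus : forall a b, H a -> H b -> H (seq_plus a b);
  hilbert_scal : forall (c : C) a, H a -> H (seq_scal c a);
  inner_plus_l : forall a b d, H a -> H b -> H d ->
    inner (seq_plus a b) d = (inner a d + inner b d)%C;
  inner_scal_l : forall (c : C) a b, H a -> H b ->
    inner (seq_scal c a) b = (c * inner a b)%C;
  inner_conj : forall a b, H a -> H b -> inner b a = Cconj (inner a b);
  inner_ge_0 : forall a, H a -> 0 <= Re (inner a a);
  inner_eq_0 : forall a, H a -> inner a a = RtoC 0 -> forall n, a n = RtoC 0;
  hilbert_complete : forall u : nat -> nat -> C,
    (forall j, H (u j)) ->
    (forall eps : posreal, exists J : nat, forall i j : nat,
        (J <= i)%nat -> (J <= j)%nat ->
        norm_of inner (seq_minus (u i) (u j)) < eps) ->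
    exists a, H a /\
      is_lim_seq (fun j => norm_of inner (seq_minus (u j) a)) 0
}.

(* H is a Hilbert space whose elements are, through the evaluation map [ev],
   functions on X, with linear and continuous point evaluations. *)
Record is_rkhs (X : C -> Prop) (H : (nat -> C) -> Prop)
    (inner : (nat -> C) -> (nat -> C) -> C)
    (ev : (nat -> C) -> C -> C) : Prop := {
  rkhs_hilbert : is_hilbert_space H inner;
  rkhs_functions : forall a b, H a -> H b ->
    (forall s, X s -> ev a s = ev b s) -> forall n, a n = b n;
  rkhs_ev_plus : forall s a b, X s -> H a -> H b ->
    ev (seq_plus a b) s = (ev a s + ev b s)%C;
  rkhs_ev_scal : forall s (c : C) a, X s -> H a ->
    ev (seq_scal c a) s = (c * ev a s)%C;
  rkhs_ev_continuous : forall s, X s -> forall a, H a ->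
    forall eps : posreal, exists eta : posreal, forall b, H b ->
      norm_of inner (seq_minus b a) < eta -> Cmod (ev b s - ev a s)%C < eps
}.

Definition is_prime (p : nat) : Prop := prime (Z.of_nat p).

(* P_N: the primes having fewer than N primes below them *)
Definition in_P (N p : nat) : Prop :=
  is_prime p /\
  (length (filter (fun q => if prime_dec (Z.of_nat q) then true else false)
                  (seq 0 p)) < N)%nat.

(* <P_N>: the products of elements of P_N, repetitions allowed *)
Inductive in_gen_P (N : nat) : nat -> Prop :=
| gen_P_one : in_gen_P N 1
| gen_P_mul : forall p n, in_P N p -> in_gen_P N n -> in_gen_P N (p * n).

Definition in_gen_P_dec (N n : nat) : {in_gen_P N n} + {~ in_gen_P N n} :=
  excluded_middle_informative (in_gen_P N n).

Definition in_HN (w : nat -> R) (N : nat) (a : nat -> C) : Prop :=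
  in_H w a /\
  forall n, (1 <= n)%nat -> ~ in_gen_P N n -> a n = RtoC 0.

Definition proj (N : nat) (a : nat -> C) : nat -> C :=
  fun n => if in_gen_P_dec N n then a n else RtoC 0.

Definition wterm_P (w : nat -> R) (N : nat) (sigma : R) (n : nat) : R :=
  if in_gen_P_dec N n then wterm w sigma n else 0.

(* M_phi a = b, for phi given on the half plane Re s > sigma0 *)
Definition mult_graph (w : nat -> R) (sigma0 : R) (phi : C -> C)
    (a b : nat -> C) : Prop :=
  in_H w a /\ in_H w b /\
  forall s, half_plane sigma0 s -> (phi s * dsum a s)%C = dsum b s.

Definition is_multiplier (w : nat -> R) (sigma0 : R) (phi : C -> C) : Prop :=
  forall a, in_H w a -> exists b, mult_graph w sigma0 phi a b.

Definition opnorm (w : nat -> R) (sigma0 : R) (phi : C -> C) : Rbar :=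
  Lub_Rbar (fun x => exists a b,
    mult_graph w sigma0 phi a b /\ normH w a <= 1 /\ x = normH w b).

Definition is_dseries_of (w : nat -> R) (sigma0 : R) (phi : C -> C)
    (c : nat -> C) : Prop :=
  in_H w c /\ forall s, half_plane sigma0 s -> phi s = dsum c s.

Definition sup_on (X : C -> Prop) (F : C -> C) : Rbar :=
  Lub_Rbar (fun x => exists s, X s /\ x = Cmod (F s)).

Definition holomorphic_on (X : C -> Prop) (F : C -> C) : Prop :=
  forall s, X s -> ex_derive (K := C_AbsRing) (V := C_NormedModule) F s.

Definition is_continuation (sigma0 : R) (phi : C -> C) (sigma : R)
    (F : C -> C) : Prop :=
  holomorphic_on (half_plane sigma) F /\
  forall s, half_plane sigma s -> half_plane sigma0 s -> F s = phi s.

(* |phi|_{Omega_sigma}; the choice of the continuation is immaterial since it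
   is unique on the half plane. *)
Definition sup_norm (sigma0 : R) (phi : C -> C) (sigma : R) : Rbar :=
  match excluded_middle_informative
          (exists F, is_continuation sigma0 phi sigma F) with
  | left h =>
      sup_on (half_plane sigma)
             (proj1_sig (constructive_indefinite_description _ h))
  | right _ => p_infty
  end.

Definition multiplicative (w : nat -> R) : Prop :=
  forall m n, (1 <= m)%nat -> (1 <= n)%nat -> Nat.gcd m n = 1%nat ->
    w (m * n)%nat = w m * w n.

Lemma proj_in_HN (w : nat -> R) (N : nat) (a : nat -> C) :
  (forall n, (1 <= n)%nat -> 0 < w n) -> in_H w a -> in_HN w N (proj N a).
Proof.
intros Hw [a0 Ha]; split; [split|].
- unfold proj; destruct (in_gen_P_dec N 0); auto.
- apply (@ex_series_le R_AbsRing R_CompleteNormedModule _ _) with (2 := Ha).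
  intros k; unfold norm, proj; simpl; unfold abs; simpl.
  assert (Hk : 0 < w (S k)) by (apply Hw; lia).
  pose proof (Cmod_ge_0 (a (S k))) as Hc.
  destruct (in_gen_P_dec N (S k)); [|rewrite Cmod_0]; rewrite Rabs_pos_eq; nra.
- intros n _ Hn; unfold proj; destruct (in_gen_P_dec N n); tauto.
Qed.

(* Together with [proj_in_HN]: [proj N] is the orthogonal projection of H^w
   onto its subspace H^w_N. *)
Lemma proj_orthogonal (w : nat -> R) (N : nat) (a b : nat -> C) :
  in_HN w N b -> ip w (seq_minus a (proj N a)) b = RtoC 0.
Proof.
intros [_ Hb].
assert (E : forall k, (seq_minus a (proj N a) (S k) * Cconj (b (S k))
                       * RtoC (w (S k)))%C = RtoC 0).
{ intros k; unfold seq_minus, proj; destruct (in_gen_P_dec N (S k)) as [|h].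
  - unfold Cminus; rewrite Cplus_opp_r, !Cmult_0_l; reflexivity.
  - rewrite (Hb (S k)) by (auto; lia).
    unfold Cconj; simpl; rewrite Ropp_0.
    change ((0, 0)) with (RtoC 0); rewrite Cmult_0_r, Cmult_0_l; reflexivity. }
assert (Z : Series (fun _ : nat => 0) = 0).
{ rewrite (Series_ext _ (fun k => 0 * 0)) by (intros; ring).
  rewrite Series_scal_l; ring. }
unfold ip, CSeries, RtoC; f_equal; (etransitivity; [|exact Z]);
  apply Series_ext; intros k; rewrite E; reflexivity.
Qed.

(* Main.v *)
(* By Cauchy-Schwarz the elements of H^w converge absolutely where the kernel is finite, and
   uniqueness of coefficients turns the multiplier phi into the operator a |-> a * c of
   Dirichlet convolution with its coefficients c, bounded by the uniform boundedness principle.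

   (A) Compressing to <P_N> and evaluating powers at the constant 1 gives
   |D_N(s)|^m <= K(s) ||M_phi||^m for D_N = pi_N phi and all m, so |D_N| <= ||M_phi|| on
   Omega_Delta.  The partial sums of a Dirichlet series bounded by M are O(M log n) (Bohr);
   this is obtained from the positivity of the Fejer kernel.  Abel summation then makes the
   convergence of the series D_N uniform in N, so that the series of phi converges on
   Omega_Delta with the same bound and is holomorphic there.  Since the norm |phi| refers to an
   arbitrary complex differentiable continuation, uniqueness of the continuation is needed; it
   follows from Goursat's theorem through the mean value property.

   (B) If a continuation F is bounded by M on Omega_delta, Goursat's theorem on tall
   rectangles shows that the means of F(sigma + it) k^(it) over vertical lines still compute
   c_k k^(-sigma) for all sigma > delta.  Hence convolution by c_n n^(-delta) is bounded by M
   in l^2 of the divisors of m, for every m, and a multiplicative weight decreasing along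
   prime powers is a positive combination of indicators of divisor sets. *)

Require Import Defs.
From Stdlib Require Import Reals Lra Lia ClassicalEpsilon.
From Coquelicot Require Import Coquelicot.
From HB Require Import structures.
Open Scope R_scope.

(* Inside this module nat inequalities are those of ssrnat; the module keeps them out of the
   scope of the final statement. *)
Module HilbertDirichlet.

From mathcomp Require Import ssreflect ssrfun ssrbool eqtype ssrnat seq div prime fintype bigop zify.
Local Open Scope R_scope.


(** * Finite and infinite complex sums *)

(** In (A) the kernel of the whole space is known to be finite only beyond [Delta'], so [phi] cannot
    be estimated directly on the larger half plane. The numbers generated by finitely many primes
    are closed under products and divisors, so compression to them respects convolution. The factor
    K(s) also depends on N, but it disappears under m-th roots, and the remaining bound does not see
    N. Since the partial sum of c up to n is one of D_N for every N > n, estimates uniform in N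
    suffice, and a factor log n is harmless because any n^(-theta) absorbs it.

    In (B) the series of [phi] may diverge on part of the half plane where F lives, and nothing is
    known on its boundary line. The coefficients therefore enter as means of F, absolute convergence
    being used only far to the right, and sigma -> delta is taken in a finite inequality. Truncation
    to the divisors of m is harmless because the convolution at a divisor of m involves only
    divisors of m. *)

HB.instance Definition _ := Monoid.isComLaw.Build R 0 Rplus
  (fun x y z => esym (Rplus_assoc x y z)) Rplus_comm Rplus_0_l.
HB.instance Definition _ := Monoid.isMulLaw.Build R 0 Rmult Rmult_0_l Rmult_0_r.
HB.instance Definition _ := Monoid.isAddLaw.Build R Rmult Rplus
  (fun x y z => Rmult_plus_distr_r x y z) Rmult_plus_distr_l.
HB.instance Definition _ := Monoid.isComLaw.Build C (RtoC 0) Cplus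
  Cplus_assoc Cplus_comm Cplus_0_l.
HB.instance Definition _ := Monoid.isMulLaw.Build C (RtoC 0) Cmult Cmult_0_l Cmult_0_r.
HB.instance Definition _ := Monoid.isAddLaw.Build C Cmult Cplus
  (fun x y z => Cmult_plus_distr_r x y z) Cmult_plus_distr_l.

Reserved Notation "\rsum_ ( m <= i < n ) F" (at level 41, F at level 41, i, m, n at level 60).
Reserved Notation "\rsum_ ( i <- r ) F" (at level 41, F at level 41, i, r at level 60).
Reserved Notation "\rsum_ ( i <- r | P ) F" (at level 41, F at level 41, i, r at level 60).
Reserved Notation "\csum_ ( m <= i < n ) F" (at level 41, F at level 41, i, m, n at level 60).
Reserved Notation "\csum_ ( i <- r ) F" (at level 41, F at level 41, i, r at level 60).
Reserved Notation "\csum_ ( i <- r | P ) F" (at level 41, F at level 41, i, r at level 60).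
Notation "\rsum_ ( m <= i < n ) F" := (\big[Rplus/0%R]_(m <= i < n) F%R).
Notation "\rsum_ ( i <- r ) F" := (\big[Rplus/0%R]_(i <- r) F%R).
Notation "\rsum_ ( i <- r | P ) F" := (\big[Rplus/0%R]_(i <- r | P%B) F%R).
Notation "\csum_ ( m <= i < n ) F" := (\big[Cplus/RtoC 0]_(m <= i < n) F%C).
Notation "\csum_ ( i <- r ) F" := (\big[Cplus/RtoC 0]_(i <- r) F%C).
Notation "\csum_ ( i <- r | P ) F" := (\big[Cplus/RtoC 0]_(i <- r | P%B) F%C).


Definition clim (u : nat -> C) (l : C) : Prop :=
  is_lim_seq (fun n => Cmod (u n - l)) 0.

(** The partial sums stop before [n], whereas [sum_n] includes the index [n]; hence the shifts by
    one between the two notions of series. *)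
Definition csums (u : nat -> C) (l : C) : Prop :=
  clim (fun n => \csum_(0 <= k < n) u k) l.

Lemma Cmod_dist (x y : C) : Rabs (Cmod x - Cmod y) <= Cmod (x - y).
Proof.
have h1 := Cmod_triangle (x - y) y.
have h2 := Cmod_triangle (y - x) x.
have e1 : (x - y + y)%C = x by ring.
have e2 : (y - x + x)%C = y by ring.
have e3 : Cmod (y - x) = Cmod (x - y) by rewrite -Cmod_opp; congr Cmod; ring.
rewrite e1 in h1; rewrite e2 e3 in h2.
by apply: Rabs_le; lra.
Qed.

Lemma Re_plus (x y : C) : Re (x + y)%C = Re x + Re y. Proof. by []. Qed.
Lemma Re_minus (x y : C) : Re (x - y)%C = Re x - Re y. Proof. by []. Qed.
Lemma Im_minus (x y : C) : Im (x - y)%C = Im x - Im y. Proof. by []. Qed.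
Lemma Re_mult (x y : C) : Re (x * y)%C = Re x * Re y - Im x * Im y. Proof. by []. Qed.
Lemma C_eq (x y : C) : Re x = Re y -> Im x = Im y -> x = y.
Proof. by case: x => a b; case: y => c d /= -> ->. Qed.

Lemma im_le_Cmod (x : C) : Rabs (Im x) <= Cmod x.
Proof. by apply: Rle_trans (Rmax_r _ _) (Rmax_Cmod x). Qed.

Lemma Cmod_le_ReIm (x : C) : Cmod x <= Rabs (Re x) + Rabs (Im x).
Proof.
have {1}-> : x = (RtoC (Re x) + Ci * RtoC (Im x))%C by apply: C_eq => /=; ring.
apply: Rle_trans (Cmod_triangle _ _) _.
by rewrite Cmod_mult Cmod_Ci !Cmod_R Rmult_1_l; right.
Qed.

Lemma clim_ReIm (u : nat -> C) (l : C) :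
  clim u l <-> is_lim_seq (fun n => Re (u n)) (Re l) /\ is_lim_seq (fun n => Im (u n)) (Im l).
Proof.
split.
- move=> h; split.
    have h0 : is_lim_seq (fun n => Re (u n) - Re l) 0.
      apply/is_lim_seq_abs_0; apply: is_lim_seq_le_le h; last exact: is_lim_seq_const.
      by move=> n; split; [exact: Rabs_pos | rewrite -Re_minus; exact: re_le_Cmod].
    have := is_lim_seq_plus' _ _ _ _ h0 (is_lim_seq_const (Re l)).
    by rewrite Rplus_0_l; apply: is_lim_seq_ext => n; ring.
  + have h0 : is_lim_seq (fun n => Im (u n) - Im l) 0.
      apply/is_lim_seq_abs_0; apply: is_lim_seq_le_le h; last exact: is_lim_seq_const.
      by move=> n; split; [exact: Rabs_pos | rewrite -Im_minus; exact: im_le_Cmod].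
    have := is_lim_seq_plus' _ _ _ _ h0 (is_lim_seq_const (Im l)).
    by rewrite Rplus_0_l; apply: is_lim_seq_ext => n; ring.
- case=> h1 h2.
  have h : is_lim_seq (fun n => Rabs (Re (u n) - Re l) + Rabs (Im (u n) - Im l)) 0.
    have a1 := is_lim_seq_minus' _ _ _ _ h1 (is_lim_seq_const (Re l)).
    have a2 := is_lim_seq_minus' _ _ _ _ h2 (is_lim_seq_const (Im l)).
    rewrite Rminus_diag in a1; rewrite Rminus_diag in a2.
    have := is_lim_seq_plus' _ _ _ _ (proj1 (is_lim_seq_abs_0 _) a1) (proj1 (is_lim_seq_abs_0 _) a2).
    by rewrite Rplus_0_l.
  apply: is_lim_seq_le_le h; last exact: is_lim_seq_const.
  move=> n; split; first exact: Cmod_ge_0.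
  by rewrite -Re_minus -Im_minus; exact: Cmod_le_ReIm.
Qed.

Lemma clim_ext (u v : nat -> C) (l : C) : (forall n, u n = v n) -> clim u l -> clim v l.
Proof. by move=> h; apply: is_lim_seq_ext => n; rewrite h. Qed.

Lemma clim_unique (u : nat -> C) (l l' : C) : clim u l -> clim u l' -> l = l'.
Proof.
move=> /clim_ReIm[h1 h2] /clim_ReIm[h3 h4].
have e1 := is_lim_seq_unique _ _ h1; rewrite (is_lim_seq_unique _ _ h3) in e1.
have e2 := is_lim_seq_unique _ _ h2; rewrite (is_lim_seq_unique _ _ h4) in e2.
by apply: C_eq; [case: e1 | case: e2].
Qed.

Lemma clim_const (l : C) : clim (fun=> l) l.
Proof.
apply: is_lim_seq_ext (is_lim_seq_const 0) => n.
by rewrite -Cmod_0; congr Cmod; ring.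
Qed.

Lemma clim_plus (u v : nat -> C) (l m : C) :
  clim u l -> clim v m -> clim (fun n => u n + v n)%C (l + m)%C.
Proof.
move=> /clim_ReIm[h1 h2] /clim_ReIm[h3 h4]; apply/clim_ReIm; split.
- exact: is_lim_seq_plus'.
- exact: is_lim_seq_plus'.
Qed.

Lemma clim_minus (u v : nat -> C) (l m : C) :
  clim u l -> clim v m -> clim (fun n => u n - v n)%C (l - m)%C.
Proof.
move=> /clim_ReIm[h1 h2] /clim_ReIm[h3 h4]; apply/clim_ReIm; split.
- exact: is_lim_seq_minus'.
- exact: is_lim_seq_minus'.
Qed.

Lemma clim_mult (u v : nat -> C) (l m : C) :
  clim u l -> clim v m -> clim (fun n => u n * v n)%C (l * m)%C.
Proof.
move=> /clim_ReIm[h1 h2] /clim_ReIm[h3 h4]; apply/clim_ReIm; split.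
- by apply: is_lim_seq_minus'; apply: is_lim_seq_mult'.
- by apply: is_lim_seq_plus'; apply: is_lim_seq_mult'.
Qed.

Lemma clim_Cmod (u : nat -> C) (l : C) : clim u l -> is_lim_seq (fun n => Cmod (u n)) (Cmod l).
Proof.
move=> h.
have h0 : is_lim_seq (fun n => Cmod (u n) - Cmod l) 0.
  apply/is_lim_seq_abs_0; apply: is_lim_seq_le_le h; last exact: is_lim_seq_const.
  by move=> n; split; [exact: Rabs_pos | exact: Cmod_dist].
have := is_lim_seq_plus' _ _ _ _ h0 (is_lim_seq_const (Cmod l)).
by rewrite Rplus_0_l; apply: is_lim_seq_ext => n; ring.
Qed.

Lemma clim_bound (u : nat -> C) (l : C) (f : nat -> R) (B : R) (N : nat) :
  clim u l -> is_lim_seq f B -> (forall n, (N <= n)%N -> Cmod (u n) <= f n) -> Cmod l <= B.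
Proof.
move=> /clim_Cmod h hf hb.
have h' : Rbar_le (Cmod l) B.
  by apply: is_lim_seq_le_loc h hf; exists N => n hn; apply: hb; lia.
exact: h'.
Qed.

Lemma is_lim_seq_eps (u : nat -> R) :
  (forall n, 0 <= u n) ->
  is_lim_seq u 0 <-> (forall eps, 0 < eps -> exists N, forall n, (N <= n)%N -> u n <= eps).
Proof.
move=> u0; split.
- move=> /is_lim_seq_spec h eps he.
  have [N hN] := h (mkposreal eps he).
  exists N => n hn; have := hN n; move=> /(_ ltac:(lia)) /=.
  by rewrite Rminus_0_r Rabs_pos_eq //; lra.
- move=> h; apply/is_lim_seq_spec => -[eps he].
  have [N hN] := h (eps / 2) ltac:(lra).
  exists N => n hn /=; rewrite Rminus_0_r Rabs_pos_eq //.
  by have := hN n ltac:(lia); lra.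
Qed.

Lemma clim_eps (u : nat -> C) (l : C) :
  clim u l <-> (forall eps, 0 < eps -> exists N, forall n, (N <= n)%N -> Cmod (u n - l) <= eps).
Proof. by apply: is_lim_seq_eps => n; exact: Cmod_ge_0. Qed.

Lemma clim_cauchy (u : nat -> C) :
  (forall eps, 0 < eps -> exists N, forall m n, (N <= m)%N -> (m <= n)%N -> Cmod (u n - u m) <= eps) ->
  exists l, clim u l.
Proof.
move=> h.
have hs : forall eps, 0 < eps -> exists N, forall m n, (N <= m)%N -> (N <= n)%N -> Cmod (u n - u m) <= eps.
  move=> eps /h[N hN]; exists N => m n hm hn.
  case: (leqP m n) => hmn; first exact: hN.
  rewrite -Cmod_opp; have -> : (- (u n - u m) = u m - u n)%C by ring.
  by apply: hN => //; lia.
have [lr hr] : ex_finite_lim_seq (fun n => Re (u n)).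
  apply/ex_lim_seq_cauchy_corr => eps.
  have [N hN] := hs (eps / 2) ltac:(have := cond_pos eps; lra).
  exists N => m n hm hn; rewrite -Re_minus.
  apply: Rle_lt_trans (re_le_Cmod _) _.
  apply: Rle_lt_trans (hN n m ltac:(lia) ltac:(lia)) _; have := cond_pos eps; lra.
have [li hi] : ex_finite_lim_seq (fun n => Im (u n)).
  apply/ex_lim_seq_cauchy_corr => eps.
  have [N hN] := hs (eps / 2) ltac:(have := cond_pos eps; lra).
  exists N => m n hm hn; rewrite -Im_minus.
  apply: Rle_lt_trans (im_le_Cmod _) _.
  apply: Rle_lt_trans (hN n m ltac:(lia) ltac:(lia)) _; have := cond_pos eps; lra.
by exists (lr, li); apply/clim_ReIm.
Qed.

Lemma sum_n_rsum (f : nat -> R) (n : nat) : sum_n f n = \rsum_(0 <= k < n.+1) f k.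
Proof.
elim: n => [|n IHn]; first by rewrite sum_O big_nat1.
by rewrite sum_Sn IHn (big_nat_recr n.+1).
Qed.

Lemma csum_ReIm (f : nat -> C) (r : seq nat) (P : pred nat) :
  (\csum_(k <- r | P k) f k) = (\rsum_(k <- r | P k) Re (f k), \rsum_(k <- r | P k) Im (f k)).
Proof.
elim: r => [|x r IHr]; first by rewrite !big_nil.
by rewrite !big_cons; case: (P x); rewrite IHr.
Qed.

Lemma Re_csum (f : nat -> C) (r : seq nat) (P : pred nat) :
  Re (\csum_(k <- r | P k) f k) = \rsum_(k <- r | P k) Re (f k).
Proof. by rewrite csum_ReIm. Qed.

Lemma Im_csum (f : nat -> C) (r : seq nat) (P : pred nat) :
  Im (\csum_(k <- r | P k) f k) = \rsum_(k <- r | P k) Im (f k).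
Proof. by rewrite csum_ReIm. Qed.

Lemma is_series_rsum (f : nat -> R) (l : R) :
  is_series f l <-> is_lim_seq (fun n => \rsum_(0 <= k < n) f k) l.
Proof.
split.
- move=> h; apply/is_lim_seq_incr_1.
  by apply: (is_lim_seq_ext (sum_n f)) => [n|]; [exact: sum_n_rsum | exact: h].
- move=> /is_lim_seq_incr_1 h.
  apply: (is_lim_seq_ext _ (sum_n f) l _ h) => n; by rewrite sum_n_rsum.
Qed.

Lemma Series_lim (f : nat -> R) :
  ex_series f -> is_lim_seq (fun n => \rsum_(0 <= k < n) f k) (Series f).
Proof. by move=> /Series_correct /is_series_rsum. Qed.

Lemma rsum_ge0 {I : Type} (r : seq I) (P : pred I) (f : I -> R) :
  (forall k, P k -> 0 <= f k) -> 0 <= \big[Rplus/0]_(k <- r | P k) f k.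
Proof.
move=> h; elim: r => [|x r IHr]; first by rewrite big_nil; lra.
by rewrite big_cons; case: ifP => // Px; have := h x Px; lra.
Qed.

Lemma rsum_le (r : seq nat) (P : pred nat) (f g : nat -> R) :
  (forall k, k \in r -> P k -> f k <= g k) ->
  \rsum_(k <- r | P k) f k <= \rsum_(k <- r | P k) g k.
Proof.
elim: r => [|x r IHr] h; first by rewrite !big_nil; lra.
have h1 : \rsum_(k <- r | P k) f k <= \rsum_(k <- r | P k) g k.
  by apply: IHr => k hk; apply: h; rewrite in_cons hk orbT.
rewrite !big_cons; case: ifP => // Px.
by have := h x (mem_head _ _) Px; lra.
Qed.

Lemma Cmod_csum (r : seq nat) (P : pred nat) (f : nat -> C) :
  Cmod (\csum_(k <- r | P k) f k) <= \rsum_(k <- r | P k) Cmod (f k).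
Proof.
elim: r => [|x r IHr]; first by rewrite !big_nil Cmod_0; lra.
rewrite !big_cons; case: ifP => // Px.
by apply: Rle_trans (Cmod_triangle _ _) _; lra.
Qed.

Lemma rsum_nat_split (f : nat -> R) (m n : nat) : (m <= n)%N ->
  \rsum_(0 <= k < n) f k = \rsum_(0 <= k < m) f k + \rsum_(m <= k < n) f k.
Proof. by move=> h; rewrite (big_cat_nat (leq0n m) h). Qed.

Lemma csum_nat_split (f : nat -> C) (m n : nat) : (m <= n)%N ->
  (\csum_(0 <= k < n) f k = \csum_(0 <= k < m) f k + \csum_(m <= k < n) f k)%C.
Proof. by move=> h; rewrite (big_cat_nat (leq0n m) h). Qed.

Lemma ex_series_bounded (f : nat -> R) (B : R) :
  (forall k, 0 <= f k) -> (forall n, \rsum_(0 <= k < n) f k <= B) -> ex_series f.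
Proof.
move=> f0 hB.
have [l hl] : ex_finite_lim_seq (fun n => \rsum_(0 <= k < n) f k).
  apply: (ex_finite_lim_seq_incr _ B) => // n.
  by rewrite big_nat_recr //=; have := f0 n; lra.
by exists l; apply/is_series_rsum.
Qed.

Lemma Series_le_bound (f : nat -> R) (B : R) :
  ex_series f -> (forall n, \rsum_(0 <= k < n) f k <= B) -> Series f <= B.
Proof.
move=> /Series_lim h hB.
have h' : Rbar_le (Series f) B by apply: is_lim_seq_le h (is_lim_seq_const B).
exact: h'.
Qed.

Lemma rsum_le_Series (f : nat -> R) (n : nat) :
  (forall k, 0 <= f k) -> ex_series f -> \rsum_(0 <= k < n) f k <= Series f.
Proof.
move=> f0 /Series_lim h.
have h' : Rbar_le (\rsum_(0 <= k < n) f k) (Series f).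
  apply: is_lim_seq_le_loc (is_lim_seq_const _) h.
  exists n => m hm; rewrite (@rsum_nat_split f n m); last lia.
  by have := rsum_ge0 (index_iota n m) xpredT f (fun k _ => f0 k); lra.
exact: h'.
Qed.

Lemma ex_series_le_abs (f g : nat -> R) :
  (forall k, Rabs (f k) <= g k) -> ex_series g -> ex_series f.
Proof. by move=> h; apply: (@ex_series_le R_AbsRing R_CompleteNormedModule). Qed.

Lemma csums_CSeries (u : nat -> C) :
  ex_series (fun k => Cmod (u k)) -> csums u (CSeries u).
Proof.
move=> h; apply/clim_ReIm; split => /=.
- apply: is_lim_seq_ext (Series_lim (fun k => Re (u k)) _) => [n|]; first by rewrite Re_csum.
  by apply: ex_series_le_abs h => k; exact: re_le_Cmod.
- apply: is_lim_seq_ext (Series_lim (fun k => Im (u k)) _) => [n|]; first by rewrite Im_csum.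
  by apply: ex_series_le_abs h => k; exact: im_le_Cmod.
Qed.

Lemma CSeries_unique (u : nat -> C) (l : C) : csums u l -> CSeries u = l.
Proof.
move=> /clim_ReIm[h1 h2]; apply: C_eq; apply: is_series_unique; apply/is_series_rsum.
- by apply: is_lim_seq_ext h1 => n; rewrite Re_csum.
- by apply: is_lim_seq_ext h2 => n; rewrite Im_csum.
Qed.

Lemma Cmod_CSeries_le (u : nat -> C) :
  ex_series (fun k => Cmod (u k)) -> Cmod (CSeries u) <= Series (fun k => Cmod (u k)).
Proof.
move=> h.
apply: (@clim_bound _ _ (fun n => \rsum_(0 <= k < n) Cmod (u k)) _ 0 (csums_CSeries u h)).
- exact: Series_lim.
- by move=> n _; exact: Cmod_csum.
Qed.

Lemma sum_n_csum (u : nat -> C) (n : nat) :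
  sum_n (G := C_AbelianGroup) u n = \csum_(0 <= k < n.+1) u k.
Proof.
elim: n => [|n IHn]; first by rewrite sum_O big_nat1.
by rewrite sum_Sn IHn (big_nat_recr n.+1).
Qed.

Lemma ex_series_csums (u : nat -> C) (l : C) :
  csums u l -> ex_series (K := C_AbsRing) (V := C_NormedModule) u.
Proof.
move=> /clim_ReIm[h1 h2]; exists l.
apply: (filterlim_ext (fun n => \csum_(0 <= k < n.+1) u k)).
  by move=> n; rewrite -sum_n_csum.
apply/filterlim_locally => eps.
move/is_lim_seq_incr_1/is_lim_seq_spec: h1 => /(_ eps)[N1 hN1].
move/is_lim_seq_incr_1/is_lim_seq_spec: h2 => /(_ eps)[N2 hN2].
exists (N1 + N2)%N => n hn; split.
- by have := hN1 n ltac:(lia).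
- by have := hN2 n ltac:(lia).
Qed.

(** * Complex exponential and complex derivative *)

Definition cexp (z : C) : C := (exp (Re z) * cos (Im z), exp (Re z) * sin (Im z)).

Lemma cexp_plus (x y : C) : cexp (x + y) = (cexp x * cexp y)%C.
Proof.
by case: x y => a b [c d]; apply: C_eq; rewrite /= exp_plus ?cos_plus ?sin_plus; ring.
Qed.

Lemma cexp_0 : cexp 0 = 1.
Proof. by apply: C_eq => /=; rewrite exp_0 ?cos_0 ?sin_0; ring. Qed.

Lemma Cmod_cexp (z : C) : Cmod (cexp z) = exp (Re z).
Proof.
rewrite /Cmod /=.
have -> : exp (Re z) * cos (Im z) * (exp (Re z) * cos (Im z) * 1) +
  exp (Re z) * sin (Im z) * (exp (Re z) * sin (Im z) * 1) =
  (exp (Re z))² * ((sin (Im z))² + (cos (Im z))²) by rewrite /Rsqr; ring.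
by rewrite sin2_cos2 Rmult_1_r sqrt_Rsqr //; left; exact: exp_pos.
Qed.

Lemma cexp_neq0 (z : C) : cexp z <> 0.
Proof. by apply/Cmod_gt_0; rewrite Cmod_cexp; exact: exp_pos. Qed.

Lemma npow_cexp (n : nat) (s : C) : npow n s = cexp (- (s * RtoC (ln (INR n)))).
Proof.
case: s => a b; rewrite /npow /cexp; apply: C_eq => /=.
- congr (exp _ * _); first ring.
  by rewrite -cos_neg; congr cos; ring.
- rewrite Ropp_mult_distr_r -sin_neg.
  by congr (exp _ * sin _); ring.
Qed.

Lemma npow_plus (n : nat) (s t : C) : npow n (s + t) = (npow n s * npow n t)%C.
Proof. by rewrite !npow_cexp -cexp_plus; congr cexp; ring. Qed.

Lemma INR_gt0 (n : nat) : (0 < n)%N -> 0 < INR n.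
Proof. by move=> h; apply: lt_0_INR; lia. Qed.

Lemma npow_mult (m n : nat) (s : C) : (0 < m)%N -> (0 < n)%N ->
  npow (m * n)%N s = (npow m s * npow n s)%C.
Proof.
move=> hm hn; rewrite !npow_cexp -cexp_plus mult_INR ln_mult; [|exact: INR_gt0..].
by congr cexp; rewrite RtoC_plus; ring.
Qed.

Lemma npow_1 (s : C) : npow 1 s = 1.
Proof. by rewrite npow_cexp /= ln_1 Cmult_0_r -cexp_0; congr cexp; ring. Qed.

Lemma Cmod_npow (n : nat) (s : C) : Cmod (npow n s) = exp (- (Re s * ln (INR n))).
Proof. by case: s => a b; rewrite npow_cexp Cmod_cexp /=; congr exp; ring. Qed.

Lemma npow_neq0 (n : nat) (s : C) : npow n s <> 0.
Proof. by rewrite npow_cexp; exact: cexp_neq0. Qed.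

Lemma ln_INR_ge0 (n : nat) : 0 <= ln (INR n).
Proof.
case: n => [|n]; first by rewrite /ln; destruct (Rlt_dec 0 (INR 0)) as [h|h]; [case: (Rlt_irrefl _ h) | lra].
rewrite -ln_1; case: n => [|n]; first by right.
left; apply: ln_increasing; first lra.
by rewrite !S_INR; have := pos_INR n; lra.
Qed.

Lemma Cmod_npow_le (n : nat) (s t : C) : Re s <= Re t -> Cmod (npow n t) <= Cmod (npow n s).
Proof.
move=> h; rewrite !Cmod_npow.
have h1 := ln_INR_ge0 n.
have h2 : - (Re t * ln (INR n)) <= - (Re s * ln (INR n)) by nra.
by case: h2 => [h2|->]; [left; exact: exp_increasing | right].
Qed.

(** First order expansion with an explicit increment [h]: no quotient occurs, so [h = 0] is no
    exception and estimates compose by hand. [is_derive_cdiff] identifies it with the derivative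
    used in [holomorphic_on]. *)
Definition cdiff (f : C -> C) (z l : C) : Prop :=
  forall eps, 0 < eps -> exists d, 0 < d /\
    forall h, Cmod h < d -> Cmod (f (z + h)%C - f z - l * h) <= eps * Cmod h.

Lemma is_derive_cdiff (f : C -> C) (z l : C) :
  is_derive (K := C_AbsRing) (V := C_NormedModule) f z l <-> cdiff f z l.
Proof.
split.
- move=> [_ /(_ z (fun P HP => HP)) h] eps he.
  have [[d hd] H] := h (mkposreal eps he).
  exists d; split=> // k hk.
  have {}H := H (z + k)%C.
  have e1 : (z + k + - z)%C = k by ring.
  unfold ball in H; simpl in H; unfold AbsRing_ball in H.
  rewrite /minus /plus /opp /norm /scal /= /abs /mult /= e1 in H.
  by rewrite (Cmult_comm l); exact: H.
- move=> h; split; first exact: is_linear_scal_l.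
  move=> x /(is_filter_lim_locally_unique (V := AbsRing_NormedModule C_AbsRing)) <-.
  move=> [eps he].
  have [d [hd H]] := h eps he.
  exists (mkposreal d hd) => y hy.
  unfold ball in hy; simpl in hy; unfold AbsRing_ball in hy.
  rewrite /minus /plus /opp /norm /scal /= /abs /mult /=.
  rewrite /minus /plus /opp /= /abs /= in hy.
  have := H (y + - z)%C hy.
  have -> : (z + (y + - z))%C = y by ring.
  by rewrite (Cmult_comm l).
Qed.

Lemma cdiff_ext_loc (f g : C -> C) (z l : C) (r : R) : 0 < r ->
  (forall x, Cmod (x - z) < r -> f x = g x) -> cdiff f z l -> cdiff g z l.
Proof.
move=> hr hfg hf eps he; have [d [hd H]] := hf eps he.
exists (Rmin d r); split; first exact: Rmin_pos.
move=> h hh; rewrite -!hfg.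
- by apply: H; apply: Rlt_le_trans hh (Rmin_l _ _).
- have -> : (z - z)%C = 0 by ring.
  by rewrite Cmod_0.
- have -> : (z + h - z)%C = h by ring.
  by apply: Rlt_le_trans hh (Rmin_r _ _).
Qed.

Lemma cdiff_eq (f : C -> C) (z l l' : C) : l = l' -> cdiff f z l -> cdiff f z l'.
Proof. by move=> ->. Qed.

Lemma cdiff_const (c z : C) : cdiff (fun=> c) z 0.
Proof.
move=> eps he; exists 1; split; first lra.
move=> h _; have -> : (c - c - 0 * h)%C = 0 by ring.
by rewrite Cmod_0; apply: Rmult_le_pos; [lra | exact: Cmod_ge_0].
Qed.

Lemma cdiff_id (z : C) : cdiff id z 1.
Proof.
move=> eps he; exists 1; split; first lra.
move=> h _; have -> : (z + h - z - 1 * h)%C = 0 by ring.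
by rewrite Cmod_0; apply: Rmult_le_pos; [lra | exact: Cmod_ge_0].
Qed.

Lemma cdiff_plus (f g : C -> C) (z a b : C) :
  cdiff f z a -> cdiff g z b -> cdiff (fun x => f x + g x)%C z (a + b)%C.
Proof.
move=> hf hg eps he.
have [d1 [hd1 H1]] := hf (eps / 2) ltac:(lra).
have [d2 [hd2 H2]] := hg (eps / 2) ltac:(lra).
exists (Rmin d1 d2); split; first exact: Rmin_pos.
move=> h hh.
have h1 := H1 h (Rlt_le_trans _ _ _ hh (Rmin_l _ _)).
have h2 := H2 h (Rlt_le_trans _ _ _ hh (Rmin_r _ _)).
have -> : (f (z + h) + g (z + h) - (f z + g z) - (a + b) * h =
  (f (z + h) - f z - a * h) + (g (z + h) - g z - b * h))%C by ring.
by apply: Rle_trans (Cmod_triangle _ _) _; lra.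
Qed.

Lemma cdiff_bound (f : C -> C) (z l : C) : cdiff f z l ->
  exists d, 0 < d /\ forall h, Cmod h < d -> Cmod (f (z + h)%C - f z) <= (Cmod l + 1) * Cmod h.
Proof.
move=> hf; have [d [hd H]] := hf 1 ltac:(lra).
exists d; split=> // h /H hh.
have -> : (f (z + h) - f z = (f (z + h) - f z - l * h) + l * h)%C by ring.
by apply: Rle_trans (Cmod_triangle _ _) _; rewrite Cmod_mult; lra.
Qed.

Lemma cdiff_comp (f g : C -> C) (z a b : C) :
  cdiff f z a -> cdiff g (f z) b -> cdiff (fun x => g (f x)) z (b * a)%C.
Proof.
move=> hf hg eps he.
have [d0 [hd0 H0]] := cdiff_bound _ _ _ hf.
have ha := Cmod_ge_0 a; have hb := Cmod_ge_0 b.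
have k1 : 0 < eps / 2 / (Cmod a + 1) by apply: Rdiv_lt_0_compat; lra.
have k2 : 0 < eps / 2 / (Cmod b + 1) by apply: Rdiv_lt_0_compat; lra.
have [d1 [hd1 H1]] := hg _ k1.
have [d2 [hd2 H2]] := hf _ k2.
have k3 : 0 < d1 / (Cmod a + 1) by apply: Rdiv_lt_0_compat; lra.
exists (Rmin d0 (Rmin d2 (d1 / (Cmod a + 1)))); split.
  by apply: Rmin_pos => //; apply: Rmin_pos.
move=> h hh.
have hh0 := Rlt_le_trans _ _ _ hh (Rmin_l _ _).
have hh' := Rlt_le_trans _ _ _ hh (Rmin_r _ _).
have hh1 := Rlt_le_trans _ _ _ hh' (Rmin_l _ _).
have hh2 := Rlt_le_trans _ _ _ hh' (Rmin_r _ _).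
have {}H0 := H0 h hh0.
have {}H2 := H2 h hh1.
have hk : Cmod (f (z + h)%C - f z) < d1.
  apply: Rle_lt_trans H0 _.
  have : Cmod h * (Cmod a + 1) < d1 / (Cmod a + 1) * (Cmod a + 1) by apply: Rmult_lt_compat_r; lra.
  by rewrite /Rdiv Rmult_assoc Rinv_l; lra.
have {}H1 := H1 _ hk.
have e : (f z + (f (z + h) - f z) = f (z + h))%C by ring.
rewrite e in H1.
have -> : (g (f (z + h)) - g (f z) - b * a * h =
  (g (f (z + h)) - g (f z) - b * (f (z + h) - f z)) + b * (f (z + h) - f z - a * h))%C by ring.
apply: Rle_trans (Cmod_triangle _ _) _; rewrite Cmod_mult.
have q1 : eps / 2 / (Cmod a + 1) * Cmod (f (z + h)%C - f z) <= eps / 2 * Cmod h.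
  have -> : eps / 2 * Cmod h = eps / 2 / (Cmod a + 1) * ((Cmod a + 1) * Cmod h) by field; lra.
  by apply: Rmult_le_compat_l; lra.
have q2 : Cmod b * Cmod (f (z + h)%C - f z - a * h) <= eps / 2 * Cmod h.
  have -> : eps / 2 * Cmod h = (Cmod b + 1) * (eps / 2 / (Cmod b + 1) * Cmod h) by field; lra.
  apply: Rmult_le_compat; try lra; exact: Cmod_ge_0.
lra.
Qed.

Lemma cdiff_scal (c : C) (f : C -> C) (z a : C) :
  cdiff f z a -> cdiff (fun x => c * f x)%C z (c * a)%C.
Proof.
move=> hf eps he.
have hc := Cmod_ge_0 c.
have k2 : 0 < eps / (Cmod c + 1) by apply: Rdiv_lt_0_compat; lra.
have [d [hd H]] := hf _ k2.
exists d; split=> // h hh.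
have -> : (c * f (z + h) - c * f z - c * a * h = c * (f (z + h) - f z - a * h))%C by ring.
rewrite Cmod_mult.
have -> : eps * Cmod h = (Cmod c + 1) * (eps / (Cmod c + 1) * Cmod h) by field; lra.
apply: Rmult_le_compat; try lra; try exact: Cmod_ge_0.
exact: H.
Qed.

Lemma cdiff_opp (f : C -> C) (z a : C) : cdiff f z a -> cdiff (fun x => - f x)%C z (- a)%C.
Proof.
move=> /(cdiff_scal (- (1))) h.
apply: (@cdiff_ext_loc (fun x => - (1) * f x)%C _ _ _ 1); first lra.
  by move=> x _; ring.
by apply: cdiff_eq h; ring.
Qed.

Lemma cdiff_minus (f g : C -> C) (z a b : C) :
  cdiff f z a -> cdiff g z b -> cdiff (fun x => f x - g x)%C z (a - b)%C.
Proof. by move=> hf /cdiff_opp; exact: cdiff_plus. Qed.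

Lemma cdiff_sqr (z : C) : cdiff (fun x => x * x)%C z (2 * z)%C.
Proof.
move=> eps he; exists eps; split=> // h hh.
have -> : ((z + h) * (z + h) - z * z - 2 * z * h = h * h)%C by ring.
by rewrite Cmod_mult; have := Cmod_ge_0 h; nra.
Qed.

(* Polarization reduces the product rule to the square. *)
Lemma cdiff_mult (f g : C -> C) (z a b : C) :
  cdiff f z a -> cdiff g z b -> cdiff (fun x => f x * g x)%C z (a * g z + f z * b)%C.
Proof.
move=> hf hg.
have h1 := cdiff_comp _ _ _ _ _ (cdiff_plus _ _ _ _ _ hf hg) (cdiff_sqr _).
have h2 := cdiff_comp _ _ _ _ _ (cdiff_minus _ _ _ _ _ hf hg) (cdiff_sqr _).
have h3 := cdiff_scal (/ RtoC 4) _ _ _ (cdiff_minus _ _ _ _ _ h1 h2).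
have n4 : RtoC 4 <> 0 by move=> /RtoC_inj; lra.
apply: (@cdiff_ext_loc _ _ _ _ 1); first lra; last first.
  apply: cdiff_eq h3.
  have -> : (RtoC 2 = RtoC 1 + RtoC 1)%C by rewrite -RtoC_plus; congr RtoC; ring.
  have e4 : (RtoC 4 = (RtoC 1 + RtoC 1) * (RtoC 1 + RtoC 1))%C by rewrite -RtoC_plus -RtoC_mult; congr RtoC; ring.
  rewrite e4; field; rewrite -RtoC_plus; split; move=> /RtoC_inj; lra.
move=> x _ /=.
have e4 : (RtoC 4 = (RtoC 1 + RtoC 1) * (RtoC 1 + RtoC 1))%C by rewrite -RtoC_plus -RtoC_mult; congr RtoC; ring.
rewrite e4; field; rewrite -RtoC_plus; move=> /RtoC_inj; lra.
Qed.

Lemma cdiff_csum (f g : nat -> C -> C) (r : seq nat) (z : C) :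
  (forall k, cdiff (f k) z (g k z)) ->
  cdiff (fun x => \csum_(k <- r) f k x)%C z (\csum_(k <- r) g k z).
Proof.
move=> h; elim: r => [|k r IHr].
  rewrite big_nil; apply: (@cdiff_ext_loc (fun=> RtoC 0) _ _ _ 1); first lra.
    by move=> x _; rewrite big_nil.
  exact: cdiff_const.
rewrite big_cons.
apply: (@cdiff_ext_loc (fun x => f k x + \csum_(k <- r) f k x)%C _ _ _ 1); first lra.
  by move=> x _; rewrite big_cons.
by apply: cdiff_plus.
Qed.

Lemma abs_sin_le (x : R) : Rabs (sin x) <= Rabs x.
Proof.
have [c [_ hc]] : exists c, Rmin 0 x <= c <= Rmax 0 x /\ sin x - sin 0 = cos c * (x - 0).
  apply: (MVT_gen sin 0 x cos) => t _; first by auto_derive; [| ring].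
  exact: (continuity_sin t).
rewrite sin_0 !Rminus_0_r in hc; rewrite hc Rabs_mult.
have : Rabs (cos c) <= 1 by apply: Rabs_le; have := COS_bound c; lra.
by have := Rabs_pos x; nra.
Qed.

Lemma cos_le_1_sqr (x : R) : 0 <= 1 - cos x <= x ^ 2 / 2.
Proof.
have -> : x = 2 * (x / 2) by field.
rewrite cos_2a_sin.
have h := abs_sin_le (x / 2).
have : Rsqr (sin (x / 2)) <= Rsqr (x / 2) by apply: Rsqr_le_abs_1.
by rewrite /Rsqr => h2; nra.
Qed.

Lemma sin_minus_id (x : R) : Rabs x <= 1 -> Rabs (sin x - x) <= x ^ 2.
Proof.
move=> hx.
have [c [hc1 hc]] : exists c, Rmin 0 x <= c <= Rmax 0 x /\ (sin x - x) - (sin 0 - 0) = (cos c - 1) * (x - 0).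
  apply: (MVT_gen (fun t => sin t - t) 0 x (fun t => cos t - 1)) => t _; first by auto_derive; [| ring].
  by apply: continuity_pt_minus; [exact: (continuity_sin t) | exact: continuity_pt_id].
rewrite sin_0 !Rminus_0_r in hc; rewrite hc Rabs_mult.
have h1 := cos_le_1_sqr c.
have hcx : Rabs c <= Rabs x.
  move: hc1; rewrite /Rmin /Rmax; case: Rle_dec => hh [q1 q2]; rewrite /Rabs; case: Rcase_abs; case: Rcase_abs; lra.
have h2 : Rabs (cos c - 1) <= Rabs x.
  rewrite -Rabs_Ropp Rabs_pos_eq; last lra.
  have : c ^ 2 <= Rabs x.
    rewrite -pow2_abs; have := Rabs_pos c; have := Rabs_pos x; nra.
  lra.
by rewrite -pow2_abs; have := Rabs_pos x; nra.
Qed.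

Lemma exp_minus_1_id (x : R) : Rabs x <= 1 / 2 -> 0 <= exp x - 1 - x <= 2 * x ^ 2.
Proof.
move=> hx; have hx' := proj1 (Rabs_le_between _ _) hx.
have h1 := exp_ineq1_le x.
(* The upper bound comes from [exp x <= 1 / (1 - x)], which at most equals [1 + x + 2 x^2] for
   [|x| <= 1/2]. *)
have h2 := exp_ineq1_le (- x).
split; first lra.
have e : exp x * exp (- x) = 1 by rewrite -exp_plus Rplus_opp_r exp_0.
have := exp_pos x; nra.
Qed.

(** By the functional equation everything reduces to the remainder of the exponential at 0, where
    [key] gives a quadratic bound; 12 is a generous constant collected from the bounds on [exp],
    [cos] and [sin]. *)
Lemma cdiff_cexp (z : C) : cdiff cexp z (cexp z).
Proof.
have key h : Cmod h <= 1 / 2 -> Cmod (cexp h - 1 - h) <= 12 * Cmod h ^ 2.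
  case: h => x y hh.
  have hx := Rle_trans _ _ _ (re_le_Cmod (x, y)) hh.
  have hy := Rle_trans _ _ _ (im_le_Cmod (x, y)) hh.
  rewrite /= in hx hy.
  have Ex := exp_minus_1_id _ hx.
  have Cy := cos_le_1_sqr y.
  have Sy := sin_minus_id y ltac:(lra).
  have m2 : Cmod (x, y) ^ 2 = x ^ 2 + y ^ 2 by rewrite Cmod2_alt.
  rewrite m2.
  apply: Rle_trans (Cmod_le_ReIm _) _.
  rewrite /=.
  have hx' := proj1 (Rabs_le_between _ _) hx.
  have hy' := proj1 (Rabs_le_between _ _) hy.
  have Sy' := proj1 (Rabs_le_between _ _) Sy.
  have b1 : 0 < exp x <= 2 by split; [exact: exp_pos | nra].
  have r1 : Rabs (exp x * cos y + - (1) + - x) <= 2 * x ^ 2 + y ^ 2.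
    apply: Rabs_le; split; nra.
  have r2 : Rabs (exp x * sin y + - 0 + - y) <= 6 * (x ^ 2 + y ^ 2).
    have -> : exp x * sin y + - 0 + - y = exp x * (sin y - y) + (exp x - 1) * y by ring.
    apply: Rle_trans (Rabs_triang _ _) _; rewrite !Rabs_mult.
    have q1 : Rabs (exp x) * Rabs (sin y - y) <= 2 * y ^ 2.
      apply: Rmult_le_compat => //; try exact: Rabs_pos.
      by rewrite Rabs_pos_eq; lra.
    have q2 : Rabs (exp x - 1) <= 2 * Rabs x.
      have -> : exp x - 1 = (exp x - 1 - x) + x by ring.
      apply: Rle_trans (Rabs_triang _ _) _; rewrite (Rabs_pos_eq (exp x - 1 - x)); last lra.
      have : x ^ 2 <= 1 / 2 * Rabs x by rewrite -pow2_abs; have := Rabs_pos x; nra.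
      lra.
    have q3 : Rabs x * Rabs y <= x ^ 2 + y ^ 2.
      rewrite -(pow2_abs x) -(pow2_abs y); have := Rabs_pos x; have := Rabs_pos y; nra.
    have q4 : Rabs (exp x - 1) * Rabs y <= 2 * (Rabs x * Rabs y) by have := Rabs_pos y; nra.
    nra.
  nra.
move=> eps he.
have hz : 0 < Cmod (cexp z) by rewrite Cmod_cexp; exact: exp_pos.
have hk : 0 < eps / (12 * Cmod (cexp z)) by apply: Rdiv_lt_0_compat; lra.
exists (Rmin (1 / 2) (eps / (12 * Cmod (cexp z)))); split; first by apply: Rmin_pos; lra.
move=> h hh.
have hh1 := Rlt_le_trans _ _ _ hh (Rmin_l _ _).
have hh2 := Rlt_le_trans _ _ _ hh (Rmin_r _ _).
rewrite cexp_plus.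
have -> : (cexp z * cexp h - cexp z - cexp z * h = cexp z * (cexp h - 1 - h))%C by ring.
rewrite Cmod_mult.
have h0 := Cmod_ge_0 h.
apply: Rle_trans (Rmult_le_compat_l _ _ _ (Rlt_le _ _ hz) (key h ltac:(lra))) _.
have q : 12 * Cmod (cexp z) * Cmod h <= eps.
  have := Rmult_lt_compat_l (12 * Cmod (cexp z)) _ _ ltac:(lra) hh2.
  have -> : 12 * Cmod (cexp z) * (eps / (12 * Cmod (cexp z))) = eps by field; lra.
  lra.
nra.
Qed.

Lemma cdiff_npow (n : nat) (s : C) : cdiff (npow n) s (- RtoC (ln (INR n)) * npow n s)%C.
Proof.
apply: (@cdiff_ext_loc (fun s => cexp (- RtoC (ln (INR n)) * s)) _ _ _ 1); first lra.
  by move=> x _; rewrite npow_cexp; congr cexp; ring.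
apply: cdiff_eq (cdiff_comp _ _ _ _ _ (cdiff_scal _ _ _ _ (cdiff_id s)) (cdiff_cexp _)).
rewrite npow_cexp Cmult_1_r Cmult_comm; congr (_ * cexp _)%C; rewrite /id; ring.
Qed.

(** * The Hilbert space of weighted coefficient sequences *)

Definition pos_weight (w : nat -> R) : Prop := forall n, (0 < n)%N -> 0 < w n.

Lemma pos_weight_of_le (w : nat -> R) :
  (forall n : nat, (1 <= n)%coq_nat -> 0 < w n) -> pos_weight w.
Proof. by move=> h n hn; apply: h; lia. Qed.

Definition sqterm (w : nat -> R) (a : nat -> C) (k : nat) : R := Cmod (a k.+1) ^ 2 * w k.+1.

(** The seminorm seeing the first [K] coefficients. Inequalities are proved for these finite sums
    and transferred to [normH] by [pnorm_le_normH] and [in_H_bound]. *)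
Definition pnorm (w : nat -> R) (K : nat) (a : nat -> C) : R :=
  sqrt (\rsum_(0 <= k < K) sqterm w a k).

Lemma sqterm_ge0 (w : nat -> R) (a : nat -> C) (k : nat) : pos_weight w -> 0 <= sqterm w a k.
Proof.
by move=> hw; apply: Rmult_le_pos; [exact: pow2_ge_0 | left; exact: hw].
Qed.

Lemma rsum_sqterm_ge0 (w : nat -> R) (a : nat -> C) (r : seq nat) : pos_weight w ->
  0 <= \rsum_(k <- r) sqterm w a k.
Proof. by move=> hw; apply: rsum_ge0 => k _; exact: sqterm_ge0. Qed.

Lemma pnorm_ge0 (w : nat -> R) (K : nat) (a : nat -> C) : 0 <= pnorm w K a.
Proof. exact: sqrt_pos. Qed.

Lemma pnorm_sqr (w : nat -> R) (K : nat) (a : nat -> C) : pos_weight w ->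
  pnorm w K a ^ 2 = \rsum_(0 <= k < K) sqterm w a k.
Proof. by move=> hw; rewrite /= Rmult_1_r sqrt_sqrt //; exact: rsum_sqterm_ge0. Qed.

Lemma sqrt_sqr_plus_Cmod (x y : R) : sqrt (x ^ 2 + y ^ 2) = Cmod (x, y).
Proof. by []. Qed.

Lemma pnorm_S (w : nat -> R) (K : nat) (a : nat -> C) : pos_weight w ->
  pnorm w K.+1 a = sqrt (pnorm w K a ^ 2 + (Cmod (a K.+1) * sqrt (w K.+1)) ^ 2).
Proof.
move=> hw; rewrite pnorm_sqr // /pnorm big_nat_recr //=.
congr sqrt; congr (_ + _); rewrite /sqterm.
have := sqrt_sqrt (w K.+1) ltac:(left; exact: hw) => h.
by rewrite -{1}h; ring.
Qed.

Lemma sqrt_sqr_mono (a b c d : R) : 0 <= a -> 0 <= c -> a <= b -> c <= d ->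
  sqrt (a ^ 2 + c ^ 2) <= sqrt (b ^ 2 + d ^ 2).
Proof. by move=> *; apply: sqrt_le_1_alt; nra. Qed.

(** Minkowski's inequality by induction on [K]: adjoining a coordinate turns the seminorm into the
    modulus of a pair, and the triangle inequality for [Cmod] applies to that pair. *)
Lemma pnorm_plus (w : nat -> R) (K : nat) (a b : nat -> C) : pos_weight w ->
  pnorm w K (seq_plus a b) <= pnorm w K a + pnorm w K b.
Proof.
move=> hw; elim: K => [|K IHK].
  by rewrite /pnorm !big_nil sqrt_0; lra.
rewrite !pnorm_S //.
have sw := sqrt_pos (w K.+1).
set s := sqrt (w K.+1) in sw *.
have t : Cmod (seq_plus a b K.+1) * s <= Cmod (a K.+1) * s + Cmod (b K.+1) * s.
  by have := Cmod_triangle (a K.+1) (b K.+1); rewrite /seq_plus; nra.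
apply: Rle_trans (sqrt_sqr_mono _ _ _ _ _ _ IHK t) _.
- exact: pnorm_ge0.
- by apply: Rmult_le_pos => //; exact: Cmod_ge_0.
rewrite !sqrt_sqr_plus_Cmod.
exact: (Cmod_triangle (_, _) (_, _)).
Qed.

Lemma pnorm_scal (w : nat -> R) (K : nat) (c : C) (a : nat -> C) :
  pnorm w K (seq_scal c a) = Cmod c * pnorm w K a.
Proof.
rewrite /pnorm.
rewrite (eq_bigr (fun k => Cmod c ^ 2 * sqterm w a k)); last first.
  by move=> k _; rewrite /sqterm /seq_scal Cmod_mult; ring.
rewrite -big_distrr sqrt_mult_alt; last exact: pow2_ge_0.
by rewrite sqrt_pow2 //; exact: Cmod_ge_0.
Qed.

Lemma pnorm_ext (w : nat -> R) (K : nat) (a b : nat -> C) :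
  (forall k, (0 < k)%N -> a k = b k) -> pnorm w K a = pnorm w K b.
Proof.
by move=> h; rewrite /pnorm; congr sqrt; apply: eq_bigr => k _; rewrite /sqterm h.
Qed.

Lemma pnorm_mono (w : nat -> R) (K K' : nat) (a : nat -> C) : pos_weight w -> (K <= K')%N ->
  pnorm w K a <= pnorm w K' a.
Proof.
move=> hw h; apply: sqrt_le_1_alt; rewrite (@rsum_nat_split _ K K') //.
by have := rsum_sqterm_ge0 w a (index_iota K K') hw; lra.
Qed.

Lemma normH_Series (w : nat -> R) (a : nat -> C) : normH w a = sqrt (Series (sqterm w a)).
Proof.
rewrite /normH /norm_of /ip /CSeries /=; congr sqrt; apply: Series_ext => k.
by rewrite /sqterm Cmod2_alt; case: (a k.+1) => x y /=; ring.
Qed.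

Lemma normH_ge0 (w : nat -> R) (a : nat -> C) : 0 <= normH w a.
Proof. exact: sqrt_pos. Qed.

Lemma pnorm_le_normH (w : nat -> R) (K : nat) (a : nat -> C) : pos_weight w -> in_H w a ->
  pnorm w K a <= normH w a.
Proof.
move=> hw [_ ha]; rewrite normH_Series; apply: sqrt_le_1_alt.
by apply: rsum_le_Series => // k; exact: sqterm_ge0.
Qed.

Lemma in_H_bound (w : nat -> R) (a : nat -> C) (B : R) : pos_weight w ->
  a 0%N = 0 -> (forall K, pnorm w K a <= B) -> in_H w a /\ normH w a <= B.
Proof.
move=> hw a0 hB.
have B0 : 0 <= B by apply: Rle_trans (hB 0%N); exact: pnorm_ge0.
have hs n : \rsum_(0 <= k < n) sqterm w a k <= B ^ 2.
  by rewrite -pnorm_sqr //; apply: pow_incr; split; [exact: pnorm_ge0 | exact: hB].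
have hex : ex_series (sqterm w a).
  by apply: ex_series_bounded hs => k; exact: sqterm_ge0.
split; first by split.
rewrite normH_Series -(sqrt_pow2 B) //; apply: sqrt_le_1_alt.
exact: Series_le_bound.
Qed.

Lemma in_H_ext (w : nat -> R) (a b : nat -> C) : (forall n, a n = b n) -> in_H w a -> in_H w b.
Proof.
move=> h [a0 ha]; split; first by rewrite -h.
by apply: ex_series_ext ha => k; rewrite h.
Qed.

Lemma normH_ext (w : nat -> R) (a b : nat -> C) : (forall n, a n = b n) -> normH w a = normH w b.
Proof. by move=> h; rewrite !normH_Series; congr sqrt; apply: Series_ext => k; rewrite /sqterm h. Qed.

Lemma in_H_plus_norm (w : nat -> R) (a b : nat -> C) : pos_weight w -> in_H w a -> in_H w b ->
  in_H w (seq_plus a b) /\ normH w (seq_plus a b) <= normH w a + normH w b.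
Proof.
move=> hw ha hb; apply: in_H_bound => //.
  by rewrite /seq_plus (proj1 ha) (proj1 hb) Cplus_0_l.
move=> K; apply: Rle_trans (pnorm_plus _ _ _ _ hw) _.
by apply: Rplus_le_compat; exact: pnorm_le_normH.
Qed.

Lemma in_H_scal_norm (w : nat -> R) (c : C) (a : nat -> C) : pos_weight w -> in_H w a ->
  in_H w (seq_scal c a) /\ normH w (seq_scal c a) <= Cmod c * normH w a.
Proof.
move=> hw ha; apply: in_H_bound => //.
  by rewrite /seq_scal (proj1 ha) Cmult_0_r.
move=> K; rewrite pnorm_scal; apply: Rmult_le_compat_l; first exact: Cmod_ge_0.
exact: pnorm_le_normH.
Qed.

Lemma seq_minus_plus (a b : nat -> C) (n : nat) : seq_plus a (seq_scal (- (1)) b) n = seq_minus a b n.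
Proof. by rewrite /seq_plus /seq_scal /seq_minus; ring. Qed.

Lemma in_H_minus (w : nat -> R) (a b : nat -> C) : pos_weight w -> in_H w a -> in_H w b ->
  in_H w (seq_minus a b).
Proof.
move=> hw ha hb; apply: in_H_ext (seq_minus_plus a b) _.
by apply: (proj1 (in_H_plus_norm _ _ _ hw ha _)); apply: (proj1 (in_H_scal_norm _ _ _ hw hb)).
Qed.

Lemma in_H_zero (w : nat -> R) : pos_weight w -> in_H w seq_zero.
Proof.
move=> hw; apply: (proj1 (in_H_bound w _ 0 hw _ _)) => // K.
rewrite /pnorm big1 ?sqrt_0; first lra.
by move=> k _; rewrite /sqterm Cmod_0; ring.
Qed.

Lemma coef_le_pnorm (w : nat -> R) (a : nat -> C) (n K : nat) : pos_weight w ->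
  (0 < n)%N -> (n <= K)%N -> Cmod (a n) * sqrt (w n) <= pnorm w K a.
Proof.
case: n => // n hw _ hn.
apply: Rle_trans (pnorm_mono _ _ _ _ hw hn).
rewrite pnorm_S // -{1}(sqrt_pow2 (Cmod (a n.+1) * sqrt (w n.+1))).
  by apply: sqrt_le_1_alt; have := pow2_ge_0 (pnorm w n a); lra.
by apply: Rmult_le_pos; [exact: Cmod_ge_0 | exact: sqrt_pos].
Qed.

Lemma coef_le_normH (w : nat -> R) (a : nat -> C) (n : nat) : pos_weight w -> in_H w a ->
  (0 < n)%N -> Cmod (a n) * sqrt (w n) <= normH w a.
Proof.
by move=> hw ha hn; apply: Rle_trans (coef_le_pnorm _ _ _ n hw hn _) (pnorm_le_normH _ _ _ hw ha).
Qed.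

Lemma pnorm_lim (w : nat -> R) (K : nat) (u : nat -> nat -> C) (a : nat -> C) : pos_weight w ->
  (forall n, clim (fun j => u j n) (a n)) ->
  is_lim_seq (fun j => pnorm w K (u j)) (pnorm w K a).
Proof.
move=> hw h.
have hs : is_lim_seq (fun j => \rsum_(0 <= k < K) sqterm w (u j) k) (\rsum_(0 <= k < K) sqterm w a k).
  elim: K => [|K IHK].
    rewrite big_nil; apply: is_lim_seq_ext (is_lim_seq_const 0) => j.
    by rewrite big_nil.
  rewrite big_nat_recr //=.
  apply: (is_lim_seq_ext (fun j => \rsum_(0 <= k < K) sqterm w (u j) k + sqterm w (u j) K)).
    by move=> j; rewrite [RHS]big_nat_recr.
  apply: is_lim_seq_plus' => //.
  have hc := clim_Cmod _ _ (h K.+1).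
  have hc2 := is_lim_seq_mult' _ _ _ _ hc hc.
  have := is_lim_seq_mult' _ _ _ _ hc2 (is_lim_seq_const (w K.+1)).
  rewrite /sqterm /= Rmult_1_r; apply: is_lim_seq_ext => j; ring.
apply: is_lim_seq_continuous hs.
by apply: continuity_pt_sqrt; exact: rsum_sqterm_ge0.
Qed.

Lemma in_H_complete (w : nat -> R) (u : nat -> nat -> C) : pos_weight w ->
  (forall j, in_H w (u j)) ->
  (forall eps : posreal, exists J : nat, forall i j : nat,
     (J <= i)%coq_nat -> (J <= j)%coq_nat -> normH w (seq_minus (u i) (u j)) < eps) ->
  exists a, in_H w a /\ is_lim_seq (fun j => normH w (seq_minus (u j) a)) 0.
Proof.
move=> hw hu hC.
have hc n : exists l, clim (fun j => u j n) l.
  case: n => [|n].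
    exists (RtoC 0); apply: clim_ext (clim_const 0) => j; by rewrite (proj1 (hu j)).
  apply: clim_cauchy => eps he.
  have hs : 0 < sqrt (w n.+1) by apply: sqrt_lt_R0; exact: hw.
  have [J hJ] := hC (mkposreal (eps * sqrt (w n.+1)) (Rmult_lt_0_compat _ _ he hs)).
  exists J => i j hi hij.
  have h1 := hJ j i ltac:(lia) ltac:(lia).
  have h2 : Cmod (u j n.+1 - u i n.+1) * sqrt (w n.+1) <= normH w (seq_minus (u j) (u i)).
    exact: coef_le_normH w _ n.+1 hw (in_H_minus _ _ _ hw (hu j) (hu i)) isT.
  apply: (Rmult_le_reg_r (sqrt (w n.+1))) => //.
  by rewrite /= in h1; lra.
pose a n := proj1_sig (constructive_indefinite_description _ (hc n)).
have ha n : clim (fun j => u j n) (a n) by rewrite /a; case: constructive_indefinite_description.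
(* For fixed [K] the Cauchy bound survives the limit in [j], since only finitely many coefficients
   enter; [K] is released afterwards by [in_H_bound]. *)
have key (eps : posreal) : exists J, forall i, (J <= i)%N -> forall K, pnorm w K (seq_minus (u i) a) <= eps.
  have [J hJ] := hC eps; exists J => i hi K.
  have hl : is_lim_seq (fun j => pnorm w K (seq_minus (u i) (u j))) (pnorm w K (seq_minus (u i) a)).
    by apply: pnorm_lim => // n; apply: clim_minus (clim_const _) (ha n).
  have h' : Rbar_le (pnorm w K (seq_minus (u i) a)) eps.
    apply: is_lim_seq_le_loc hl (is_lim_seq_const _); exists J => j hj.
    apply: Rle_trans (pnorm_le_normH _ _ _ hw (in_H_minus _ _ _ hw (hu i) (hu j))) _.
    by left; apply: hJ; lia.
  exact: h'.
have a0 : a 0%N = 0.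
  apply: clim_unique (ha 0%N) _.
  by apply: clim_ext (clim_const 0) => j; rewrite (proj1 (hu j)).
have hd i : seq_minus (u i) a 0%N = 0 by rewrite /seq_minus (proj1 (hu i)) a0; ring.
exists a; split.
  have [J hJ] := key (mkposreal 1 ltac:(lra)).
  have [h1 _] := in_H_bound w _ _ hw (hd J) (hJ J ltac:(lia)).
  apply: in_H_ext (in_H_minus _ _ _ hw (hu J) h1) => n.
  by rewrite /seq_minus; ring.
apply/is_lim_seq_eps; first by move=> j; exact: normH_ge0.
move=> eps he; have [J hJ] := key (mkposreal eps he).
exists J => j hj.
exact: (proj2 (in_H_bound w _ _ hw (hd j) (hJ j hj))).
Qed.

Lemma ip_csums (w : nat -> R) (a b : nat -> C) : pos_weight w -> in_H w a -> in_H w b ->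
  csums (fun k => a k.+1 * Cconj (b k.+1) * RtoC (w k.+1))%C (ip w a b).
Proof.
move=> hw [_ ha] [_ hb]; apply: csums_CSeries.
apply: ex_series_le_abs (ex_series_plus _ _ ha hb) => k.
rewrite Rabs_pos_eq; last exact: Cmod_ge_0.
rewrite !Cmod_mult Cmod_conj Cmod_R Rabs_pos_eq; last by left; exact: hw.
have := hw k.+1 isT; have := Cmod_ge_0 (a k.+1); have := Cmod_ge_0 (b k.+1).
set x := Cmod _; set y := Cmod _; set v := w _ => hx hy hv.
rewrite /plus /=.
have : x * y <= x ^ 2 + y ^ 2 by nra.
nra.
Qed.

Lemma csums_ext (u v : nat -> C) (l : C) : (forall k, u k = v k) -> csums u l -> csums v l.
Proof. by move=> h; apply: clim_ext => n; apply: eq_bigr => k _; exact: h. Qed.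

Lemma csums_plus (u v : nat -> C) (l m : C) :
  csums u l -> csums v m -> csums (fun k => u k + v k)%C (l + m)%C.
Proof.
move=> h1 h2; apply: clim_ext (clim_plus _ _ _ _ h1 h2) => n.
by rewrite -big_split.
Qed.

Lemma csums_scal (c : C) (u : nat -> C) (l : C) :
  csums u l -> csums (fun k => c * u k)%C (c * l)%C.
Proof.
move=> h1; apply: clim_ext (clim_mult _ _ _ _ (clim_const c) h1) => n.
by rewrite big_distrr.
Qed.

Lemma H_hilbert_space (w : nat -> R) : pos_weight w -> is_hilbert_space (in_H w) (ip w).
Proof.
move=> hw; split.
- exact: in_H_zero.
- by move=> a b ha hb; exact: (proj1 (in_H_plus_norm _ _ _ hw ha hb)).
- by move=> c a ha; exact: (proj1 (in_H_scal_norm _ c _ hw ha)).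
- move=> a b d ha hb hd; apply: CSeries_unique.
  apply: csums_ext (csums_plus _ _ _ _ (ip_csums _ _ _ hw ha hd) (ip_csums _ _ _ hw hb hd)) => k.
  by rewrite /seq_plus; ring.
- move=> c a b ha hb; apply: CSeries_unique.
  apply: csums_ext (csums_scal c _ _ (ip_csums _ _ _ hw ha hb)) => k.
  by rewrite /seq_scal; ring.
- move=> a b ha hb; apply: CSeries_unique.
  have /clim_ReIm[h1 h2] := ip_csums _ _ _ hw ha hb.
  apply/clim_ReIm; split.
  + apply: is_lim_seq_ext h1 => n; rewrite !Re_csum; apply: eq_bigr => k _.
    by rewrite /=; ring.
  + move/is_lim_seq_opp: h2; rewrite /=.
    apply: is_lim_seq_ext => n; rewrite !Im_csum (big_morph Ropp Ropp_plus_distr Ropp_0).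
    by apply: eq_bigr => k _ /=; ring.
- move=> a [_ ha].
  have := normH_Series w a; rewrite /normH /norm_of => h.
  have -> : Re (ip w a a) = Series (sqterm w a).
    rewrite /ip /CSeries /=; apply: Series_ext => k.
    by rewrite /sqterm Cmod2_alt; case: (a k.+1) => x y /=; ring.
  have := rsum_le_Series (sqterm w a) 0 (fun k => sqterm_ge0 w a k hw) ha.
  by rewrite big_nil.
- move=> a ha h0 [|n]; first exact: (proj1 ha).
  have h1 := coef_le_normH w a n.+1 hw ha isT.
  rewrite /normH /norm_of h0 /= sqrt_0 in h1.
  have hs : 0 < sqrt (w n.+1) by apply: sqrt_lt_R0; exact: hw.
  apply: Cmod_eq_0; have := Cmod_ge_0 (a n.+1); nra.
- by move=> u; exact: in_H_complete.
Qed.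

(** * Dirichlet convolution *)

Lemma is_primeP (p : nat) : is_prime p <-> prime p.
Proof.
split.
- move=> [h1 h2]; apply/primeP; split; first lia.
  move=> d hd; case: (posnP d) => [d0|dpos].
    by move: hd; rewrite d0 dvd0n => /eqP pp; lia.
  have hle := dvdn_leq (ltac:(lia) : (0 < p)%N) hd.
  case: (ltnP d p) => hlt; last by apply/orP; right; apply/eqP; lia.
  apply/orP; left; apply/eqP.
  have [_ _ h3] := h2 (Z.of_nat d) ltac:(lia).
  have q1 : (Z.of_nat d | Z.of_nat d)%Z by exists 1%Z; lia.
  have q2 : (Z.of_nat d | Z.of_nat p)%Z by move/dvdnP: hd => [k ->]; exists (Z.of_nat k); lia.
  have /Z.divide_1_r_nonneg : (Z.of_nat d | 1)%Z by exact: h3.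
  lia.
- move=> hp; have h1 := prime_gt1 hp; split; first lia.
  move=> n hn; constructor; [exact: Z.divide_1_l | exact: Z.divide_1_l |].
  move=> x hx1 hx2.
  have q1 : (Z.to_nat (Z.abs x) %| Z.to_nat n)%N.
    move: hx1 => [k hk]; apply/dvdnP; exists (Z.to_nat (Z.abs k)).
    by rewrite -[n]Z.abs_eq; last lia; rewrite hk Z.abs_mul; lia.
  have q2 : (Z.to_nat (Z.abs x) %| p)%N.
    move: hx2 => [k hk]; apply/dvdnP; exists (Z.to_nat (Z.abs k)).
    have : Z.of_nat p = (Z.abs k * Z.abs x)%Z by rewrite -Z.abs_mul; lia.
    lia.
  case/primeP: hp => _ /(_ _ q2) /orP[/eqP h|/eqP h].
    by apply/Z.divide_abs_l; exists 1%Z; lia.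
  have := dvdn_leq (ltac:(lia) : (0 < Z.to_nat n)%N) q1; lia.
Qed.

Lemma in_gen_P_mul (N m n : nat) : in_gen_P N m -> in_gen_P N n -> in_gen_P N (m * n)%N.
Proof.
move=> hm hn; elim: hm => [|p k hp _ IH]; first by rewrite mul1n.
by have -> : (p * k * n = p * (k * n))%N by [lia]; constructor.
Qed.

Lemma in_gen_P_dvd (N n d : nat) : in_gen_P N n -> (d %| n)%N -> in_gen_P N d.
Proof.
move=> hn; elim: hn d => [|p k hp _ IH] d hd.
  by move: hd; rewrite dvdn1 => /eqP ->; constructor.
have pp : prime p by apply/is_primeP; case: hp.
have pk : (p * k)%coq_nat = (p * k)%N by [].
rewrite pk in hd.
case: (boolP (p %| d)%N) => hpd; last by apply: IH; rewrite -(@Gauss_dvdr d p) // coprime_sym prime_coprime.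
move/dvdnP: hpd => [e he].
have -> : d = (p * e)%coq_nat by rewrite he mulnC.
constructor=> //; apply: IH.
by move: hd; rewrite he mulnC dvdn_pmul2l // prime_gt0.
Qed.

(** A prime factor of [n] is below [N], so fewer than [N] numbers, let alone primes, lie below it.
    The bound is crude, but it makes [proj N c] agree with [c] at all indices from 1 to [N - 1]. *)
Lemma in_gen_P_large (N n : nat) : (0 < n)%N -> (n < N)%N -> in_gen_P N n.
Proof.
elim/ltn_ind: n => n IH n0 nN.
case: (ltnP 1 n) => n1; last by have -> : n = 1%N by [lia]; constructor.
have hp := pdiv_prime n1.
have hd := pdiv_dvd n.
have e : n = (pdiv n * (n %/ pdiv n))%N by rewrite mulnC divnK.
have q0 : (0 < n %/ pdiv n)%N by rewrite divn_gt0 ?pdiv_gt0 //; exact: dvdn_leq.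
have ql : (n %/ pdiv n < n)%N by apply: ltn_Pdiv => //; exact: prime_gt1.
rewrite e; apply: gen_P_mul; last by apply: IH => //; lia.
split; first by apply/is_primeP.
apply: (Nat.le_lt_trans _ (length (List.seq 0 (pdiv n)))).
  exact: List.filter_length_le.
by rewrite List.length_seq; have := dvdn_leq n0 hd; lia.
Qed.

Lemma big_divisors_pairs (T : Type) (idx : T) (op : Monoid.com_law idx) (F : nat -> nat -> T)
    (n N : nat) : (0 < n)%N -> (n <= N)%N ->
  \big[op/idx]_(d <- divisors n) F d (n %/ d)%N =
  \big[op/idx]_(1 <= d < N.+1) \big[op/idx]_(1 <= e < N.+1 | (d * e == n)%N) F d e.
Proof.
move=> n0 nN.
transitivity (\big[op/idx]_(1 <= d < N.+1 | (d %| n)%N) F d (n %/ d)%N).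
  rewrite -[RHS]big_filter; apply: perm_big; apply: uniq_perm.
  - exact: divisors_uniq.
  - by apply: filter_uniq; exact: iota_uniq.
  - move=> d; rewrite -dvdn_divisors // mem_filter mem_index_iota.
    case: (boolP (d %| n)%N) => //= hd.
    have := dvdn_leq n0 hd; have := dvdn_gt0 n0 hd; lia.
rewrite big_mkcond; apply: eq_big_nat => d /andP[d1 dN].
case: (boolP (d %| n)%N) => hd.
  have hq : (n %/ d)%N \in index_iota 1 N.+1.
    rewrite mem_index_iota divn_gt0 // (dvdn_leq n0 hd) /=.
    by have := leq_div n d; lia.
  rewrite big_mkcond (bigD1_seq _ hq (iota_uniq _ _)) /= (mulnC d) divnK // eqxx.
  rewrite big1 ?Monoid.mulm1 // => e he.
  case: eqP => // hde; case/eqP: he; rewrite -hde mulKn //.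
rewrite big1 // => e /eqP hde.
by case/negP: hd; rewrite -hde dvdn_mulr.
Qed.

(** Summing a Dirichlet convolution up to [N] is summing over the lattice points under the hyperbola
    [d e = N]. The operation is abstract because both real and complex sums are rearranged this
    way. *)
Lemma big_conv_pairs (T : Type) (idx : T) (op : Monoid.com_law idx) (F : nat -> nat -> T) (N : nat) :
  \big[op/idx]_(1 <= n < N.+1) \big[op/idx]_(d <- divisors n) F d (n %/ d)%N =
  \big[op/idx]_(1 <= d < N.+1) \big[op/idx]_(1 <= e < N.+1 | (d * e <= N)%N) F d e.
Proof.
rewrite (eq_big_nat _ _ (F2 := fun n => \big[op/idx]_(1 <= d < N.+1)
  \big[op/idx]_(1 <= e < N.+1 | (d * e == n)%N) F d e)); last first.
  by move=> n /andP[h1 h2]; apply: big_divisors_pairs.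
rewrite exchange_big; apply: eq_big_nat => d /andP[d1 dN].
under eq_bigr do rewrite big_mkcond.
rewrite exchange_big [RHS]big_mkcond; apply: eq_big_nat => e /andP[e1 eN].
case: (leqP (d * e) N) => hde.
  have hin : (d * e)%N \in index_iota 1 N.+1 by rewrite mem_index_iota muln_gt0 d1 e1 /=; lia.
  rewrite (bigD1_seq _ hin (iota_uniq _ _)) /= eqxx big1 ?Monoid.mulm1 // => n.
  by rewrite eq_sym; case: eqP.
rewrite big_nat big1 // => n hn; case: eqP => // h; move: hn; lia.
Qed.

Definition conv (a b : nat -> C) (n : nat) : C :=
  \csum_(d <- divisors n) (a d * b (n %/ d)%N).

(** [divisors 0] is the one-element list of 1, so the junk value at 0 is [a 1 * b 0]; this keeps
    convolutions within the normalization of [in_H]. *)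
Lemma conv_0 (a b : nat -> C) : b 0%N = 0 -> conv a b 0 = 0.
Proof. by move=> h; rewrite /conv big_seq1 div0n h Cmult_0_r. Qed.

Lemma proj_in (N n : nat) (a : nat -> C) : in_gen_P N n -> proj N a n = a n.
Proof. by move=> h; rewrite /proj; case: in_gen_P_dec. Qed.

Lemma proj_out (N n : nat) (a : nat -> C) : ~ in_gen_P N n -> proj N a n = 0.
Proof. by move=> h; rewrite /proj; case: in_gen_P_dec. Qed.

(** A product lies in the generated set exactly when both factors do, so the projection is a
    homomorphism for convolution. *)
Lemma proj_conv (N : nat) (a b : nat -> C) (n : nat) : (0 < n)%N ->
  proj N (conv a b) n = conv (proj N a) (proj N b) n.
Proof.
move=> n0; case: (in_gen_P_dec N n) => h.
  rewrite proj_in //; apply: eq_big_seq => d; rewrite -dvdn_divisors // => hd.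
  rewrite !proj_in //; apply: in_gen_P_dvd h _ => //.
  exact: dvdn_div.
rewrite proj_out // /conv big_seq big1 // => d; rewrite -dvdn_divisors // => hd.
case: (in_gen_P_dec N d) => h1; last by rewrite (proj_out N d) // Cmult_0_l.
rewrite (proj_out N (n %/ d)%N) ?Cmult_0_r // => h2.
by apply: h; rewrite -(divnK hd) mulnC; exact: in_gen_P_mul.
Qed.

Lemma big_shift (T : Type) (idx : T) (op : T -> T -> T) (F : nat -> T) (N : nat) :
  \big[op/idx]_(0 <= k < N) F k.+1 = \big[op/idx]_(1 <= n < N.+1) F n.
Proof. by rewrite big_add1. Qed.

(** The square of side [m] lies under the hyperbola [d e = N] as soon as [m^2 <= N]. *)
Lemma rsum_pairs_ge (x y : nat -> R) (m N : nat) :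
  (forall n, 0 <= x n) -> (forall n, 0 <= y n) -> (m * m <= N)%N ->
  (\rsum_(1 <= d < m.+1) x d) * (\rsum_(1 <= e < m.+1) y e) <=
  \big[Rplus/0]_(1 <= d < N.+1) \big[Rplus/0]_(1 <= e < N.+1 | (d * e <= N)%N) (x d * y e).
Proof.
move=> hx hy hm.
have mN : (m.+1 <= N.+1)%N by have : (m <= m * m)%N by [case: m {hm} => // m; rewrite mulnS leq_addr]; lia.
rewrite big_distrl (big_cat_nat (ltac:(lia) : 1 <= m.+1)%N mN) /=.
have h1 : 0 <= \big[Rplus/0]_(m.+1 <= d < N.+1) \big[Rplus/0]_(1 <= e < N.+1 | (d * e <= N)%N) (x d * y e).
  by apply: rsum_ge0 => d _; apply: rsum_ge0 => e _; apply: Rmult_le_pos.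
suff : \big[Rplus/0]_(1 <= d < m.+1) (x d * (\rsum_(1 <= e < m.+1) y e)) <=
  \big[Rplus/0]_(1 <= d < m.+1) \big[Rplus/0]_(1 <= e < N.+1 | (d * e <= N)%N) (x d * y e) by lra.
apply: rsum_le => d; rewrite mem_index_iota => /andP[d1 dm] _.
rewrite big_distrr big_mkcond /= [X in _ <= X]big_mkcond (big_cat_nat (ltac:(lia) : 1 <= m.+1)%N mN) /=.
rewrite -[X in X <= _]Rplus_0_r; apply: Rplus_le_compat.
  apply: rsum_le => e; rewrite mem_index_iota => /andP[e1 em] _.
  have -> : (d * e <= N)%N by apply: leq_trans hm; apply: leq_mul; lia.
  by right.
by apply: rsum_ge0 => e _; case: ifP => _; [apply: Rmult_le_pos | right].
Qed.

Lemma rsum_pairs_le (x y : nat -> R) (N : nat) :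
  (forall n, 0 <= x n) -> (forall n, 0 <= y n) ->
  \big[Rplus/0]_(1 <= d < N.+1) \big[Rplus/0]_(1 <= e < N.+1 | (d * e <= N)%N) (x d * y e) <=
  (\rsum_(1 <= d < N.+1) x d) * (\rsum_(1 <= e < N.+1) y e).
Proof.
move=> hx hy; rewrite big_distrl; apply: rsum_le => d _ _ /=.
rewrite big_distrr big_mkcond; apply: rsum_le => e _ _ /=.
by case: ifP => _; [right | apply: Rmult_le_pos].
Qed.

Lemma Cmod_conv (f g : nat -> C) (n : nat) :
  Cmod (conv f g n) <= \big[Rplus/0]_(d <- divisors n) (Cmod (f d) * Cmod (g (n %/ d)%N)).
Proof.
apply: Rle_trans (Cmod_csum _ _ _) _; right.
by apply: eq_bigr => d _; rewrite Cmod_mult.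
Qed.

Lemma ex_series_conv (f g : nat -> C) :
  ex_series (fun k => Cmod (f k.+1)) -> ex_series (fun k => Cmod (g k.+1)) ->
  ex_series (fun k => Cmod (conv f g k.+1)).
Proof.
move=> hf hg.
apply: (@ex_series_bounded _ (Series (fun k => Cmod (f k.+1)) * Series (fun k => Cmod (g k.+1)))).
  by move=> k; exact: Cmod_ge_0.
move=> N; rewrite (big_shift _ _ _ (fun n => Cmod (conv f g n))).
apply: Rle_trans (rsum_le _ _ _ _ (fun n _ _ => Cmod_conv f g n)) _.
rewrite (big_conv_pairs _ _ _ (fun d e => Cmod (f d) * Cmod (g e))).
apply: Rle_trans (rsum_pairs_le (fun n => Cmod (f n)) (fun n => Cmod (g n)) N _ _) _ => [n|n|]; try exact: Cmod_ge_0.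
rewrite -!(big_shift _ _ _ (fun n => Cmod (_ n))).
apply: Rmult_le_compat; try (by apply: rsum_ge0 => k _; exact: Cmod_ge_0);
  by apply: rsum_le_Series => // k; exact: Cmod_ge_0.
Qed.

(** The product of partial sums runs over a square, the partial sum of the convolution over the
    region under a hyperbola. The discrepancy is bounded by the same discrepancy for the moduli,
    which is squeezed between the product of their partial sums up to [m] and the full product. *)
Lemma csums_conv (f g : nat -> C) (lf lg : C) :
  ex_series (fun k => Cmod (f k.+1)) -> ex_series (fun k => Cmod (g k.+1)) ->
  csums (fun k => f k.+1) lf -> csums (fun k => g k.+1) lg ->
  csums (fun k => conv f g k.+1) (lf * lg)%C.
Proof.
move=> hf hg cf cg.
set x := fun n => Cmod (f n); set y := fun n => Cmod (g n).
have x0 n : 0 <= x n by exact: Cmod_ge_0.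
have y0 n : 0 <= y n by exact: Cmod_ge_0.
have hd : clim (fun N => \csum_(0 <= k < N) conv f g k.+1 -
    (\csum_(0 <= k < N) f k.+1) * (\csum_(0 <= k < N) g k.+1))%C 0.
  apply/clim_eps => eps he.
  have hl := is_lim_seq_mult' _ _ _ _ (Series_lim _ hf) (Series_lim _ hg).
  set L := _ * _ in hl.
  have /is_lim_seq_spec/(_ (mkposreal eps he)) [m hm] := hl.
  exists (m * m)%N => N hN.
  rewrite !(big_shift _ _ _ (fun n => _ n)) /conv (big_conv_pairs _ _ _ (fun d e => f d * g e)%C) big_distrl.
  have -> : (\big[Cplus/RtoC 0]_(1 <= d < N.+1) \big[Cplus/RtoC 0]_(1 <= e < N.+1 | (d * e <= N)%N) (f d * g e) -
    \big[Cplus/RtoC 0]_(1 <= d < N.+1) (f d * \big[Cplus/RtoC 0]_(1 <= e < N.+1) g e) - 0 =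
    - \big[Cplus/RtoC 0]_(1 <= d < N.+1) \big[Cplus/RtoC 0]_(1 <= e < N.+1 | ~~ (d * e <= N)%N) (f d * g e))%C.
    have -> : \big[Cplus/RtoC 0]_(1 <= d < N.+1) (f d * \big[Cplus/RtoC 0]_(1 <= e < N.+1) g e)%C =
      (\big[Cplus/RtoC 0]_(1 <= d < N.+1) \big[Cplus/RtoC 0]_(1 <= e < N.+1 | (d * e <= N)%N) (f d * g e) +
      \big[Cplus/RtoC 0]_(1 <= d < N.+1) \big[Cplus/RtoC 0]_(1 <= e < N.+1 | ~~ (d * e <= N)%N) (f d * g e))%C.
      rewrite -big_split; apply: eq_bigr => d _.
      by rewrite big_distrr (bigID (fun e => d * e <= N)%N).
    ring.
  rewrite Cmod_opp.
  apply: Rle_trans (Cmod_csum _ _ _) _.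
  apply: (Rle_trans _ (\big[Rplus/0]_(1 <= d < N.+1) \big[Rplus/0]_(1 <= e < N.+1 | ~~ (d * e <= N)%N) (x d * y e))).
    apply: rsum_le => d _ _; apply: Rle_trans (Cmod_csum _ _ _) _; right.
    by apply: eq_bigr => e _; rewrite Cmod_mult.
  have e1 : (\rsum_(1 <= d < N.+1) x d) * (\rsum_(1 <= e < N.+1) y e) =
    \big[Rplus/0]_(1 <= d < N.+1) \big[Rplus/0]_(1 <= e < N.+1 | (d * e <= N)%N) (x d * y e) +
    \big[Rplus/0]_(1 <= d < N.+1) \big[Rplus/0]_(1 <= e < N.+1 | ~~ (d * e <= N)%N) (x d * y e).
    rewrite big_distrl -big_split; apply: eq_bigr => d _ /=.
    by rewrite big_distrr (bigID (fun e => d * e <= N)%N).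
  have e2 := rsum_pairs_ge x y m N x0 y0 hN.
  have e3 : (\rsum_(1 <= d < N.+1) x d) * (\rsum_(1 <= e < N.+1) y e) <= L.
    rewrite -!(big_shift _ _ _ (fun n => _ n)).
    apply: Rmult_le_compat; try (by apply: rsum_ge0);
    by apply: rsum_le_Series.
  have e4 : Rabs ((\rsum_(0 <= k < m) x k.+1) * (\rsum_(0 <= k < m) y k.+1) - L) < eps by exact: hm m (le_n m).
  move: e4; rewrite (big_shift _ _ _ x) (big_shift _ _ _ y) => /Rabs_lt_between e4.
  lra.
have := clim_plus _ _ _ _ hd (clim_mult _ _ _ _ cf cg).
rewrite Cplus_0_l; apply: clim_ext => N; ring.
Qed.

(** * Evaluation and uniqueness of Dirichlet series *)

Lemma wterm_npow (w : nat -> R) (s : C) (n : nat) :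
  wterm w (Re s) n = / w n * Cmod (npow n s) ^ 2.
Proof.
rewrite /wterm Cmod_npow /Rpower /= Rmult_1_r -exp_plus.
by congr (_ * exp _); ring.
Qed.

(** A termwise form of Cauchy-Schwarz. Summed with [lam] the inverse of the norm of [a], it yields
    the factor (1 + V) / 2 instead of the square root of V; a finite constant is all that the
    applications use. *)
Lemma dterm_amgm (w : nat -> R) (a : nat -> C) (s : C) (k : nat) (lam : R) :
  pos_weight w -> 0 < lam ->
  Cmod (dterm a s k) <= (lam * sqterm w a k + wterm w (Re s) k.+1 / lam) / 2.
Proof.
move=> hw hl; rewrite /dterm wterm_npow Cmod_mult /sqterm.
have hv := hw k.+1 isT.
set x := Cmod _; set y := Cmod _; set v := w _ in hv *.
have -> : (lam * (x ^ 2 * v) + / v * y ^ 2 / lam) / 2 =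
  x * y + (lam * v * x - y) ^ 2 / (lam * v) / 2 by field; split; lra.
have hlv : 0 < lam * v by exact: Rmult_lt_0_compat.
have : 0 <= (lam * v * x - y) ^ 2 / (lam * v).
  by apply: Rmult_le_pos; [exact: pow2_ge_0 | left; exact: Rinv_0_lt_compat].
lra.
Qed.

Lemma dterm_0 (a : nat -> C) (s : C) (k : nat) : a k.+1 = 0 -> dterm a s k = 0.
Proof. by move=> h; rewrite /dterm h Cmult_0_l. Qed.

(* [v] majorizes the weights only on the support of [a], so that the same bound serves
   the whole space and the subspaces of series supported on the numbers generated by
   finitely many primes. *)
Lemma point_evaluation_bound (w : nat -> R) (a : nat -> C) (s : C) (v : nat -> R) :
  pos_weight w -> in_H w a -> (forall k, 0 <= v k) -> ex_series v ->
  (forall k, a k.+1 <> 0 -> wterm w (Re s) k.+1 <= v k) ->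
  dconverges_abs a s /\ Series (fun k => Cmod (dterm a s k)) <= (1 + Series v) / 2 * normH w a.
Proof.
move=> hw ha v0 hv hsupp.
suff hb n : \rsum_(0 <= k < n) Cmod (dterm a s k) <= (1 + Series v) / 2 * normH w a.
  have hex : dconverges_abs a s by apply: ex_series_bounded hb => k; exact: Cmod_ge_0.
  by split=> //; apply: Series_le_bound.
have V0 : 0 <= Series v by have := rsum_le_Series v 0 v0 hv; rewrite big_nil.
have N0 := normH_ge0 w a.
case: (Req_dec (normH w a) 0) => hN.
  (* With norm 0 there is no [lam] to choose; instead every coefficient vanishes. *)
  rewrite hN Rmult_0_r big1; first by right.
  move=> k _; rewrite dterm_0 ?Cmod_0 //.
  have h1 := coef_le_normH w a k.+1 hw ha isT.
  have hs : 0 < sqrt (w k.+1) by apply: sqrt_lt_R0; exact: hw.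
  by apply: Cmod_eq_0; have := Cmod_ge_0 (a k.+1); nra.
set lam := / normH w a.
have hl : 0 < lam by apply: Rinv_0_lt_compat; lra.
apply: (Rle_trans _ (\rsum_(0 <= k < n) (lam / 2 * sqterm w a k + normH w a / 2 * v k))).
  apply: rsum_le => k _ _.
  case: (Ceq_dec (a k.+1) 0) => hk.
    rewrite dterm_0 // Cmod_0; apply: Rplus_le_le_0_compat; apply: Rmult_le_pos => //; try lra.
    exact: sqterm_ge0.
  apply: Rle_trans (dterm_amgm w a s k lam hw hl) _.
  have h1 := hsupp k hk.
  have -> : wterm w (Re s) k.+1 / lam = normH w a * wterm w (Re s) k.+1.
    by rewrite /lam /Rdiv Rinv_inv; ring.
  by have := Rmult_le_compat_l _ _ _ N0 h1; lra.
rewrite big_split /= -!big_distrr /=.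
have h1 := rsum_le_Series v n v0 hv.
have h2 : \rsum_(0 <= k < n) sqterm w a k <= normH w a ^ 2.
  rewrite -pnorm_sqr //; apply: pow_incr; split; [exact: pnorm_ge0 | exact: pnorm_le_normH].
have h3 : lam / 2 * (\rsum_(0 <= k < n) sqterm w a k) <= lam / 2 * normH w a ^ 2.
  by apply: Rmult_le_compat_l; lra.
have h4 : normH w a / 2 * (\rsum_(0 <= k < n) v k) <= normH w a / 2 * Series v.
  by apply: Rmult_le_compat_l; lra.
have e : lam / 2 * normH w a ^ 2 = normH w a / 2 by rewrite /lam; field.
lra.
Qed.

Lemma wterm_ge0 (w : nat -> R) (sigma : R) (k : nat) : pos_weight w -> 0 <= wterm w sigma k.+1.
Proof.
move=> hw; apply: Rmult_le_pos; left; last exact: exp_pos.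
by apply: Rinv_0_lt_compat; exact: hw.
Qed.

Lemma in_H_evaluation (w : nat -> R) (a : nat -> C) (s : C) :
  pos_weight w -> in_H w a -> ex_series (fun k => wterm w (Re s) k.+1) ->
  dconverges_abs a s /\
  Series (fun k => Cmod (dterm a s k)) <= (1 + Series (fun k => wterm w (Re s) k.+1)) / 2 * normH w a.
Proof.
move=> hw ha hs; apply: point_evaluation_bound => // [k|k _]; [exact: wterm_ge0 | by right].
Qed.

Lemma in_HN_evaluation (w : nat -> R) (N : nat) (a : nat -> C) (s : C) :
  pos_weight w -> in_HN w N a -> ex_series (fun k => wterm_P w N (Re s) k.+1) ->
  dconverges_abs a s /\
  Series (fun k => Cmod (dterm a s k)) <= (1 + Series (fun k => wterm_P w N (Re s) k.+1)) / 2 * normH w a.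
Proof.
move=> hw [ha hN] hs; apply: point_evaluation_bound => // k.
  by rewrite /wterm_P; case: in_gen_P_dec => _; [exact: wterm_ge0 | right].
move=> hk; rewrite /wterm_P; case: in_gen_P_dec => h; first by right.
by case: hk; apply: hN => //; lia.
Qed.

Lemma dsum_csums (a : nat -> C) (s : C) : dconverges_abs a s -> csums (dterm a s) (dsum a s).
Proof. exact: csums_CSeries. Qed.

Lemma Cmod_dsum_le (a : nat -> C) (s : C) : dconverges_abs a s ->
  Cmod (dsum a s) <= Series (fun k => Cmod (dterm a s k)).
Proof. exact: Cmod_CSeries_le. Qed.

Lemma dsum_plus (a b : nat -> C) (s : C) : dconverges_abs a s -> dconverges_abs b s ->
  dsum (seq_plus a b) s = (dsum a s + dsum b s)%C.
Proof.
move=> /dsum_csums ha /dsum_csums hb; apply: CSeries_unique.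
by apply: csums_ext (csums_plus _ _ _ _ ha hb) => k; rewrite /dterm /seq_plus; ring.
Qed.

Lemma dsum_scal (c : C) (a : nat -> C) (s : C) : dconverges_abs a s ->
  dsum (seq_scal c a) s = (c * dsum a s)%C.
Proof.
move=> /dsum_csums ha; apply: CSeries_unique.
by apply: csums_ext (csums_scal c _ _ ha) => k; rewrite /dterm /seq_scal; ring.
Qed.

Lemma dsum_ext (a b : nat -> C) (s : C) : (forall n, (0 < n)%N -> a n = b n) -> dsum a s = dsum b s.
Proof.
by move=> h; rewrite /dsum /CSeries; congr pair; apply: Series_ext => k; rewrite /dterm h.
Qed.

Lemma dconverges_abs_ext (a b : nat -> C) (s : C) : (forall n, (0 < n)%N -> a n = b n) ->
  dconverges_abs a s -> dconverges_abs b s.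
Proof. by move=> h; apply: ex_series_ext => k; rewrite /dterm h. Qed.

Lemma dconverges_abs_plus (a b : nat -> C) (s : C) : dconverges_abs a s -> dconverges_abs b s ->
  dconverges_abs (seq_plus a b) s.
Proof.
move=> ha hb; apply: ex_series_le_abs (ex_series_plus _ _ ha hb) => k.
rewrite Rabs_pos_eq; last exact: Cmod_ge_0.
apply: Rle_trans (Cmod_triangle _ _); right; congr Cmod.
by rewrite /dterm /seq_plus; ring.
Qed.

Lemma dconverges_abs_scal (c : C) (a : nat -> C) (s : C) : dconverges_abs a s ->
  dconverges_abs (seq_scal c a) s.
Proof.
move=> ha; apply: ex_series_ext (ex_series_scal (Cmod c) _ ha) => k.
by rewrite /scal /= /mult /= -Cmod_mult; congr Cmod; rewrite /dterm /seq_scal; ring.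
Qed.

Lemma dsum_minus (a b : nat -> C) (s : C) : dconverges_abs a s -> dconverges_abs b s ->
  dconverges_abs (seq_minus a b) s /\ dsum (seq_minus a b) s = (dsum a s - dsum b s)%C.
Proof.
move=> ha hb.
have hb' := dconverges_abs_scal (- (1)) _ _ hb.
split; first by apply: dconverges_abs_ext (dconverges_abs_plus _ _ _ ha hb') => n _; exact: seq_minus_plus.
rewrite -(dsum_ext (seq_plus a (seq_scal (- (1)) b))); last by move=> n _; exact: seq_minus_plus.
by rewrite dsum_plus // dsum_scal //; ring.
Qed.

Lemma dconverges_abs_mono (a : nat -> C) (s t : C) : Re s <= Re t ->
  dconverges_abs a s -> dconverges_abs a t.
Proof.
move=> h; apply: ex_series_le_abs => k.
rewrite Rabs_pos_eq; last exact: Cmod_ge_0.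
rewrite /dterm !Cmod_mult; apply: Rmult_le_compat_l; first exact: Cmod_ge_0.
exact: Cmod_npow_le.
Qed.

Lemma dterm_conv (a b : nat -> C) (s : C) (k : nat) :
  dterm (conv a b) s k = conv (fun n => a n * npow n s)%C (fun n => b n * npow n s)%C k.+1.
Proof.
rewrite /dterm /conv big_distrl; apply: eq_big_seq => d; rewrite -dvdn_divisors // => hd /=.
have d0 := dvdn_gt0 (ltn0Sn k) hd.
have q0 : (0 < k.+1 %/ d)%N by rewrite divn_gt0 // dvdn_leq.
have -> : npow k.+1 s = (npow d s * npow (k.+1 %/ d)%N s)%C.
  by rewrite -npow_mult // mulnC divnK.
ring.
Qed.

Lemma dsum_conv (a b : nat -> C) (s : C) : dconverges_abs a s -> dconverges_abs b s ->
  dconverges_abs (conv a b) s /\ dsum (conv a b) s = (dsum a s * dsum b s)%C.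
Proof.
move=> ha hb; split.
  have := ex_series_conv (fun n => a n * npow n s)%C (fun n => b n * npow n s)%C ha hb.
  by apply: ex_series_ext => k; rewrite dterm_conv.
apply: CSeries_unique.
apply: csums_ext (csums_conv (fun n => a n * npow n s)%C (fun n => b n * npow n s)%C _ _ ha hb (dsum_csums _ _ ha) (dsum_csums _ _ hb)) => k.
by rewrite dterm_conv.
Qed.

Lemma Cmod_npow_shift (n : nat) (x : R) (m : nat) : (0 < n)%N ->
  Cmod (npow n (RtoC (x + INR m))) = Cmod (npow n (RtoC x)) * (/ INR n) ^ m.
Proof.
move=> n0; rewrite !Cmod_npow /=.
have hn := INR_gt0 n n0.
have -> : / INR n = exp (- ln (INR n)) by rewrite exp_Ropp exp_ln.
have -> : exp (- ln (INR n)) ^ m = exp (- (INR m * ln (INR n))).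
  elim: m => [|m IH]; first by rewrite /= Rmult_0_l Ropp_0 exp_0.
  by rewrite -tech_pow_Rmult IH -exp_plus S_INR; congr exp; ring.
by rewrite -exp_plus; congr exp; ring.
Qed.

(* On the real axis the first nonvanishing term dominates at infinity. *)
Lemma dseries_zero (f : nat -> C) (x : R) :
  dconverges_abs f (RtoC x) -> (forall m : nat, dsum f (RtoC (x + INR m)) = 0) ->
  forall n, (0 < n)%N -> f n = 0.
Proof.
move=> hf h0; elim/ltn_ind => -[//|n] IH _.
set A := Series (fun k => Cmod (dterm f (RtoC x) k)).
have hA K : \rsum_(0 <= k < K) Cmod (dterm f (RtoC x) k) <= A.
  by apply: rsum_le_Series => // k; exact: Cmod_ge_0.
have key m : Cmod (dterm f (RtoC (x + INR m)) n) <= A * (/ INR n.+2) ^ m.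
  have hm : dconverges_abs f (RtoC (x + INR m)).
    by apply: dconverges_abs_mono hf => /=; have := pos_INR m; lra.
  have hc := clim_Cmod _ _ (dsum_csums _ _ hm); rewrite h0 Cmod_0 in hc.
  have hle : Rbar_le (Cmod (dterm f (RtoC (x + INR m)) n) - A * (/ INR n.+2) ^ m) 0.
    apply: is_lim_seq_le_loc (is_lim_seq_const _) hc.
    exists n.+1 => K hK.
    rewrite (@csum_nat_split _ n.+1 K); last lia.
    rewrite big_nat_recr //= big_nat big1 ?Cplus_0_l; last first.
      by move=> k /andP[_ hk]; apply: dterm_0; apply: IH.
    set t := dterm _ _ _; set r := \big[_/_]_(n.+1 <= k < K) _.
    have ht : Cmod t <= Cmod (t + r) + Cmod r.
      have -> : Cmod t = Cmod ((t + r) + (- r)) by congr Cmod; ring.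
      by apply: Rle_trans (Cmod_triangle _ _) _; rewrite Cmod_opp; right.
    suff hr : Cmod r <= A * (/ INR n.+2) ^ m.
      by change (Cmod t - A * (/ INR n.+2) ^ m <= Cmod (t + r)); lra.
    apply: Rle_trans (Cmod_csum _ _ _) _.
    apply: (Rle_trans _ (\rsum_(n.+1 <= k < K) (Cmod (dterm f (RtoC x) k) * (/ INR n.+2) ^ m))).
      apply: rsum_le => k; rewrite mem_index_iota => /andP[hk _] _.
      rewrite /dterm !Cmod_mult Cmod_npow_shift // -Rmult_assoc.
      apply: Rmult_le_compat_l.
        by apply: Rmult_le_pos; exact: Cmod_ge_0.
      apply: pow_incr; split; first by left; apply: Rinv_0_lt_compat; exact: INR_gt0.
      by apply: Rinv_le_contravar; [exact: INR_gt0 | apply: le_INR; lia].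
    rewrite -big_distrl; apply: Rmult_le_compat_r.
      by apply: pow_le; left; apply: Rinv_0_lt_compat; exact: INR_gt0.
    have := hA K; rewrite (@rsum_nat_split _ n.+1 K); last lia.
    have : 0 <= \rsum_(0 <= k < n.+1) Cmod (dterm f (RtoC x) k).
      by apply: rsum_ge0 => k _; exact: Cmod_ge_0.
    by rewrite /=; lra.
  have hle' : Cmod (dterm f (RtoC (x + INR m)) n) - A * (/ INR n.+2) ^ m <= 0 by exact: hle.
  lra.
have p1 := INR_gt0 n.+1 isT; have p2 := INR_gt0 n.+2 isT.
have p12 : INR n.+1 < INR n.+2 by apply: lt_INR; lia.
(* Multiplying [key] by [(n+1)^m] leaves a fixed quantity on the left and [A q^m] on the right,
   which tends to 0. *)
set q := INR n.+1 / INR n.+2.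
have hq : Rabs q < 1.
  rewrite Rabs_pos_eq; last by left; exact: Rdiv_lt_0_compat.
  by apply/Rlt_div_l; lra.
have hlim : is_lim_seq (fun m => A * q ^ m) 0.
  have := is_lim_seq_mult' _ _ _ _ (is_lim_seq_const A) (is_lim_seq_geom q hq).
  by rewrite Rmult_0_r.
have hle : Rbar_le (Cmod (dterm f (RtoC x) n)) 0.
  apply: is_lim_seq_le (is_lim_seq_const _) hlim => m.
  have := key m; rewrite /dterm !Cmod_mult Cmod_npow_shift // -Rmult_assoc.
  set y := Cmod _ * Cmod _ => hy.
  have pp : 0 < INR n.+1 ^ m by exact: pow_lt.
  have := Rmult_le_compat_r _ _ _ (Rlt_le _ _ pp) hy.
  rewrite /q /Rdiv Rpow_mult_distr !Rmult_assoc -Rpow_mult_distr Rinv_l; last lra.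
  by rewrite pow1 Rmult_1_r (Rmult_comm ((/ _) ^ m)).
have {}hle : Cmod (dterm f (RtoC x) n) <= 0 by exact: hle.
have : dterm f (RtoC x) n = 0.
  by apply: Cmod_eq_0; have := Cmod_ge_0 (dterm f (RtoC x) n); lra.
case: (Ceq_dec (f n.+1) 0) => // hne heq.
by case: (Cmult_neq_0 _ _ hne (npow_neq0 n.+1 (RtoC x)) heq).
Qed.

Lemma dseries_unique (a b : nat -> C) (sigma : R) :
  (forall s, half_plane sigma s -> dconverges_abs a s /\ dconverges_abs b s) ->
  (forall s, half_plane sigma s -> dsum a s = dsum b s) ->
  forall n, (0 < n)%N -> a n = b n.
Proof.
move=> hc heq n n0.
have hin m : half_plane sigma (RtoC (sigma + 1 + INR m)).
  by rewrite /half_plane /=; have := pos_INR m; lra.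
have h : seq_minus a b n = 0.
  apply: (dseries_zero (seq_minus a b) (sigma + 1)) => //.
    have := hin 0%N; rewrite /= Rplus_0_r => /hc[ha hb].
    exact: (proj1 (dsum_minus _ _ _ ha hb)).
  move=> m; have [ha hb] := hc _ (hin m).
  by rewrite (proj2 (dsum_minus _ _ _ ha hb)) heq //; ring.
have -> : a n = (seq_minus a b n + b n)%C by rewrite /seq_minus; ring.
by rewrite h Cplus_0_l.
Qed.

Lemma H_rkhs (w : nat -> R) (sigma : R) : pos_weight w ->
  (forall sigma' : R, sigma < sigma' -> ex_series (fun k => wterm w sigma' k.+1)) ->
  is_rkhs (half_plane sigma) (in_H w) (ip w) dsum.
Proof.
move=> hw hs.
have hc a s : in_H w a -> half_plane sigma s -> dconverges_abs a s.
  by move=> ha hss; exact: (proj1 (in_H_evaluation _ _ _ hw ha (hs _ hss))).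
split.
- exact: H_hilbert_space.
- move=> a b ha hb heq [|n]; first by rewrite (proj1 ha) (proj1 hb).
  by apply: (dseries_unique a b sigma) => // s hss; split; exact: hc.
- by move=> s a b hss ha hb; apply: dsum_plus; exact: hc.
- by move=> s c a hss ha; apply: dsum_scal; exact: hc.
- move=> s hss a ha eps.
  set V := Series (fun k => wterm w (Re s) k.+1).
  have V0 : 0 <= V.
    have := rsum_le_Series (fun k => wterm w (Re s) k.+1) 0 (fun k => wterm_ge0 w _ k hw) (hs _ hss).
    by rewrite big_nil.
  have he : 0 < eps / ((1 + V) / 2) by apply: Rdiv_lt_0_compat; [exact: cond_pos | lra].
  exists (mkposreal _ he) => b hb /= hlt.
  rewrite -(proj2 (dsum_minus _ _ _ (hc _ _ hb hss) (hc _ _ ha hss))).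
  have [h1 h2] := in_H_evaluation _ _ _ hw (in_H_minus _ _ _ hw hb ha) (hs _ hss).
  apply: Rle_lt_trans (Cmod_dsum_le _ _ h1) _; apply: Rle_lt_trans h2 _.
  have := Rmult_lt_compat_l ((1 + V) / 2) _ _ ltac:(lra) hlt.
  have -> : (1 + V) / 2 * (eps / ((1 + V) / 2)) = eps by field; lra.
  by [].
Qed.

(** * Uniform boundedness *)

Definition is_seq_linear (T : (nat -> C) -> nat -> C) : Prop :=
  (forall a b n, T (seq_plus a b) n = seq_plus (T a) (T b) n) /\
  (forall c a n, T (seq_scal c a) n = seq_scal c (T a) n).

(* The "gliding hump" x = sum_k +- 3^-k u_k of Sokal's proof of the uniform boundedness
   principle; the signs are chosen so that the k-th seminorm does not shrink at step k. *)
Fixpoint hump (p : nat -> (nat -> C) -> R) (u : nat -> nat -> C) (k : nat) : nat -> C :=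
  if k is j.+1 then
    let y := seq_scal (RtoC ((/ 3) ^ k)) (u k) in
    if Rle_dec (p k y) (p k (seq_plus (hump p u j) y)) then seq_plus (hump p u j) y
    else seq_minus (hump p u j) y
  else seq_zero.

Lemma pow_third_pos (k : nat) : 0 < (/ 3) ^ k.
Proof. by apply: pow_lt; lra. Qed.

Lemma hump_step (w : nat -> R) (p : nat -> (nat -> C) -> R) (u : nat -> nat -> C) (k : nat) :
  pos_weight w -> (forall j, in_H w (u j) /\ normH w (u j) <= 1) ->
  in_H w (hump p u k) ->
  in_H w (hump p u k.+1) /\
  normH w (seq_minus (hump p u k.+1) (hump p u k)) <= (/ 3) ^ k.+1.
Proof.
move=> hw hu hk.
have [hu1 hu2] := hu k.+1.
have h3 := pow_third_pos k.+1.
have [hy1 hy2] := in_H_scal_norm w (RtoC ((/ 3) ^ k.+1)) _ hw hu1.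
have [hy3 hy4] := in_H_scal_norm w (RtoC (- (/ 3) ^ k.+1)) _ hw hu1.
rewrite Cmod_R Rabs_pos_eq in hy2; last lra.
rewrite Cmod_R Rabs_Ropp Rabs_pos_eq in hy4; last lra.
have hle : (/ 3) ^ k.+1 * normH w (u k.+1) <= (/ 3) ^ k.+1 by nra.
have -> : hump p u k.+1 = let y := seq_scal (RtoC ((/ 3) ^ k.+1)) (u k.+1) in
    if Rle_dec (p k.+1 y) (p k.+1 (seq_plus (hump p u k) y)) then seq_plus (hump p u k) y
    else seq_minus (hump p u k) y by [].
cbv zeta.
case: (Rle_dec _ _) => [?|?]; rewrite [is_left _]/=; split.
- exact: (proj1 (in_H_plus_norm _ _ _ hw hk hy1)).
- rewrite (normH_ext w _ (seq_scal (RtoC ((/ 3) ^ k.+1)) (u k.+1))); first lra.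
  by move=> n; rewrite /seq_minus /seq_plus; ring.
- exact: in_H_minus.
- rewrite (normH_ext w _ (seq_scal (RtoC (- (/ 3) ^ k.+1)) (u k.+1))); first lra.
  move=> n; rewrite /seq_minus /seq_scal RtoC_opp; ring.
Qed.

(** The seminorms [pnorm w K (T a)] are individually bounded by constants that may grow with [K],
    and for each [a] they are jointly bounded by [normH w (T a)]. Without a uniform bound, the limit
    [x] of the humps would have an image of norm at least [k / 3] for every [k]. *)
Lemma uniform_boundedness (w : nat -> R) (T : (nat -> C) -> nat -> C) (CK : nat -> R) :
  pos_weight w -> is_seq_linear T ->
  (forall a, in_H w a -> in_H w (T a)) ->
  (forall K a, in_H w a -> pnorm w K (T a) <= CK K * normH w a) ->
  exists B, forall a, in_H w a -> normH w (T a) <= B * normH w a.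
Proof.
move=> hw [Tplus Tscal] TH TK.
have pT_plus K a b : pnorm w K (T (seq_plus a b)) <= pnorm w K (T a) + pnorm w K (T b).
  by rewrite (pnorm_ext w K _ (seq_plus (T a) (T b))) //; exact: pnorm_plus.
have pT_scal K c a : pnorm w K (T (seq_scal c a)) = Cmod c * pnorm w K (T a).
  by rewrite (pnorm_ext w K _ (seq_scal c (T a))) //; exact: pnorm_scal.
have pT_ext K a b : (forall n, a n = b n) -> pnorm w K (T a) = pnorm w K (T b).
  by move=> h; rewrite (FunctionalExtensionality.functional_extensionality _ _ h).
have pT_minus K a b : pnorm w K (T a) <= pnorm w K (T b) + pnorm w K (T (seq_minus a b)).
  rewrite (pT_ext K a (seq_plus b (seq_minus a b))); first exact: pT_plus.
  by move=> n; rewrite /seq_plus /seq_minus; ring.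
apply: NNPP => hno.
have big B : exists K a, in_H w a /\ normH w a <= 1 /\ B < pnorm w K (T a).
  apply: NNPP => hb; apply: hno; exists (Rmax B 0) => a ha.
  have hB0 := Rmax_r B 0; have hBB := Rmax_l B 0.
  have Ta := TH _ ha.
  apply: (proj2 (in_H_bound w (T a) _ hw (proj1 Ta) _)) => K.
  have N0 := normH_ge0 w a.
  case: (Rle_lt_dec (pnorm w K (T a)) (Rmax B 0 * normH w a)) => // hlt; exfalso; apply: hb.
  case: (Req_dec (normH w a) 0) => hN.
    by have := TK K a ha; rewrite hN in hlt *; lra.
  have hi : 0 < / normH w a by apply: Rinv_0_lt_compat; lra.
  have [h1 h2] := in_H_scal_norm w (RtoC (/ normH w a)) _ hw ha.
  rewrite Cmod_R Rabs_pos_eq in h2; last lra.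
  exists K, (seq_scal (RtoC (/ normH w a)) a); split=> //; split.
    by rewrite Rinv_l in h2.
  rewrite pT_scal Cmod_R Rabs_pos_eq; last lra.
  have := Rmult_lt_compat_l _ _ _ hi hlt.
  have -> : / normH w a * (Rmax B 0 * normH w a) = Rmax B 0 by field.
  lra.
(* The supremum [l] of the seminorm over the unit ball need not be attained. A vector reaching more
   than [3/4] of it gives the factor [4/3], and starting above [4/3 * (3^k * k)] keeps its value
   above [3^k * k]. *)
have near_opt k : exists Ku : nat * (nat -> C), in_H w Ku.2 /\ normH w Ku.2 <= 1 /\
    3 ^ k * INR k <= pnorm w Ku.1 (T Ku.2) /\
    forall a, in_H w a -> pnorm w Ku.1 (T a) <= 4 / 3 * pnorm w Ku.1 (T Ku.2) * normH w a.
  have hB0 : 0 <= 3 ^ k * INR k by apply: Rmult_le_pos; [apply: pow_le; lra | exact: pos_INR].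
  have [K [a0 [ha0 [hn0 hlt]]]] := big (4 / 3 * (3 ^ k * INR k)).
  pose E x := exists a, in_H w a /\ normH w a <= 1 /\ x = pnorm w K (T a).
  have Ebd : bound E.
    exists (Rabs (CK K)) => x [a [ha [hn ->]]].
    apply: Rle_trans (TK K a ha) _.
    have := Rle_abs (CK K); have := Rabs_pos (CK K); have := normH_ge0 w a; nra.
  have [l [lub1 lub2]] := completeness E Ebd (ex_intro _ _ (ex_intro _ a0 (conj ha0 (conj hn0 erefl)))).
  have hl0 : pnorm w K (T a0) <= l by apply: lub1; exists a0.
  have hlpos : 0 < l by lra.
  have [u [hu [hun hul]]] : exists u, in_H w u /\ normH w u <= 1 /\ 3 / 4 * l < pnorm w K (T u).
    apply: NNPP => hc.
    have : l <= 3 / 4 * l.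
      apply: lub2 => x [a [ha [hn ->]]]; apply: Rnot_lt_le => hh.
      by apply: hc; exists a.
    lra.
  exists (K, u); split=> //; split=> //=; split; first lra.
  move=> a ha.
  have N0 := normH_ge0 w a.
  case: (Req_dec (normH w a) 0) => hN.
    by have := TK K a ha; rewrite hN; lra.
  have hi : 0 < / normH w a by apply: Rinv_0_lt_compat; lra.
  have [h1 h2] := in_H_scal_norm w (RtoC (/ normH w a)) _ hw ha.
  have h3 : Cmod (RtoC (/ normH w a)) * pnorm w K (T a) <= l.
    apply: lub1; exists (seq_scal (RtoC (/ normH w a)) a); split=> //; split; last by rewrite pT_scal.
    by rewrite Cmod_R Rabs_pos_eq in h2; [rewrite Rinv_l in h2 | lra].
  rewrite Cmod_R Rabs_pos_eq in h3; last lra.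
  have h4 := Rmult_le_compat_l _ _ _ N0 h3.
  rewrite -Rmult_assoc Rinv_r // Rmult_1_l in h4.
  by apply: Rle_trans h4 _; nra.
pose Ku k := proj1_sig (constructive_indefinite_description _ (near_opt k)).
have hKu k : in_H w (Ku k).2 /\ normH w (Ku k).2 <= 1 /\
    3 ^ k * INR k <= pnorm w (Ku k).1 (T (Ku k).2) /\
    forall a, in_H w a -> pnorm w (Ku k).1 (T a) <= 4 / 3 * pnorm w (Ku k).1 (T (Ku k).2) * normH w a.
  by rewrite /Ku; case: constructive_indefinite_description.
pose p k a := pnorm w (Ku k).1 (T a).
pose u k := (Ku k).2.
have hu k : in_H w (u k) /\ normH w (u k) <= 1 by have [? [? _]] := hKu k.
pose X := hump p u.
have XH k : in_H w (X k).
  elim: k => [|k IH]; first exact: in_H_zero.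
  exact: (proj1 (hump_step w p u k hw hu IH)).
(* The step of length [3^-(j+1)] is half the difference of [3^-j] and [3^-(j+1)], so the lengths
   telescope. *)
have Xdist i j : (i <= j)%N -> normH w (seq_minus (X j) (X i)) <= / 2 * ((/ 3) ^ i - (/ 3) ^ j).
  elim: j => [|j IH] hij.
    have -> : i = 0%N by lia.
    rewrite (normH_ext w _ (seq_scal 0 (X 0%N))); last by move=> n; rewrite /seq_minus /seq_scal; ring.
    have := proj2 (in_H_scal_norm w 0 _ hw (XH 0%N)); rewrite Cmod_0; lra.
  case: (ltngtP i j.+1) hij => // [hij _|-> _]; last first.
    rewrite (normH_ext w _ (seq_scal 0 (X 0%N))); last by move=> n; rewrite /seq_minus /seq_scal; ring.
    have := proj2 (in_H_scal_norm w 0 _ hw (XH 0%N)); rewrite Cmod_0; lra.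
  have h1 := IH ltac:(lia).
  have [_ h2] := hump_step w p u j hw hu (XH j).
  have [_ h3] := in_H_plus_norm w _ _ hw (in_H_minus _ _ _ hw (XH j.+1) (XH j)) (in_H_minus _ _ _ hw (XH j) (XH i)).
  rewrite (normH_ext w _ (seq_minus (X j.+1) (X i))) in h3; last first.
    by move=> n; rewrite /seq_plus /seq_minus; ring.
  rewrite -/X in h2; rewrite /= in h2 *; lra.
have Xdist' i j : (i <= j)%N -> normH w (seq_minus (X i) (X j)) <= / 2 * (/ 3) ^ i.
  move=> hij.
  have [_ h] := in_H_scal_norm w (- (1)) _ hw (in_H_minus _ _ _ hw (XH j) (XH i)).
  rewrite (normH_ext w _ (seq_minus (X i) (X j))) in h; last first.
    by move=> n; rewrite /seq_scal /seq_minus; ring.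
  rewrite Cmod_opp Cmod_1 in h; have := Xdist i j hij; have := pow_third_pos j; lra.
have hgeo : is_lim_seq (fun j => (/ 3) ^ j) 0.
  by apply: is_lim_seq_geom; rewrite Rabs_pos_eq; lra.
have [x [xH xlim]] : exists x, in_H w x /\ is_lim_seq (fun j => normH w (seq_minus (X j) x)) 0.
  apply: in_H_complete => // eps.
  move/is_lim_seq_spec: hgeo => /(_ eps)[J hJ].
  exists J => i j hi hj.
  have aux m : (J <= m)%coq_nat -> / 2 * (/ 3) ^ m < eps / 2.
    by move=> /hJ; have := pow_third_pos m; rewrite Rminus_0_r => ? /Rabs_lt_between; lra.
  case: (leqP i j) => hij.
    by have := Xdist' i j hij; have := aux i hi; have := cond_pos eps; lra.
  have := Xdist j i (ltnW hij); have := aux j hj; have := pow_third_pos i; have := cond_pos eps; lra.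
have Xx i : normH w (seq_minus (X i) x) <= / 2 * (/ 3) ^ i.
  have hl := is_lim_seq_plus' _ _ _ _ (is_lim_seq_const (/ 2 * (/ 3) ^ i)) xlim.
  rewrite Rplus_0_r in hl.
  have hle : Rbar_le (normH w (seq_minus (X i) x)) (/ 2 * (/ 3) ^ i).
    apply: is_lim_seq_le_loc (is_lim_seq_const _) hl; exists i => j hj.
    have [_ h3] := in_H_plus_norm w _ _ hw (in_H_minus _ _ _ hw (XH i) (XH j)) (in_H_minus _ _ _ hw (XH j) xH).
    rewrite (normH_ext w _ (seq_minus (X i) x)) in h3; last first.
      by move=> n; rewrite /seq_plus /seq_minus; ring.
    by have := Xdist' i j ltac:(lia); lra.
  exact: hle.
have Xp k : (/ 3) ^ k.+1 * p k.+1 (u k.+1) <= p k.+1 (X k.+1).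
  set y := seq_scal (RtoC ((/ 3) ^ k.+1)) (u k.+1).
  have h3 := pow_third_pos k.+1.
  have ey : p k.+1 y = (/ 3) ^ k.+1 * p k.+1 (u k.+1).
    by rewrite /p pT_scal Cmod_R Rabs_pos_eq //; lra.
  rewrite -ey.
  have -> : X k.+1 = if Rle_dec (p k.+1 y) (p k.+1 (seq_plus (X k) y)) then seq_plus (X k) y
    else seq_minus (X k) y by [].
  case: (Rle_dec _ _) => hn; rewrite [is_left _]/= //.
  (* Since [2 y = (X + y) - (X - y)], a seminorm below that of [y] at [X + y] forces a larger one at
     [X - y]. *)
  have e2 : p k.+1 (seq_scal 2 y) = 2 * p k.+1 y by rewrite /p pT_scal Cmod_R Rabs_pos_eq //; lra.
  have := pT_minus (Ku k.+1).1 (seq_scal 2 y) (seq_plus (X k) y).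
  rewrite (pT_ext _ (seq_minus (seq_scal 2 y) (seq_plus (X k) y)) (seq_scal (- (1)) (seq_minus (X k) y))); last first.
    by move=> n; rewrite /seq_minus /seq_plus /seq_scal; have -> : (RtoC 2 = RtoC 1 + RtoC 1)%C; [rewrite -RtoC_plus; congr RtoC; ring | ring].
  rewrite (pT_scal _ (- (1))%C) Cmod_opp Cmod_1 -/(p k.+1 _) -/(p k.+1 (seq_plus _ _)) -/(p k.+1 (seq_minus _ _)) e2; lra.
(* At stage [k+1] the hump contributes at least [3^-(k+1) P], and the later ones remove at most
   [4/3 * 1/2 = 2/3] of that; a third remains, and [P] is at least [3^(k+1) * (k+1)]. *)
have grow k : / 3 * INR k.+1 <= normH w (T x).
  have [_ [_ [h1 h2]]] := hKu k.+1.
  have h3 := h2 _ (in_H_minus _ _ _ hw (XH k.+1) xH).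
  have h4 := pT_minus (Ku k.+1).1 (X k.+1) x.
  have h5 := Xp k; have h6 := Xx k.+1.
  have h7 := pnorm_le_normH w (Ku k.+1).1 _ hw (TH _ xH).
  rewrite /p /u in h5.
  set P := pnorm w (Ku k.+1).1 (T (Ku k.+1).2) in h1 h2 h3 h5.
  have P0 : 0 <= P by exact: pnorm_ge0.
  have h8 : 4 / 3 * P * normH w (seq_minus (X k.+1) x) <= 4 / 3 * P * (/ 2 * (/ 3) ^ k.+1).
    by apply: Rmult_le_compat_l => //; lra.
  have e3 : 3 ^ k.+1 * (/ 3) ^ k.+1 = 1 by rewrite -Rpow_mult_distr Rinv_r ?pow1; lra.
  have h9 : (/ 3) ^ k.+1 * (3 ^ k.+1 * INR k.+1) <= (/ 3) ^ k.+1 * P.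
    by apply: Rmult_le_compat_l => //; left; exact: pow_third_pos.
  have e4 : (/ 3) ^ k.+1 * (3 ^ k.+1 * INR k.+1) = INR k.+1.
    by rewrite -Rmult_assoc (Rmult_comm ((/ 3) ^ k.+1)) e3 Rmult_1_l.
  rewrite e4 in h9; lra.
have [n hn] := INR_unbounded (3 * normH w (T x)).
have := grow n; rewrite S_INR; lra.
Qed.

(** * Multipliers as convolution operators *)

(** The Dirichlet series of the constant function 1, hence the unit of convolution. *)
Definition unit_coef (n : nat) : C := if (n == 1)%N then RtoC 1 else RtoC 0.

Lemma pnorm_unit_coef (w : nat -> R) (K : nat) : pos_weight w -> pnorm w K unit_coef <= sqrt (w 1%N).
Proof.
move=> hw; apply: sqrt_le_1_alt; case: K => [|K].
  by rewrite big_nil; left; exact: hw.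
rewrite big_nat_recl // big1; last by move=> k _; rewrite /sqterm /= Cmod_0; ring.
by rewrite /sqterm /= Cmod_1; right; ring.
Qed.

Lemma in_H_unit_coef (w : nat -> R) : pos_weight w -> in_H w unit_coef.
Proof. by move=> hw; apply: (proj1 (in_H_bound w _ _ hw _ (fun K => pnorm_unit_coef w K hw))). Qed.

Lemma csums_eventually (u : nat -> C) (N : nat) :
  (forall k, (N <= k)%N -> u k = 0) -> csums u (\csum_(0 <= k < N) u k).
Proof.
move=> h; apply/clim_eps => eps he; exists N => n hn.
rewrite (@csum_nat_split u N n) //.
have -> : \csum_(N <= k < n) u k = RtoC 0 by rewrite big_nat big1 // => k /andP[hk _]; exact: h.
have -> : forall x : C, (x + 0 - x = 0)%C by move=> x; ring.
by rewrite Cmod_0; lra.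
Qed.

Lemma dsum_unit_coef (s : C) : dsum unit_coef s = 1.
Proof.
apply: CSeries_unique.
have -> : RtoC 1 = \csum_(0 <= k < 1) dterm unit_coef s k.
  by rewrite big_nat1 /dterm npow_1 /unit_coef eqxx; ring.
by apply: csums_eventually => -[|k] // _; rewrite /dterm /unit_coef /=; ring.
Qed.

Lemma conv_linear (c : nat -> C) : is_seq_linear (fun a => conv a c).
Proof.
split.
- move=> a b n; rewrite /seq_plus /conv -big_split; apply: eq_bigr => d _.
  by rewrite /=; ring.
- move=> x a n; rewrite /seq_scal /conv big_distrr; apply: eq_bigr => d _.
  by rewrite /=; ring.
Qed.

(** Each coefficient of the convolution is a finite combination of coefficients of [a], and these
    are continuous functionals. The constant depends on [K]; uniform boundedness removes that
    dependence. *)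
Lemma pnorm_conv_le (w : nat -> R) (c : nat -> C) (K : nat) : pos_weight w ->
  exists B, forall a, in_H w a -> pnorm w K (conv a c) <= B * normH w a.
Proof.
move=> hw; elim: K => [|K [B IH]].
  by exists 0 => a _; rewrite /pnorm big_nil sqrt_0; lra.
pose Q := \rsum_(d <- divisors K.+1) (Cmod (c (K.+1 %/ d)%N) / sqrt (w d)).
exists (B + Q * sqrt (w K.+1)) => a ha.
rewrite pnorm_S //.
have sw := sqrt_pos (w K.+1); have N0 := normH_ge0 w a.
have h1 : Cmod (conv a c K.+1) <= Q * normH w a.
  apply: Rle_trans (Cmod_conv _ _ _) _.
  rewrite /Q big_distrl big_seq [X in _ <= X]big_seq; apply: rsum_le => d _.
  rewrite -dvdn_divisors // => hd /=.
  have d0 := dvdn_gt0 (ltn0Sn K) hd.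
  have hs : 0 < sqrt (w d) by apply: sqrt_lt_R0; exact: hw.
  have h2 := coef_le_normH w a d hw ha d0.
  have -> : Cmod (c (K.+1 %/ d)%N) / sqrt (w d) * normH w a =
    normH w a / sqrt (w d) * Cmod (c (K.+1 %/ d)%N) by field; lra.
  apply: Rmult_le_compat_r; first exact: Cmod_ge_0.
  by apply/Rle_div_r.
have h2 := IH a ha.
have p0 := pnorm_ge0 w K (conv a c).
set x := pnorm _ _ _ in h2 p0 *; set y := Cmod _ * _.
have y0 : 0 <= y by apply: Rmult_le_pos => //; exact: Cmod_ge_0.
apply: (Rle_trans _ (x + y)).
  rewrite -(sqrt_pow2 (x + y)); last lra.
  by apply: sqrt_le_1_alt; nra.
have : y <= Q * sqrt (w K.+1) * normH w a by rewrite /y; nra.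
lra.
Qed.

Lemma mult_graph_conv (w : nat -> R) (sigma0 : R) (phi : C -> C) (c a b : nat -> C) :
  pos_weight w ->
  (forall sigma : R, sigma0 < sigma -> ex_series (fun k => wterm w sigma k.+1)) ->
  is_dseries_of w sigma0 phi c -> mult_graph w sigma0 phi a b ->
  forall n, b n = conv a c n.
Proof.
move=> hw hs [hc hphi] [ha [hb hab]] [|n]; first by rewrite (proj1 hb) conv_0 // (proj1 hc).
have ev x s : in_H w x -> half_plane sigma0 s -> dconverges_abs x s.
  by move=> hx hss; exact: (proj1 (in_H_evaluation _ _ _ hw hx (hs _ hss))).
apply: (dseries_unique b (conv a c) sigma0) => // s hss.
  split; first exact: ev.
  by apply: (proj1 (dsum_conv _ _ _ _ _)); exact: ev.
rewrite (proj2 (dsum_conv _ _ _ _ _)); [|exact: ev..].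
by rewrite -hab // hphi // Cmult_comm.
Qed.

Lemma multiplier_convolution (w : nat -> R) (sigma0 : R) (phi : C -> C) :
  pos_weight w ->
  (forall sigma : R, sigma0 < sigma -> ex_series (fun k => wterm w sigma k.+1)) ->
  is_multiplier w sigma0 phi ->
  exists c, is_dseries_of w sigma0 phi c /\
    is_finite (opnorm w sigma0 phi) /\
    (forall a, in_H w a -> in_H w (conv a c) /\
       normH w (conv a c) <= real (opnorm w sigma0 phi) * normH w a).
Proof.
move=> hw hs hphi.
(* The coefficients of [phi] are found as the image of the constant function 1. *)
have [c [h1 [hc hg]]] := hphi _ (in_H_unit_coef w hw).
have hser : is_dseries_of w sigma0 phi c.
  by split=> // s hss; rewrite -hg // dsum_unit_coef Cmult_1_r.
exists c; split=> //.
have graph a : in_H w a -> mult_graph w sigma0 phi a (conv a c).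
  move=> ha; have [b hb] := hphi a ha.
  have -> : conv a c = b; last by [].
  apply: FunctionalExtensionality.functional_extensionality => n.
  by rewrite (mult_graph_conv _ _ _ _ _ _ hw hs hser hb).
have TH a : in_H w a -> in_H w (conv a c) by move=> /graph[_ [? _]].
pose CK K := proj1_sig (constructive_indefinite_description _ (pnorm_conv_le w c K hw)).
have hCK K a : in_H w a -> pnorm w K (conv a c) <= CK K * normH w a.
  by rewrite /CK; case: constructive_indefinite_description => B hB; exact: hB.
have [B hB] := uniform_boundedness w (fun a => conv a c) CK hw (conv_linear c) TH hCK.
pose E x := exists a b, mult_graph w sigma0 phi a b /\ normH w a <= 1 /\ x = normH w b.
have [ub lub] := Lub_Rbar_correct E.
have Ebd : is_ub_Rbar E (Rabs B).
  move=> x [a [b [hab [hn ->]]]] /=.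
  have ha : in_H w a by case: hab.
  rewrite (normH_ext w b (conv a c)); last exact: mult_graph_conv hab.
  apply: Rle_trans (hB a ha) _.
  by have := Rle_abs B; have := Rabs_pos B; have := normH_ge0 w a; nra.
(* [real] sends an infinite value to 0, so a bound by [real (opnorm _ _ _)] is meaningful only once
   finiteness is known: the set is nonempty and bounded above. *)
have E0 : E 0.
  have z := in_H_zero w hw.
  exists seq_zero, (conv seq_zero c); split; first exact: graph.
  have n0 : normH w seq_zero = 0.
    have := proj2 (in_H_scal_norm w 0 seq_zero hw z).
    rewrite Cmod_0 Rmult_0_l (normH_ext w _ seq_zero); last by move=> n; rewrite /seq_scal /seq_zero; ring.
    by have := normH_ge0 w seq_zero; lra.
  split; first by rewrite n0; lra.
  by have := hB _ z; have := normH_ge0 w (conv seq_zero c); rewrite n0; lra.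
have fin : is_finite (opnorm w sigma0 phi).
  rewrite /opnorm -/E.
  move: (lub _ Ebd) (ub _ E0); by case: (Lub_Rbar E).
split=> // a ha; split; first exact: TH.
have N0 := normH_ge0 w a.
case: (Req_dec (normH w a) 0) => hN.
  by have := hB a ha; rewrite hN !Rmult_0_r.
have hi : 0 < / normH w a by apply: Rinv_0_lt_compat; lra.
have [h2 h3] := in_H_scal_norm w (RtoC (/ normH w a)) _ hw ha.
rewrite Cmod_R Rabs_pos_eq in h3; last lra.
rewrite Rinv_l // in h3.
have : Rbar_le (normH w (conv (seq_scal (RtoC (/ normH w a)) a) c)) (opnorm w sigma0 phi).
  by apply: ub; exists (seq_scal (RtoC (/ normH w a)) a), (conv (seq_scal (RtoC (/ normH w a)) a) c); split; first exact: graph.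
rewrite -fin /= => h4.
have [_ h5] := in_H_scal_norm w (RtoC (normH w a)) _ hw (TH _ h2).
rewrite Cmod_R Rabs_pos_eq // in h5.
rewrite (normH_ext w (conv a c) (seq_scal (RtoC (normH w a)) (conv (seq_scal (RtoC (/ normH w a)) a) c))); last first.
  move=> n; rewrite /seq_scal (proj2 (conv_linear c)) /seq_scal Cmult_assoc -RtoC_mult Rinv_r //.
  by rewrite Cmult_1_l.
by apply: Rle_trans h5 _; rewrite Rmult_comm; apply: Rmult_le_compat_r.
Qed.

Lemma proj_norm_le (w : nat -> R) (N : nat) (a : nat -> C) : pos_weight w -> in_H w a ->
  in_HN w N (proj N a) /\ normH w (proj N a) <= normH w a.
Proof.
move=> hw ha.
have hN : in_HN w N (proj N a) by apply: proj_in_HN => // n hn; apply: hw; lia.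
split=> //.
apply: (proj2 (in_H_bound w _ _ hw (proj1 (proj1 hN)) _)) => K.
apply: Rle_trans (pnorm_le_normH w K a hw ha); apply: sqrt_le_1_alt; apply: rsum_le => k _ _.
rewrite /sqterm /proj; case: in_gen_P_dec => _; first by right.
rewrite Cmod_0 /= !Rmult_0_l; exact: (sqterm_ge0 w a k hw).
Qed.

(** A constant independent of [m] is lost on taking m-th roots; equivalently, the powers of a ratio
    [x / M > 1] are unbounded. *)
Lemma le_of_pow_le (x M K : R) : 0 <= x -> 0 <= M ->
  (forall m : nat, x ^ m <= K * M ^ m) -> x <= M.
Proof.
move=> x0 M0 h.
case: (Rle_lt_dec x M) => // hlt.
case: (Req_dec M 0) => hM.
  by have := h 1%N; rewrite hM /=; lra.
have q1 : 1 < x / M by apply/Rlt_div_r; lra.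
have hb m : (x / M) ^ m <= K.
  rewrite /Rdiv Rpow_mult_distr pow_inv.
  have hp : 0 < M ^ m by apply: pow_lt; lra.
  by apply/Rle_div_l => //; exact: h.
have [N hN] := Pow_x_infinity (x / M) ltac:(rewrite Rabs_pos_eq; lra) (K + 1).
have := hN N (le_n N); rewrite Rabs_pos_eq; last by apply: pow_le; lra.
by have := hb N; lra.
Qed.

Fixpoint conv_pow (c : nat -> C) (m : nat) : nat -> C :=
  if m is j.+1 then conv (conv_pow c j) c else unit_coef.

(* Evaluating the powers of the compression of M_phi at the constant 1 gives
   |D(s)|^m <= K M^m for all m. *)
Lemma proj_dsum_bound (w : nat -> R) (c : nat -> C) (N : nat) (M : R) (s : C) :
  pos_weight w -> 0 <= M -> in_H w c ->
  (forall a, in_H w a -> in_H w (conv a c) /\ normH w (conv a c) <= M * normH w a) ->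
  ex_series (fun k => wterm_P w N (Re s) k.+1) ->
  Cmod (dsum (proj N c) s) <= M.
Proof.
move=> hw M0 hc hT hs.
set f := conv_pow (proj N c).
have f0 m : f m 0%N = 0.
  by case: m => [//|m]; rewrite /f /= conv_0 // /proj; case: in_gen_P_dec => // _; exact: (proj1 hc).
have ev a : in_HN w N a -> dconverges_abs a s.
  by move=> ha; exact: (proj1 (in_HN_evaluation _ _ _ _ hw ha hs)).
have hcN := proj1 (proj_norm_le w N c hw hc).
have fHN m : in_HN w N (f m) /\ normH w (f m) <= M ^ m * normH w unit_coef.
  elim: m => [|m [IH1 IH2]].
    split; last by rewrite /f /= Rmult_1_l; right.
    split; first exact: in_H_unit_coef.
    move=> n hn hg; rewrite /f /= /unit_coef; case: eqP => // e.
    by case: hg; rewrite e; constructor.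
  have e n : proj N (conv (f m) c) n = f m.+1 n.
    case: (posnP n) => [->|n0].
      by rewrite f0 /proj; case: in_gen_P_dec => // _; rewrite conv_0 // (proj1 hc).
    rewrite proj_conv // [RHS]/=; apply: eq_bigr => d _; congr (_ * _)%C.
    case: (in_gen_P_dec N d) => hd; first by rewrite proj_in.
    rewrite proj_out //; case: (posnP d) => [->|d0]; first exact: esym (f0 m).
    by apply: esym; apply: (proj2 IH1) => //; lia.
  have [h1 h2] := hT _ (proj1 IH1).
  have [h3 h4] := proj_norm_le w N _ hw h1.
  rewrite (FunctionalExtensionality.functional_extensionality _ _ e) in h3 h4.
  split=> //; rewrite /=.
  by have := Rmult_le_compat_l _ _ _ M0 IH2; lra.
have fs m : dsum (f m) s = (dsum (proj N c) s ^ m)%C.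
  elim: m => [|m IH]; first by rewrite dsum_unit_coef.
  rewrite /f /= (proj2 (dsum_conv _ _ _ _ _)) ?IH; [ring | | exact: ev].
  by apply: ev; exact: (proj1 (fHN m)).
apply: (le_of_pow_le _ _ ((1 + Series (fun k => wterm_P w N (Re s) k.+1)) / 2 * normH w unit_coef)) => //.
  exact: Cmod_ge_0.
move=> m; rewrite -Cmod_pow -fs.
have [h1 h2] := fHN m.
have [h3 h4] := in_HN_evaluation _ _ _ _ hw h1 hs.
apply: Rle_trans (Cmod_dsum_le _ _ h3) _; apply: Rle_trans h4 _.
rewrite Rmult_assoc (Rmult_comm (normH w unit_coef)).
apply: Rmult_le_compat_l h2.
have : 0 <= Series (fun k => wterm_P w N (Re s) k.+1).
  have := rsum_le_Series (fun k => wterm_P w N (Re s) k.+1) 0 _ hs; rewrite big_nil; apply.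
  by move=> k; rewrite /wterm_P; case: in_gen_P_dec => _; [exact: wterm_ge0 | right].
lra.
Qed.

(** * Fejer kernel *)

(** Its integral over [t > 0] is proportional to [|a|]. This is how absolute values, and from them
    triangle functions, arise from cosines. *)
Definition fejer (a t : R) : R := (1 - cos (a * t)) / t ^ 2.

Lemma fejer_ge0 (a t : R) : 0 <= fejer a t.
Proof.
have h := COS_bound (a * t).
rewrite /fejer; case: (Req_dec t 0) => [->|ht].
  by rewrite Rmult_0_r cos_0; apply: Req_le; rewrite /Rdiv; ring.
apply: Rmult_le_pos; first lra.
by left; apply: Rinv_0_lt_compat; apply: pow2_gt_0.
Qed.

Lemma fejer_continuous (a t : R) : 0 < t -> continuous (fejer a) t.
Proof.
move=> ht; apply: ex_derive_continuous; rewrite /fejer; auto_derive.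
by have := pow2_gt_0 t; lra.
Qed.

Lemma ex_RInt_fejer (a e T : R) : 0 < e -> 0 < T -> ex_RInt (fejer a) e T.
Proof.
move=> he hT; apply: (ex_RInt_continuous (V := R_CompleteNormedModule)) => z hz.
apply: fejer_continuous.
by have := Rmin_glb_lt _ _ _ he hT; lra.
Qed.

Lemma fejer_scaling (a e T : R) : 0 < a -> 0 < e -> 0 < T ->
  RInt (fejer a) e T = a * RInt (fejer 1) (a * e) (a * T).
Proof.
move=> ha he hT.
have h := RInt_comp_lin (V := R_CompleteNormedModule) (fejer 1) a 0 e T.
rewrite !Rplus_0_r in h; rewrite -h; last first.
  by apply: ex_RInt_fejer; exact: Rmult_lt_0_compat.
change (RInt (fejer a) e T = scal a (RInt (V := R_CompleteNormedModule) (fun y => scal a (fejer 1 (a * y + 0))) e T)).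
rewrite -(RInt_scal (V := R_CompleteNormedModule)); last first.
  apply: (ex_RInt_ext (fun y => scal (/ a) (fejer a y))).
    move=> x hx; have x0 : 0 < x by have := Rmin_glb_lt _ _ _ he hT; lra.
    by rewrite /scal /= /mult /= /fejer Rplus_0_r Rmult_1_l; field; lra.
  by apply: ex_RInt_scal; exact: ex_RInt_fejer.
apply: RInt_ext => x hx; have x0 : 0 < x by have := Rmin_glb_lt _ _ _ he hT; lra.
by rewrite /scal /= /mult /= /fejer Rplus_0_r Rmult_1_l; field; lra.
Qed.

Lemma fejer1_le (t : R) : 0 < t -> fejer 1 t <= 8 / (1 + t) ^ 2.
Proof.
move=> ht; rewrite /fejer Rmult_1_l.
have p1 : 0 < t ^ 2 by apply: pow2_gt_0; lra.
have p2 : 0 < (1 + t) ^ 2 by apply: pow2_gt_0; lra.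
apply/Rle_div_l => //; have -> : 8 / (1 + t) ^ 2 * t ^ 2 = 8 * t ^ 2 / (1 + t) ^ 2 by field; lra.
apply/Rle_div_r => //.
(* Up to 1 the bound [1 - cos t <= t^2 / 2] is used, beyond 1 the bound [1 - cos t <= 2] together
   with [(1 + t)^2 <= 4 t^2]; the latter case produces the 8. *)
case: (Rle_lt_dec t 1) => h1.
  have h2 := cos_le_1_sqr t.
  have : (1 + t) ^ 2 <= 4 by nra.
  nra.
have h2 := COS_bound t.
have : (1 + t) ^ 2 <= 4 * t ^ 2 by nra.
nra.
Qed.

Lemma RInt_fejer1_le (e T : R) : 0 < e -> e <= T -> RInt (fejer 1) e T <= 8.
Proof.
move=> he hT.
have hI : is_RInt (fun t => 8 / (1 + t) ^ 2) e T (8 / (1 + e) - 8 / (1 + T)).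
  have -> : 8 / (1 + e) - 8 / (1 + T) = minus (- 8 / (1 + T)) (- 8 / (1 + e)).
    by rewrite /minus /plus /opp /=; field; lra.
  apply: (is_RInt_derive (fun t => - 8 / (1 + t))).
    move=> x; rewrite Rmin_left // Rmax_right // => hx.
    by auto_derive; [lra | field; lra].
  move=> x; rewrite Rmin_left // Rmax_right // => hx.
  apply: ex_derive_continuous; auto_derive.
  by have := pow2_gt_0 (1 + x); lra.
apply: (Rle_trans _ (8 / (1 + e) - 8 / (1 + T))).
  apply: (is_RInt_le (fejer 1) _ e T) => //; last by move=> x hx; apply: fejer1_le; lra.
    by apply: (RInt_correct (V := R_CompleteNormedModule)); apply: ex_RInt_fejer; lra.
  exact: hI.
have h1 : 8 / (1 + e) <= 8 by apply/Rle_div_l; lra.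
have h2 : 0 < 8 / (1 + T) by apply: Rdiv_lt_0_compat; lra.
lra.
Qed.

Lemma RInt_fejer_mono (a e e' T' T : R) : 0 < e -> e <= e' -> e' <= T' -> T' <= T ->
  RInt (fejer a) e' T' <= RInt (fejer a) e T.
Proof.
move=> he h1 h2 h3.
have hx x y : 0 < x -> 0 < y -> ex_RInt (fejer a) x y by exact: ex_RInt_fejer.
rewrite -(RInt_Chasles (fejer a) e e' T); [|apply: hx; lra..].
rewrite -(RInt_Chasles (fejer a) e' T' T); [|apply: hx; lra..].
have q1 : 0 <= RInt (fejer a) e e'.
  by apply: RInt_ge_0 => //; [apply: hx; lra | move=> x _; exact: fejer_ge0].
have q2 : 0 <= RInt (fejer a) T' T.
  by apply: RInt_ge_0 => //; [apply: hx; lra | move=> x _; exact: fejer_ge0].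
by rewrite /plus /=; lra.
Qed.

(* The value pi/2 of the constant is never needed. *)
Lemma fejer_integral : exists I, 0 < I /\ forall a,
  is_lim_seq (fun n => RInt (fejer a) (/ INR n.+1) (INR n.+1)) (Rabs a * I).
Proof.
have hp n : 0 < INR n.+1 by exact: INR_gt0.
have h1n n : 1 <= INR n.+1 by rewrite S_INR; have := pos_INR n; lra.
have hi n : / INR n.+1 <= 1 by rewrite -Rinv_1; apply: Rinv_le_contravar; [lra | exact: h1n].
have hip n : 0 < / INR n.+1 by apply: Rinv_0_lt_compat.
pose u n := RInt (fejer 1) (/ INR n.+1) (INR n.+1).
have umono m n : (m <= n)%N -> u m <= u n.
  move=> hmn; apply: RInt_fejer_mono => //.
  - by apply: Rinv_le_contravar => //; apply: le_INR; lia.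
  - by have := h1n m; have := hi m; lra.
  - by apply: le_INR; lia.
have [I hI] : ex_finite_lim_seq u.
  apply: (ex_finite_lim_seq_incr _ 8) => n; first exact: umono.
  by apply: RInt_fejer1_le => //; have := h1n n; have := hi n; lra.
have uI n : u n <= I.
  have h : Rbar_le (u n) I.
    apply: is_lim_seq_le_loc (is_lim_seq_const _) hI; exists n => m hm.
    by apply: umono; lia.
  exact: h.
have I0 : 0 < I.
  apply: Rlt_le_trans (uI 1%N); apply: RInt_gt_0.
  - by rewrite /=; lra.
  - move=> x [hx1 hx2]; rewrite /= in hx1 hx2.
    have x0 : 0 < x by lra.
    rewrite /fejer Rmult_1_l; apply: Rdiv_lt_0_compat; last by apply: pow2_gt_0; lra.
    have -> : cos x = 1 - 2 * sin (x / 2) * sin (x / 2) by rewrite -cos_2a_sin; congr cos; field.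
    have : 0 < sin (x / 2) by apply: sin_gt_0; have := PI2_1; lra.
    nra.
  - move=> x [hx1 hx2]; apply: fejer_continuous; rewrite /= in hx1; lra.
(* Scaling moves the range of integration to [[a/(n+1), a(n+1)]]. It eventually contains the range
   of [u m] and is always contained in that of a later [u], so positivity of the kernel squeezes the
   integral. *)
have pos a : 0 < a -> is_lim_seq (fun n => RInt (fejer a) (/ INR n.+1) (INR n.+1)) (a * I).
  move=> ha.
  apply: (is_lim_seq_ext (fun n => a * RInt (fejer 1) (a * / INR n.+1) (a * INR n.+1))).
    by move=> n; rewrite (fejer_scaling a _ _ ha (hip n) (hp n)).
  apply: is_lim_seq_mult'; first exact: is_lim_seq_const.
  apply/is_lim_seq_spec => eps.
  move/is_lim_seq_spec: hI => /(_ eps)[m hm].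
  have [n1 hn1] := INR_unbounded (INR m.+1 / a).
  have [n2 hn2] := INR_unbounded (INR m.+1 * a).
  exists (n1 + n2)%N => n hn.
  have k1 : INR m.+1 <= a * INR n.+1.
    rewrite Rmult_comm; apply/Rle_div_l => //.
    by apply: Rle_trans (Rlt_le _ _ hn1) _; apply: le_INR; lia.
  have k2 : a * / INR n.+1 <= / INR m.+1.
    apply: (Rmult_le_reg_r (INR m.+1 * INR n.+1)); first exact: Rmult_lt_0_compat.
    have -> : a * / INR n.+1 * (INR m.+1 * INR n.+1) = INR m.+1 * a by field; have := hp n; lra.
    have -> : / INR m.+1 * (INR m.+1 * INR n.+1) = INR n.+1 by field; have := hp m; lra.
    by apply: Rle_trans (Rlt_le _ _ hn2) _; apply: le_INR; lia.
  have k3 : 0 < a * / INR n.+1 by exact: Rmult_lt_0_compat.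
  have lo : u m <= RInt (fejer 1) (a * / INR n.+1) (a * INR n.+1).
    by apply: RInt_fejer_mono => //; have := h1n m; have := hi m; lra.
  have [N1 hN1] := INR_unbounded (a * INR n.+1).
  have [N2 hN2] := INR_unbounded (INR n.+1 / a).
  have hi' : RInt (fejer 1) (a * / INR n.+1) (a * INR n.+1) <= u (N1 + N2)%N.
    apply: RInt_fejer_mono => //.
    - apply: (Rmult_le_reg_r (INR (N1 + N2).+1 * (INR n.+1 / a))).
        by apply: Rmult_lt_0_compat => //; apply: Rdiv_lt_0_compat.
      have -> : / INR (N1 + N2).+1 * (INR (N1 + N2).+1 * (INR n.+1 / a)) = INR n.+1 / a.
        by field; have := hp (N1 + N2)%N; lra.
      have -> : a * / INR n.+1 * (INR (N1 + N2).+1 * (INR n.+1 / a)) = INR (N1 + N2).+1.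
        by field; have := hp n; lra.
      by apply: Rle_trans (Rlt_le _ _ hN2) _; apply: le_INR; lia.
    - by have := h1n m; have := hi m; lra.
    - by apply: Rle_trans (Rlt_le _ _ hN1) _; apply: le_INR; lia.
  have := uI (N1 + N2)%N; have := hm m (le_n m) => /Rabs_lt_between.
  rewrite -/(u m) => q1 q2; apply/Rabs_lt_between; have := cond_pos eps; lra.
exists I; split=> // a.
case: (Rtotal_order a 0) => [ha|[->|ha]].
- rewrite Rabs_left //; apply: is_lim_seq_ext (pos (- a) _); last lra.
  move=> n; apply: RInt_ext => x _; rewrite /fejer -cos_neg.
  by congr ((1 - cos _) / _); ring.
- rewrite Rabs_R0 Rmult_0_l; apply: is_lim_seq_ext (is_lim_seq_const 0) => n.
  rewrite (RInt_ext _ (fun=> 0)).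
    by rewrite RInt_const /scal /= /mult /=; ring.
  move=> x _; rewrite /fejer Rmult_0_l cos_0 /Rdiv Rminus_diag; exact: Rmult_0_l.
- by rewrite Rabs_pos_eq; [exact: pos | lra].
Qed.

Lemma is_RInt_rsum (f : nat -> R -> R) (l : nat -> R) (a b : R) (r : seq nat) :
  (forall k, is_RInt (f k) a b (l k)) ->
  is_RInt (fun t => \rsum_(k <- r) f k t) a b (\rsum_(k <- r) l k).
Proof.
move=> h; elim: r => [|k r IHr].
  rewrite big_nil; apply: (is_RInt_ext (fun=> 0)) => [x _|]; first by rewrite big_nil.
  by have := is_RInt_const a b (0 : R); rewrite /scal /= /mult /= Rmult_0_r.
rewrite big_cons; apply: (is_RInt_ext (fun t => f k t + \rsum_(k <- r) f k t)).
  by move=> x _; rewrite big_cons.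
exact: is_RInt_plus.
Qed.

Definition tri (B x : R) : R := Rmax 0 (B - Rabs x).

(** The triangle is a second difference of the absolute value. [fejer_cos] has the same second
    difference on the kernel side, so integrating [fejer B t * cos (x t)] over [t > 0] gives a fixed
    multiple of [tri B x]. *)
Lemma tri_abs (B x : R) : 0 <= B ->
  / 2 * Rabs (B + x) + / 2 * Rabs (B - x) - Rabs x = tri B x.
Proof.
move=> hB; rewrite /tri /Rmax /Rabs.
by case: Rle_dec; case: Rcase_abs; case: Rcase_abs; case: Rcase_abs; lra.
Qed.

Lemma fejer_cos (B x t : R) :
  fejer B t * cos (x * t) = / 2 * fejer (B + x) t + / 2 * fejer (B - x) t - fejer x t.
Proof.
rewrite /fejer !Rmult_plus_distr_r Ropp_mult_distr_l_reverse cos_plus -/(Rminus _ _) cos_minus.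
by rewrite /Rdiv; set v := / t ^ 2; field.
Qed.

Lemma is_lim_seq_rsum (u : nat -> nat -> R) (l : nat -> R) (r : seq nat) :
  (forall k, is_lim_seq (u k) (l k)) ->
  is_lim_seq (fun n => \rsum_(k <- r) u k n) (\rsum_(k <- r) l k).
Proof.
move=> h; elim: r => [|k r IHr].
  by rewrite big_nil; apply: is_lim_seq_ext (is_lim_seq_const 0) => n; rewrite big_nil.
rewrite big_cons; apply: (is_lim_seq_ext (fun n => u k n + \rsum_(k <- r) u k n)).
  by move=> n; rewrite big_cons.
exact: is_lim_seq_plus'.
Qed.

(** The pointwise bound is integrated against [fejer B], which is legitimate because this kernel is
    nonnegative. The constant [I] then appears on both sides and cancels. *)
Lemma tri_cos_bound (K : nat) (x beta : nat -> R) (M B : R) : 0 <= B ->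
  (forall t, \rsum_(0 <= k < K) (beta k * cos (x k * t)) <= M) ->
  \rsum_(0 <= k < K) (beta k * tri B (x k)) <= M * B.
Proof.
move=> hB hM.
have [I [I0 hI]] := fejer_integral.
pose J a n := RInt (fejer a) (/ INR n.+1) (INR n.+1).
have hJ a n : is_RInt (fejer a) (/ INR n.+1) (INR n.+1) (J a n).
  apply: (RInt_correct (V := R_CompleteNormedModule)); apply: ex_RInt_fejer.
    by apply: Rinv_0_lt_compat; exact: INR_gt0.
  exact: INR_gt0.
have step n : \rsum_(0 <= k < K) (beta k * (/ 2 * J (B + x k) n + / 2 * J (B - x k) n - J (x k) n)) <= M * J B n.
  have i1 : is_RInt (fun t => \rsum_(0 <= k < K) (beta k * (/ 2 * fejer (B + x k) t + / 2 * fejer (B - x k) t - fejer (x k) t)))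
      (/ INR n.+1) (INR n.+1) (\rsum_(0 <= k < K) (beta k * (/ 2 * J (B + x k) n + / 2 * J (B - x k) n - J (x k) n))).
    apply: is_RInt_rsum => k; apply: (is_RInt_scal _ _ _ (beta k)).
    apply: is_RInt_minus => //; apply: is_RInt_plus.
      exact: (is_RInt_scal _ _ _ (/ 2)).
    exact: (is_RInt_scal _ _ _ (/ 2)).
  have i2 := is_RInt_scal _ _ _ M _ (hJ B n).
  apply: (is_RInt_le _ _ _ _ _ _ _ i1 i2).
    have h1 : 1 <= INR n.+1 by rewrite S_INR; have := pos_INR n; lra.
    by apply: Rle_trans (h1); rewrite -Rinv_1; apply: Rinv_le_contravar; [lra | exact: h1].
  move=> t _.
  rewrite (eq_bigr (fun k => fejer B t * (beta k * cos (x k * t)))); last first.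
    by move=> k _; rewrite -fejer_cos; ring.
  rewrite -big_distrr /scal /= /mult /= Rmult_comm.
  by apply: Rmult_le_compat_r; [exact: fejer_ge0 | exact: hM].
have l1 : is_lim_seq (fun n => \rsum_(0 <= k < K) (beta k * (/ 2 * J (B + x k) n + / 2 * J (B - x k) n - J (x k) n)))
    (\rsum_(0 <= k < K) (beta k * tri B (x k) * I)).
  apply: is_lim_seq_rsum => k.
  have -> : beta k * tri B (x k) * I = beta k * (/ 2 * (Rabs (B + x k) * I) + / 2 * (Rabs (B - x k) * I) - Rabs (x k) * I).
    by rewrite -tri_abs //; ring.
  apply: is_lim_seq_mult'; first exact: is_lim_seq_const.
  apply: is_lim_seq_minus'; last exact: hI.
  by apply: is_lim_seq_plus'; apply: is_lim_seq_mult'; try exact: is_lim_seq_const; exact: hI.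
have l2 : is_lim_seq (fun n => M * J B n) (M * (B * I)).
  apply: is_lim_seq_mult'; first exact: is_lim_seq_const.
  by rewrite -{2}(Rabs_pos_eq B) //; exact: hI.
have h : Rbar_le (\rsum_(0 <= k < K) (beta k * tri B (x k) * I)) (M * (B * I)).
  exact: is_lim_seq_le step l1 l2.
have {}h : \rsum_(0 <= k < K) (beta k * tri B (x k) * I) <= M * (B * I) by exact: h.
rewrite -big_distrl /= -Rmult_assoc in h.
exact: (Rmult_le_reg_r I).
Qed.

Lemma cexp_imag (y : R) : cexp (- (Ci * RtoC y)) = (cos y, - sin y).
Proof.
rewrite /cexp.
have -> : Re (- (Ci * RtoC y))%C = 0 by rewrite /=; ring.
have -> : Im (- (Ci * RtoC y))%C = - y by rewrite /=; ring.
by rewrite exp_0 cos_neg sin_neg !Rmult_1_l.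
Qed.

(** Translating by [x0] multiplies the exponential sum by a unimodular factor, and averaging [t]
    with [-t] turns exponentials into cosines. Multiplying by the conjugate of [S] makes the problem
    real and yields [|S|^2 <= |S| M B]. *)
Lemma tri_bound (K : nat) (x : nat -> R) (b : nat -> C) (M B x0 : R) : 0 <= B ->
  (forall t, Cmod (\csum_(0 <= k < K) (b k * cexp (- (Ci * RtoC (x k * t))))) <= M) ->
  Cmod (\csum_(0 <= k < K) (b k * RtoC (tri B (x k - x0)))) <= M * B.
Proof.
move=> hB hM.
set S := \csum_(0 <= k < K) _.
have hcos t : Cmod (\csum_(0 <= k < K) (b k * RtoC (cos ((x k - x0) * t)))) <= M.
  have e1 u : (\csum_(0 <= k < K) (b k * cexp (- (Ci * RtoC ((x k - x0) * u)))) =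
      cexp (Ci * RtoC (x0 * u)) * \csum_(0 <= k < K) (b k * cexp (- (Ci * RtoC (x k * u)))))%C.
    rewrite big_distrr; apply: eq_bigr => k _ /=.
    rewrite Cmult_assoc (Cmult_comm (cexp _)) -Cmult_assoc -cexp_plus.
    by congr (_ * cexp _)%C; rewrite !RtoC_mult RtoC_minus; ring.
  have b1 u : Cmod (\csum_(0 <= k < K) (b k * cexp (- (Ci * RtoC ((x k - x0) * u))))) <= M.
    rewrite e1 Cmod_mult Cmod_cexp.
    have -> : Re (Ci * RtoC (x0 * u)) = 0 by rewrite /=; ring.
    by rewrite exp_0 Rmult_1_l.
  have -> : (\csum_(0 <= k < K) (b k * RtoC (cos ((x k - x0) * t))) =
      RtoC (/ 2) * (\csum_(0 <= k < K) (b k * cexp (- (Ci * RtoC ((x k - x0) * t)))) +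
        \csum_(0 <= k < K) (b k * cexp (- (Ci * RtoC ((x k - x0) * (- t)))))))%C.
    rewrite -big_split big_distrr; apply: eq_bigr => k _ /=.
    set y := (x k - x0) * t.
    have -> : (x k - x0) * - t = - y by rewrite /y; ring.
    have -> : RtoC (cos y) = (RtoC (/ 2) * (cexp (- (Ci * RtoC y)) + cexp (- (Ci * RtoC (- y)))))%C.
      by rewrite !cexp_imag cos_neg sin_neg; apply: C_eq => /=; field.
    ring.
  rewrite Cmod_mult Cmod_R Rabs_pos_eq; last lra.
  have := Cmod_triangle (\csum_(0 <= k < K) (b k * cexp (- (Ci * RtoC ((x k - x0) * t)))))
    (\csum_(0 <= k < K) (b k * cexp (- (Ci * RtoC ((x k - x0) * (- t)))))).
  have := b1 t; have := b1 (- t); lra.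
have h := tri_cos_bound K (fun k => x k - x0) (fun k => Re (Cconj S * b k)%C) (Cmod S * M) B hB.
have {}h : \rsum_(0 <= k < K) (Re (Cconj S * b k)%C * tri B (x k - x0)) <= Cmod S * M * B.
  apply: h => t.
  have -> : \rsum_(0 <= k < K) (Re (Cconj S * b k)%C * cos ((x k - x0) * t)) =
      Re (Cconj S * \csum_(0 <= k < K) (b k * RtoC (cos ((x k - x0) * t))))%C.
    rewrite big_distrr Re_csum; apply: eq_bigr => k _ /=; ring.
  apply: Rle_trans (Rle_abs _) _; apply: Rle_trans (re_le_Cmod _) _.
  rewrite Cmod_mult Cmod_conj; apply: Rmult_le_compat_l; [exact: Cmod_ge_0 | exact: hcos].
have e : \rsum_(0 <= k < K) (Re (Cconj S * b k)%C * tri B (x k - x0)) = Cmod S ^ 2.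
  have -> : Cmod S ^ 2 = Re (Cconj S * S)%C by rewrite Cmult_comm -Cmod2_conj.
  by rewrite {3}/S big_distrr Re_csum; apply: eq_bigr => k _ /=; ring.
rewrite e in h.
case: (Req_dec (Cmod S) 0) => hS.
  have M0 : 0 <= M by apply: Rle_trans (hM 0); exact: Cmod_ge_0.
  by rewrite hS; exact: Rmult_le_pos.
apply: (Rmult_le_reg_l (Cmod S)); first by have := Cmod_ge_0 S; lra.
by lra.
Qed.

(** * Partial sums of bounded Dirichlet series *)

(** Height and width of the slope are both [d], so the slope is always -1; divided by [d] it is a
    smoothed indicator of [x <= A]. *)
Definition ramp (A d x : R) : R := Rmax 0 (Rmin d (A + d - x)).

Lemma ramp_double (A d x : R) : 0 < d -> ramp A (2 * d) x = 2 * ramp A d x + tri d (x - (A + d)).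
Proof.
move=> hd; rewrite /ramp /tri /Rmax /Rmin /Rabs.
by repeat (destruct (Rle_dec _ _)); repeat (destruct (Rcase_abs _)); lra.
Qed.

Lemma ramp_tri (A d x : R) : 0 <= A -> 0 < d -> 0 <= x -> ramp A d x = tri (A + d) x - tri A x.
Proof.
move=> hA hd hx; rewrite /ramp /tri (Rabs_pos_eq x) // /Rmax /Rmin.
by repeat (destruct (Rle_dec _ _)); lra.
Qed.

Lemma csum_plus (f g : nat -> C) (r : seq nat) :
  (\csum_(k <- r) (f k + g k) = \csum_(k <- r) f k + \csum_(k <- r) g k)%C.
Proof. exact: big_split. Qed.

Lemma csum_scal (c : C) (f : nat -> C) (r : seq nat) :
  (\csum_(k <- r) (c * f k) = c * \csum_(k <- r) f k)%C.
Proof. by rewrite big_distrr. Qed.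

(* The indicator of [0, ln n] is a ramp of width ln (1 + 1/n); doubling the width costs one
   triangle, so about log_2 n triangles reach a ramp of width 1, whence the logarithm. *)
Lemma partial_sum_bound (K n : nat) (b : nat -> C) (M : R) : (0 < n)%N -> (n <= K)%N ->
  (forall t, Cmod (\csum_(0 <= k < K) (b k * cexp (- (Ci * RtoC (ln (INR k.+1) * t))))) <= M) ->
  Cmod (\csum_(0 <= k < n) b k) <= M * (2 + 3 * ln (INR n)).
Proof.
move=> n0 nK hM.
have M0 : 0 <= M by apply: Rle_trans (hM 0); exact: Cmod_ge_0.
set A := ln (INR n).
have A0 : 0 <= A by exact: ln_INR_ge0.
pose Q d := Cmod (\csum_(0 <= k < K) (b k * RtoC (ramp A d (ln (INR k.+1))))).
have Qtop d : 0 < d -> Q d <= M * (2 * A + d).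
  move=> hd; rewrite /Q.
  have -> : (\csum_(0 <= k < K) (b k * RtoC (ramp A d (ln (INR k.+1)))) =
    \csum_(0 <= k < K) (b k * RtoC (tri (A + d) (ln (INR k.+1) - 0))) +
    (- (1)) * \csum_(0 <= k < K) (b k * RtoC (tri A (ln (INR k.+1) - 0))))%C.
    rewrite -csum_scal -csum_plus; apply: eq_bigr => k _.
    by rewrite !Rminus_0_r ramp_tri // ?RtoC_minus; [ring | exact: ln_INR_ge0].
  apply: Rle_trans (Cmod_triangle _ _) _.
  rewrite Cmod_mult Cmod_opp Cmod_1.
  have := tri_bound K (fun k => ln (INR k.+1)) b M (A + d) 0 ltac:(lra) hM.
  have := tri_bound K (fun k => ln (INR k.+1)) b M A 0 A0 hM.
  lra.
have Qstep d : 0 < d -> Q d <= (Q (2 * d) + M * d) / 2.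
  move=> hd.
  have e : (\csum_(0 <= k < K) (b k * RtoC (ramp A d (ln (INR k.+1)))) =
    RtoC (/ 2) * (\csum_(0 <= k < K) (b k * RtoC (ramp A (2 * d) (ln (INR k.+1)))) +
    (- (1)) * \csum_(0 <= k < K) (b k * RtoC (tri d (ln (INR k.+1) - (A + d))))))%C.
    rewrite -csum_scal -csum_plus -csum_scal; apply: eq_bigr => k _.
    rewrite ramp_double // RtoC_plus RtoC_mult.
    have e2 : (RtoC (/ 2) * RtoC 2 = 1)%C by rewrite -RtoC_mult Rinv_l //; lra.
    have -> : forall x y : C, (RtoC (/ 2) * (b k * (RtoC 2 * x + y) + - (1) * (b k * y)) = (RtoC (/ 2) * RtoC 2) * (b k * x))%C.
      by move=> x y; ring.
    by rewrite e2; ring.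
  rewrite {1}/Q e Cmod_mult Cmod_R Rabs_pos_eq; last lra.
  have h := tri_bound K (fun k => ln (INR k.+1)) b M d (A + d) ltac:(lra) hM.
  have h2 := Cmod_triangle (\csum_(0 <= k < K) (b k * RtoC (ramp A (2 * d) (ln (INR k.+1)))))
    ((- (1)) * \csum_(0 <= k < K) (b k * RtoC (tri d (ln (INR k.+1) - (A + d)))))%C.
  rewrite [Cmod (- (1) * _)]Cmod_mult Cmod_opp Cmod_1 -/(Q (2 * d)) in h2.
  lra.
(* Relative to the width, each doubling costs exactly [M / 2]. *)
have Qiter J d : 0 < d -> Q d <= d * (INR J * (M / 2)) + Q (2 ^ J * d) / 2 ^ J.
  elim: J d => [|J IH] d hd; first by rewrite /= Rmult_1_l; lra.
  have h1 := Qstep d hd; have h2 := IH (2 * d) ltac:(lra).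
  have -> : 2 ^ J.+1 * d = 2 ^ J * (2 * d) by rewrite /=; ring.
  have hp : 0 < 2 ^ J by apply: pow_lt; lra.
  have -> : Q (2 ^ J * (2 * d)) / 2 ^ J.+1 = (Q (2 ^ J * (2 * d)) / 2 ^ J) / 2 by rewrite /=; field; lra.
  rewrite S_INR; lra.
have pn := INR_gt0 n n0.
have pn1 : INR n.+1 = INR n + 1 by rewrite S_INR.
set d := ln (INR n.+1) - A.
have hd : / INR n.+1 <= d.
  have e : exp (- d) = INR n / INR n.+1.
    rewrite /d /A; have -> : - (ln (INR n.+1) - ln (INR n)) = ln (INR n) + - ln (INR n.+1) by ring.
    by rewrite exp_plus exp_Ropp !exp_ln //; lra.
  have := exp_ineq1_le (- d); rewrite e.
  have -> : INR n / INR n.+1 = 1 - / INR n.+1 by rewrite pn1; field; lra.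
  lra.
have d0 : 0 < d by apply: Rlt_le_trans hd; apply: Rinv_0_lt_compat; lra.
have QS : Q d = d * Cmod (\csum_(0 <= k < n) b k).
  have -> : d = Cmod (RtoC d) by rewrite Cmod_R Rabs_pos_eq //; lra.
  rewrite -Cmod_mult /Q Cmod_R (Rabs_pos_eq d); last lra.
  congr Cmod; rewrite (@csum_nat_split _ n K) //.
  rewrite [X in (_ + X)%C]big_nat [X in (_ + X)%C]big1; last first.
    move=> k /andP[hk _].
    have h : ln (INR n.+1) <= ln (INR k.+1).
      case: (Rle_lt_or_eq_dec (INR n.+1) (INR k.+1)) => [|h|->]; [apply: le_INR; lia | | by right].
      by left; apply: ln_increasing => //; lra.
    have -> : ramp A d (ln (INR k.+1)) = 0.
      by rewrite /ramp /Rmax /Rmin /d; repeat (destruct (Rle_dec _ _)); lra.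
    by rewrite Cmult_0_r.
  rewrite Cplus_0_r -csum_scal; apply: eq_big_nat => k /andP[_ hk].
  have pk := INR_gt0 k.+1 isT.
  have h : ln (INR k.+1) <= A.
    case: (Rle_lt_or_eq_dec (INR k.+1) (INR n)) => [|h|->]; [apply: le_INR; lia | | by right].
    by left; apply: ln_increasing.
  have -> : ramp A d (ln (INR k.+1)) = d.
    by rewrite /ramp /Rmax /Rmin; repeat (destruct (Rle_dec _ _)); lra.
  ring.
(* Since [d >= 1/(n+1)], having [2^J >= n+1] makes the final width at least 1. Minimality gives
   [2^(J-1) <= n], and with [ln 2 > 1/2] this becomes [J <= 2 + 2 A]. *)
set J := up_log 2 n.+1.
have := up_log_bounds (isT : 1 < 2)%N (ltac:(lia) : (1 < n.+1)%N); rewrite -/J => /andP[J1 J2].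
have J0 : (0 < J)%N by rewrite /J up_log_gt0; lia.
have pow2INR m : INR (2 ^ m)%N = 2 ^ m.
  by elim: m => // m IH; rewrite expnS mult_INR IH.
have D1 : 1 <= 2 ^ J * d.
  have h1 : INR n.+1 <= 2 ^ J by rewrite -pow2INR; apply: le_INR; lia.
  have h2 : INR n.+1 * / INR n.+1 = 1 by rewrite Rinv_r //; lra.
  have h3 : 0 < / INR n.+1 by apply: Rinv_0_lt_compat; lra.
  rewrite -h2; apply: Rmult_le_compat; lra.
have ln2 := ln_lt_2.
have Jle : INR J <= 2 + 2 * A.
  have h1 : INR J.-1 * ln 2 <= ln 2 + A.
    rewrite -ln_pow; last lra.
    rewrite -ln_mult; [|lra|lra].
    have h2 : 2 ^ J.-1 <= 2 * INR n.
      rewrite -pow2INR; apply: (Rle_trans _ (INR n)); last lra.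
      by apply: le_INR; lia.
    have h3 : 0 < 2 ^ J.-1 by apply: pow_lt; lra.
    by case: h2 => [h2|->]; [left; apply: ln_increasing | right].
  have -> : INR J = INR J.-1 + 1 by rewrite -S_INR prednK.
  have h4 := pos_INR J.-1.
  nra.
have h := Qiter J d d0.
have hD := Qtop (2 ^ J * d) ltac:(lra).
have hp : 0 < 2 ^ J by apply: pow_lt; lra.
have h5 : Q (2 ^ J * d) / 2 ^ J <= d * (M * (2 * A + 1)).
  apply/Rle_div_l => //; apply: Rle_trans hD _.
  have : M * (2 * A) * 1 <= M * (2 * A) * (2 ^ J * d).
    by apply: Rmult_le_compat_l => //; apply: Rmult_le_pos; lra.
  lra.
rewrite QS in h.
apply: (Rmult_le_reg_l d) => //.
(* The doublings contribute [M (1 + A)] and the last ramp [M (2 A + 1)], which add up to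
   [M (2 + 3 A)]. *)
have h6 : d * (INR J * (M / 2)) <= d * ((2 + 2 * A) * (M / 2)).
  by apply: Rmult_le_compat_l; [lra | apply: Rmult_le_compat_r; lra].
lra.
Qed.

Definition bounded_dseries (Delta M : R) (a : nat -> C) : Prop :=
  forall s, half_plane Delta s -> dconverges_abs a s /\ Cmod (dsum a s) <= M.

Lemma dsum_tail_le (a : nat -> C) (s : C) (K : nat) : dconverges_abs a s ->
  Cmod (dsum a s - \csum_(0 <= k < K) dterm a s k) <=
  Series (fun k => Cmod (dterm a s k)) - \rsum_(0 <= k < K) Cmod (dterm a s k).
Proof.
move=> h.
have hc := clim_minus _ _ _ _ (dsum_csums _ _ h) (clim_const (\csum_(0 <= k < K) dterm a s k)).
apply: (clim_bound _ _ _ _ K hc (is_lim_seq_const _)) => n hn.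
rewrite (@csum_nat_split _ K n) //.
have -> : forall x y : C, (x + y - x = y)%C by move=> x y; ring.
apply: Rle_trans (Cmod_csum _ _ _) _.
have := rsum_le_Series (fun k => Cmod (dterm a s k)) n (fun k => Cmod_ge_0 _) h.
by rewrite (@rsum_nat_split _ K n) // => h2; lra.
Qed.

Lemma dterm_vertical (a : nat -> C) (s : C) (t : R) (k : nat) :
  dterm a (s + Ci * RtoC t)%C k = (dterm a s k * cexp (- (Ci * RtoC (ln (INR k.+1) * t))))%C.
Proof.
rewrite /dterm npow_plus Cmult_assoc; congr (_ * _)%C.
by rewrite npow_cexp RtoC_mult; congr cexp; ring.
Qed.

Lemma Cmod_cexp_imag (t : R) : Cmod (cexp (- (Ci * RtoC t))) = 1.
Proof.
rewrite Cmod_cexp; have -> : Re (- (Ci * RtoC t))%C = 0 by rewrite /=; ring.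
exact: exp_0.
Qed.

Lemma Re_vertical (s : C) (t : R) : Re (s + Ci * RtoC t)%C = Re s.
Proof. by case: s => a b /=; ring. Qed.

(** [partial_sum_bound] concerns finite sums, so it is applied to the first [K] terms. On the
    vertical line through [s] these are bounded by [M] plus a tail of moduli that does not depend on
    [t], and this tail vanishes as [K] grows. *)
Lemma dseries_partial_bound (Delta M : R) (a : nat -> C) (s : C) (n : nat) :
  bounded_dseries Delta M a -> half_plane Delta s -> (0 < n)%N ->
  Cmod (\csum_(0 <= k < n) dterm a s k) <= M * (2 + 3 * ln (INR n)).
Proof.
move=> hb hs n0.
have [habs _] := hb s hs.
set V := Series (fun k => Cmod (dterm a s k)).
pose MK K := M + (V - \rsum_(0 <= k < K) Cmod (dterm a s k)).
have hK K : (n <= K)%coq_nat -> Cmod (\csum_(0 <= k < n) dterm a s k) <= MK K * (2 + 3 * ln (INR n)).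
  move=> hn; apply: (partial_sum_bound K) => //; first lia.
  move=> t; have hst : half_plane Delta (s + Ci * RtoC t)%C by rewrite /half_plane Re_vertical.
  have [h1 h2] := hb _ hst.
  have h3 := dsum_tail_le _ _ K h1.
  have e k : Cmod (dterm a (s + Ci * RtoC t)%C k) = Cmod (dterm a s k).
    by rewrite dterm_vertical Cmod_mult Cmod_cexp_imag Rmult_1_r.
  rewrite (Series_ext _ _ e) (eq_bigr _ (fun k _ => e k)) in h3.
  rewrite -(eq_bigr _ (fun k _ => dterm_vertical a s t k)).
  set S := \csum_(0 <= k < K) _ in h3 *; set D := dsum _ _ in h2 h3.
  have -> : S = (D + - (D - S))%C by ring.
  apply: Rle_trans (Cmod_triangle _ _) _; rewrite Cmod_opp.
  by rewrite /MK /V; lra.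
have hl : is_lim_seq (fun K => MK K * (2 + 3 * ln (INR n))) ((M + (V - V)) * (2 + 3 * ln (INR n))).
  apply: is_lim_seq_mult'; last exact: is_lim_seq_const.
  apply: is_lim_seq_plus'; first exact: is_lim_seq_const.
  apply: is_lim_seq_minus'; first exact: is_lim_seq_const.
  exact: Series_lim.
have h : Rbar_le (Cmod (\csum_(0 <= k < n) dterm a s k)) ((M + (V - V)) * (2 + 3 * ln (INR n))).
  by apply: is_lim_seq_le_loc (is_lim_seq_const _) hl; exists n.
rewrite Rminus_diag Rplus_0_r in h.
exact: h.
Qed.

Definition ninv_pow (theta : R) (n : nat) : R := exp (- (theta * ln (INR n))).

Lemma ninv_pow_pos (theta : R) (n : nat) : 0 < ninv_pow theta n.
Proof. exact: exp_pos. Qed.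

Lemma ninv_pow_decr (theta : R) (m n : nat) : 0 < theta -> (0 < m)%N -> (m <= n)%N ->
  ninv_pow theta n <= ninv_pow theta m.
Proof.
move=> ht m0 hmn.
have h : ln (INR m) <= ln (INR n).
  case: (Rle_lt_or_eq_dec (INR m) (INR n)) => [|h|->]; [apply: le_INR; lia | | by right].
  by left; apply: ln_increasing => //; exact: INR_gt0.
have h2 : - (theta * ln (INR n)) <= - (theta * ln (INR m)) by nra.
by rewrite /ninv_pow; case: h2 => [h2|->]; [left; exact: exp_increasing | right].
Qed.

Lemma abel_summation (e : nat -> C) (z : nat -> R) (m n : nat) : (m <= n)%N ->
  (\csum_(m <= k < n) (e k * RtoC (z k)) =
   RtoC (z n) * (\csum_(0 <= k < n) e k) - RtoC (z m) * (\csum_(0 <= k < m) e k) +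
   \csum_(m <= k < n) (RtoC (z k - z k.+1)%R * \csum_(0 <= j < k.+1) e j))%C.
Proof.
elim: n => [|n IH] hmn.
  have -> : m = 0%N by lia.
  by rewrite !big_nil; ring.
case: (ltngtP m n.+1) hmn => // [hmn _|-> _]; last first.
  by rewrite (@big_geq _ _ _ n.+1 n.+1) // [X in (_ + X)%C]big_geq //; ring.
have mn : (m <= n)%N by lia.
rewrite [LHS]big_nat_recr // [X in (_ + X)%C](big_nat_recr n m) // /=.
rewrite IH // [\big[Cplus/RtoC 0]_(0 <= k < n.+1) e k]big_nat_recr //= RtoC_minus.
ring.
Qed.

(** The weight [n^(-2 theta)] is split into two equal factors: one absorbs the growth of the partial
    sums, the other supplies the decay of the tail. The factor 4 covers the two boundary terms and
    twice the telescoping sum. *)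
Lemma abel_tail_bound (e : nat -> C) (theta B : R) (m n : nat) : 0 < theta -> 0 <= B ->
  (forall n, (0 < n)%N -> Cmod (\csum_(0 <= k < n) e k) <= B / ninv_pow theta n) ->
  (m <= n)%N ->
  Cmod (\csum_(m <= k < n) (e k * RtoC (ninv_pow theta k.+1 ^ 2))) <= 4 * B * ninv_pow theta m.+1.
Proof.
move=> ht hB hS hmn.
have y0 := ninv_pow_pos theta.
have ydec k : ninv_pow theta k.+2 <= ninv_pow theta k.+1 by apply: ninv_pow_decr.
have edge k : Cmod (RtoC (ninv_pow theta k.+1 ^ 2) * \csum_(0 <= k < k) e k) <= B * ninv_pow theta k.+1.
  case: k => [|k].
    by rewrite big_nil Cmult_0_r Cmod_0; apply: Rmult_le_pos => //; left.
  rewrite Cmod_mult Cmod_R Rabs_pos_eq; last exact: pow2_ge_0.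
  have h1 := hS k.+1 isT; have h2 := ydec k; have h3 := y0 k.+1; have h4 := y0 k.+2.
  apply: (Rle_trans _ (ninv_pow theta k.+2 ^ 2 * (B / ninv_pow theta k.+1))).
    by apply: Rmult_le_compat_l => //; exact: pow2_ge_0.
  have -> : ninv_pow theta k.+2 ^ 2 * (B / ninv_pow theta k.+1) =
    B * ninv_pow theta k.+2 * (ninv_pow theta k.+2 / ninv_pow theta k.+1) by field; lra.
  have h5 : ninv_pow theta k.+2 / ninv_pow theta k.+1 <= 1 by apply/Rle_div_l; lra.
  rewrite -[X in _ <= X]Rmult_1_r; apply: Rmult_le_compat_l => //.
  by apply: Rmult_le_pos; lra.
have body : Cmod (\csum_(m <= k < n) (RtoC (ninv_pow theta k.+1 ^ 2 - ninv_pow theta k.+2 ^ 2)%R * \csum_(0 <= j < k.+1) e j)) <=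
    2 * B * (ninv_pow theta m.+1 - ninv_pow theta n.+1).
  apply: Rle_trans (Cmod_csum _ _ _) _.
  apply: (Rle_trans _ (\rsum_(m <= k < n) (2 * B * (ninv_pow theta k.+1 - ninv_pow theta k.+2)))).
    apply: rsum_le => k _ _; rewrite Cmod_mult Cmod_R.
    have h1 := hS k.+1 isT; have h2 := ydec k; have h3 := y0 k.+1; have h4 := y0 k.+2.
    set u := ninv_pow theta k.+1 in h1 h2 h3 *; set v := ninv_pow theta k.+2 in h2 h4 *.
    rewrite Rabs_pos_eq; last nra.
    apply: (Rle_trans _ ((u ^ 2 - v ^ 2) * (B / u))).
      by apply: Rmult_le_compat_l => //; nra.
    (* Factoring out [u - v] leaves a factor at most 2, after which the sum telescopes. *)
    have -> : (u ^ 2 - v ^ 2) * (B / u) = B * (u - v) * (1 + v / u) by field; lra.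
    have h5 : v / u <= 1 by apply/Rle_div_l; lra.
    have : 0 <= B * (u - v) by apply: Rmult_le_pos; lra.
    nra.
  rewrite -big_distrr /=.
  right; congr (_ * _).
  elim: n hmn {hS} => [|n IH] hmn.
    have -> : m = 0%N by lia.
    by rewrite big_nil; ring.
  case: (ltngtP m n.+1) hmn => // [hmn _|-> _]; last by rewrite big_geq //; ring.
  rewrite big_nat_recr /=; last lia.
  by rewrite IH; [ring | lia].
rewrite (abel_summation e (fun k => ninv_pow theta k.+1 ^ 2)) //.
apply: Rle_trans (Cmod_triangle _ _) _.
have h1 := Cmod_triangle (RtoC (ninv_pow theta n.+1 ^ 2) * \csum_(0 <= k < n) e k)
  (- (RtoC (ninv_pow theta m.+1 ^ 2) * \csum_(0 <= k < m) e k)).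
rewrite Cmod_opp in h1.
have h2 := edge n; have h3 := edge m.
have h4 : ninv_pow theta n.+1 <= ninv_pow theta m.+1 by apply: ninv_pow_decr.
have h5 := y0 n.+1.
rewrite /Cminus.
have h6 : B * ninv_pow theta n.+1 <= B * ninv_pow theta m.+1 by exact: Rmult_le_compat_l.
have h7 : 0 <= B * ninv_pow theta n.+1 by apply: Rmult_le_pos; lra.
lra.
Qed.

(** The logarithmic bound is used at [s - 2 theta], still in the half plane of boundedness, in the
    weaker form [2 + 3 ln n <= (2 + 3/theta) n^theta]. The estimate depends on the series only
    through [M]. *)
Lemma bounded_dseries_tail (Delta M theta : R) (a : nat -> C) (s : C) (m n : nat) :
  0 <= M -> bounded_dseries Delta M a -> 0 < theta -> half_plane (Delta + 2 * theta) s -> (m <= n)%N ->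
  Cmod (\csum_(m <= k < n) dterm a s k) <= 4 * (M * (2 + 3 / theta)) * ninv_pow theta m.+1.
Proof.
move=> M0 hb ht hs hmn.
set s1 := (s - RtoC (2 * theta))%C.
have hs1 : half_plane Delta s1 by move: hs; rewrite /half_plane /s1 Re_minus [Re (RtoC _)]/=; lra.
have hC : 0 < 3 / theta by apply: Rdiv_lt_0_compat; lra.
rewrite (eq_bigr (fun k => dterm a s1 k * RtoC (ninv_pow theta k.+1 ^ 2))%C); last first.
  move=> k _; rewrite /dterm -Cmult_assoc; congr (_ * _)%C.
  have {1}-> : s = (s1 + RtoC (2 * theta))%C by rewrite /s1; ring.
  rewrite npow_plus; congr (_ * _)%C.
  rewrite npow_cexp /ninv_pow /= Rmult_1_r -exp_plus -RtoC_mult -RtoC_opp /cexp /= sin_0 cos_0.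
  apply: C_eq; rewrite /=; last ring.
  by rewrite Rmult_1_r; congr exp; ring.
apply: abel_tail_bound => //.
  by apply: Rmult_le_pos => //; lra.
move=> j j0.
apply: Rle_trans (dseries_partial_bound _ _ _ _ _ hb hs1 j0) _.
have -> : M * (2 + 3 / theta) / ninv_pow theta j = M * ((2 + 3 / theta) * exp (theta * ln (INR j))).
  by rewrite /ninv_pow exp_Ropp; field; split; [lra | have := exp_pos (theta * ln (INR j)); lra].
apply: Rmult_le_compat_l => //.
have h1 := exp_ineq1_le (theta * ln (INR j)).
have h2 := ln_INR_ge0 j.
apply: (Rle_trans _ ((2 + 3 / theta) * (1 + theta * ln (INR j)))).
  have -> : (2 + 3 / theta) * (1 + theta * ln (INR j)) = 2 + 3 * ln (INR j) + 3 / theta + 2 * (theta * ln (INR j)).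
    by field; lra.
  have : 0 <= theta * ln (INR j) by apply: Rmult_le_pos; lra.
  lra.
by apply: Rmult_le_compat_l; lra.
Qed.

Lemma ninv_pow_lim (theta : R) : 0 < theta -> is_lim_seq (fun n => ninv_pow theta n.+1) 0.
Proof.
move=> ht; apply/is_lim_seq_eps; first by move=> n; left; exact: ninv_pow_pos.
move=> eps he.
have [N hN] := INR_unbounded (exp (- ln eps / theta)).
exists N => n hn.
have h1 : exp (- ln eps / theta) < INR n.+1.
  by apply: Rlt_le_trans hN _; apply: le_INR; lia.
have h2 : - ln eps / theta < ln (INR n.+1).
  by rewrite -(ln_exp (- ln eps / theta)); apply: ln_increasing => //; exact: exp_pos.
have h3 : - ln eps < theta * ln (INR n.+1).
  by rewrite Rmult_comm; apply/Rlt_div_l.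
rewrite /ninv_pow -[X in _ <= X](exp_ln eps) //; left; apply: exp_increasing; lra.
Qed.

Lemma proj_dterm (N n : nat) (c : nat -> C) (s : C) (m : nat) : (n < N)%N ->
  \csum_(m <= k < n) dterm (proj N c) s k = \csum_(m <= k < n) dterm c s k.
Proof.
move=> hN; apply: eq_big_nat => k /andP[_ hk]; rewrite /dterm proj_in //.
by apply: in_gen_P_large => //; lia.
Qed.

(** Any block of terms of [c] is a block of some [proj N c], so the uniform tail estimates carry
    over. The first conclusion, uniform on smaller half planes, is what holomorphy of the sum is
    derived from. *)
Lemma dseries_of_projections (Delta M : R) (c : nat -> C) : 0 <= M ->
  (forall N, (0 < N)%N -> bounded_dseries Delta M (proj N c)) ->
  (forall theta s n, 0 < theta -> half_plane (Delta + 2 * theta) s ->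
     Cmod (\csum_(0 <= k < n) dterm c s k) <= 4 * (M * (2 + 3 / theta))) /\
  (forall s, half_plane Delta s -> csums (dterm c s) (dsum c s) /\ Cmod (dsum c s) <= M).
Proof.
move=> M0 hb.
have tail theta s m n : 0 < theta -> half_plane (Delta + 2 * theta) s -> (m <= n)%N ->
    Cmod (\csum_(m <= k < n) dterm c s k) <= 4 * (M * (2 + 3 / theta)) * ninv_pow theta m.+1.
  move=> ht hs hmn.
  rewrite -(proj_dterm n.+1) //.
  exact: (bounded_dseries_tail _ _ _ _ _ _ _ M0 (hb n.+1 isT)).
split.
  move=> theta s n ht hs.
  have := tail theta s 0%N n ht hs (leq0n n).
  by rewrite /ninv_pow /= ln_1 Rmult_0_r Ropp_0 exp_0 Rmult_1_r.
move=> s hs.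
set theta := (Re s - Delta) / 4.
have ht : 0 < theta by rewrite /half_plane in hs; rewrite /theta; lra.
have hs2 : half_plane (Delta + 2 * theta) s by rewrite /half_plane /theta in hs *; lra.
set E := 4 * (M * (2 + 3 / theta)).
have E0 : 0 <= E.
  have : 0 < 3 / theta by apply: Rdiv_lt_0_compat; lra.
  move=> q; rewrite /E; apply: Rmult_le_pos; first lra.
  by apply: Rmult_le_pos => //; lra.
have hlim : is_lim_seq (fun n => E * ninv_pow theta n.+1) 0.
  by have := is_lim_seq_mult' _ _ _ _ (is_lim_seq_const E) (ninv_pow_lim _ ht); rewrite Rmult_0_r.
have [l hl] : exists l, csums (dterm c s) l.
  apply: clim_cauchy => eps he.
  have hpos n : 0 <= E * ninv_pow theta n.+1 by apply: Rmult_le_pos => //; left; exact: ninv_pow_pos.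
  have [N hN] := proj1 (is_lim_seq_eps _ hpos) hlim eps he.
  exists N => m n hm hmn.
  rewrite (@csum_nat_split _ m n) //.
  have -> : forall x y : C, (x + y - x = y)%C by move=> x y; ring.
  by apply: Rle_trans (tail theta s m n ht hs2 hmn) (hN m hm).
have -> : dsum c s = l by exact: CSeries_unique.
split=> //.
(* The n-th partial sum of [c] is that of [proj n.+1 c], whose full sum is at most [M] and differs
   from the partial sum by one tail; the error vanishes in the limit and [M] is kept exactly. *)
apply: (clim_bound _ _ (fun n => M + E * ninv_pow theta n.+1) _ 0 hl).
  by have := is_lim_seq_plus' _ _ _ _ (is_lim_seq_const M) hlim; rewrite Rplus_0_r.
move=> n _; rewrite -(proj_dterm n.+1) //.
have [h1 h2] := hb n.+1 isT s hs.
have hc := clim_minus _ _ _ _ (dsum_csums _ _ h1) (clim_const (\csum_(0 <= k < n) dterm (proj n.+1 c) s k)).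
have h3 : Cmod (dsum (proj n.+1 c) s - \csum_(0 <= k < n) dterm (proj n.+1 c) s k) <= E * ninv_pow theta n.+1.
  apply: (clim_bound _ _ _ _ n hc (is_lim_seq_const _)) => j hj.
  rewrite (@csum_nat_split _ n j) //.
  have -> : forall x y : C, (x + y - x = y)%C by move=> x y; ring.
  exact: (bounded_dseries_tail _ _ _ _ _ _ _ M0 (hb n.+1 isT)).
set S := \csum_(0 <= k < n) _ in h3 *; set D := dsum _ _ in h2 h3.
have -> : S = (D + - (D - S))%C by ring.
by apply: Rle_trans (Cmod_triangle _ _) _; rewrite Cmod_opp; lra.
Qed.

(** * Goursat's theorem on rectangles *)

Definition is_CInt (f : R -> C) (a b : R) (l : C) : Prop :=
  is_RInt (fun t => Re (f t)) a b (Re l) /\ is_RInt (fun t => Im (f t)) a b (Im l).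

Definition CInt (f : R -> C) (a b : R) : C :=
  (RInt (fun t => Re (f t)) a b, RInt (fun t => Im (f t)) a b).

Definition ccontinuous (f : R -> C) (t : R) : Prop :=
  forall eps, 0 < eps -> exists d, 0 < d /\ forall u, Rabs (u - t) < d -> Cmod (f u - f t) <= eps.

Lemma ccontinuous_continuous (g : C -> R) (f : R -> C) (t : R) :
  (forall x y, Rabs (g x - g y) <= Cmod (x - y)) -> ccontinuous f t -> continuous (fun t => g (f t)) t.
Proof.
move=> hg hf; apply/filterlim_locally => eps.
have [d [hd H]] := hf (eps / 2) ltac:(have := cond_pos eps; lra).
exists (mkposreal d hd) => u hu.
rewrite /ball /= /AbsRing_ball /abs /minus /plus /opp /=.
apply: Rle_lt_trans (hg _ _) _; apply: Rle_lt_trans (H u hu) _.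
by have := cond_pos eps; lra.
Qed.

Lemma is_CInt_CInt (f : R -> C) (a b : R) : a <= b ->
  (forall t, a <= t <= b -> ccontinuous f t) -> is_CInt f a b (CInt f a b).
Proof.
move=> hab hf; split; apply: (RInt_correct (V := R_CompleteNormedModule));
  apply: (ex_RInt_continuous (V := R_CompleteNormedModule)) => t; rewrite Rmin_left // Rmax_right // => /hf.
- by apply: ccontinuous_continuous => x y; rewrite -Re_minus; exact: re_le_Cmod.
- by apply: ccontinuous_continuous => x y; rewrite -Im_minus; exact: im_le_Cmod.
Qed.

Lemma is_CInt_unique (f : R -> C) (a b : R) (l l' : C) : is_CInt f a b l -> is_CInt f a b l' -> l = l'.
Proof.
move=> [h1 h2] [h3 h4]; apply: C_eq.
- by rewrite -(is_RInt_unique _ _ _ _ h1) -(is_RInt_unique _ _ _ _ h3).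
- by rewrite -(is_RInt_unique _ _ _ _ h2) -(is_RInt_unique _ _ _ _ h4).
Qed.

Lemma is_CInt_eq (f : R -> C) (a b : R) (l l' : C) : l = l' -> is_CInt f a b l -> is_CInt f a b l'.
Proof. by move=> ->. Qed.

Lemma is_CInt_ext (f g : R -> C) (a b : R) (l : C) : a <= b ->
  (forall t, a < t < b -> f t = g t) -> is_CInt f a b l -> is_CInt g a b l.
Proof.
move=> hab h [h1 h2]; split.
- by apply: is_RInt_ext h1 => t; rewrite Rmin_left // Rmax_right // => /h ->.
- by apply: is_RInt_ext h2 => t; rewrite Rmin_left // Rmax_right // => /h ->.
Qed.

Lemma is_CInt_plus (f g : R -> C) (a b : R) (l m : C) :
  is_CInt f a b l -> is_CInt g a b m -> is_CInt (fun t => f t + g t)%C a b (l + m)%C.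
Proof. by move=> [h1 h2] [h3 h4]; split; apply: is_RInt_plus. Qed.

Lemma is_CInt_scal (c : C) (f : R -> C) (a b : R) (l : C) :
  is_CInt f a b l -> is_CInt (fun t => c * f t)%C a b (c * l)%C.
Proof.
move=> [h1 h2]; split.
- apply: is_RInt_minus; [exact: (is_RInt_scal _ _ _ (Re c)) | exact: (is_RInt_scal _ _ _ (Im c))].
- apply: is_RInt_plus; [exact: (is_RInt_scal _ _ _ (Re c)) | exact: (is_RInt_scal _ _ _ (Im c))].
Qed.

Lemma is_CInt_minus (f g : R -> C) (a b : R) (l m : C) :
  is_CInt f a b l -> is_CInt g a b m -> is_CInt (fun t => f t - g t)%C a b (l - m)%C.
Proof. by move=> [h1 h2] [h3 h4]; split; apply: is_RInt_minus. Qed.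

Lemma is_CInt_const (c : C) (a b : R) : is_CInt (fun=> c) a b (RtoC (b - a) * c)%C.
Proof.
split.
- by have := is_RInt_const a b (Re c); rewrite /scal /= /mult /= Rmult_0_l Rminus_0_r.
- by have := is_RInt_const a b (Im c); rewrite /scal /= /mult /= Rmult_0_l Rplus_0_r.
Qed.

Lemma is_CInt_Chasles (f : R -> C) (a b c : R) (l m : C) :
  is_CInt f a b l -> is_CInt f b c m -> is_CInt f a c (l + m)%C.
Proof. by move=> [h1 h2] [h3 h4]; split; apply: (is_RInt_Chasles _ a b c). Qed.

(** Multiplying the integrand by the conjugate of [l] reduces the modulus to a real integral and
    gives [|l|^2 <= |l| M (b - a)]. *)
Lemma is_CInt_bound (f : R -> C) (a b : R) (l : C) (M : R) : a <= b ->
  is_CInt f a b l -> (forall t, a <= t <= b -> Cmod (f t) <= M) -> Cmod l <= M * (b - a).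
Proof.
move=> hab hl hM.
have [h1 _] := is_CInt_scal (Cconj l) _ _ _ _ hl.
have h2 := is_RInt_const a b (Cmod l * M).
have h3 : Re (Cconj l * l)%C <= (b - a) * (Cmod l * M).
  apply: (is_RInt_le _ _ a b _ _ hab h1 h2) => t ht.
  apply: Rle_trans (Rle_abs _) _; apply: Rle_trans (re_le_Cmod _) _.
  rewrite Cmod_mult Cmod_conj; apply: Rmult_le_compat_l; first exact: Cmod_ge_0.
  by apply: hM; lra.
have e : Re (Cconj l * l)%C = Cmod l ^ 2 by rewrite Cmult_comm -Cmod2_conj.
rewrite e in h3.
case: (Req_dec (Cmod l) 0) => hl0.
  rewrite hl0; apply: Rmult_le_pos; last lra.
  by apply: Rle_trans (hM a _); [exact: Cmod_ge_0 | lra].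
have := Cmod_ge_0 l => q.
apply: (Rmult_le_reg_l (Cmod l)); lra.
Qed.

Lemma cdiff_ccontinuous (f : C -> C) (g : R -> C) (t : R) (l : C) :
  cdiff f (g t) l -> ccontinuous g t -> ccontinuous (fun t => f (g t)) t.
Proof.
move=> hf hg eps he.
have [d [hd H]] := cdiff_bound _ _ _ hf.
have hl := Cmod_ge_0 l.
have hk : 0 < eps / (Cmod l + 1) by apply: Rdiv_lt_0_compat; lra.
have [d' [hd' H']] := hg (Rmin (d / 2) (eps / (Cmod l + 1))) ltac:(apply: Rmin_pos; lra).
exists d'; split=> // u /H' h.
have h1 := Rle_trans _ _ _ h (Rmin_l _ _).
have h2 := Rle_trans _ _ _ h (Rmin_r _ _).
have := H (g u - g t)%C ltac:(lra).
have -> : (g t + (g u - g t) = g u)%C by ring.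
move=> h3; apply: Rle_trans h3 _.
have := Rmult_le_compat_l (Cmod l + 1) _ _ ltac:(lra) h2.
by have -> : (Cmod l + 1) * (eps / (Cmod l + 1)) = eps by field; lra.
Qed.

Lemma ccontinuous_horizontal (y t : R) : ccontinuous (fun t => (t, y)) t.
Proof.
move=> eps he; exists eps; split=> // u hu.
have -> : ((u, y) - (t, y) = RtoC (u - t))%C by apply: C_eq => /=; ring.
by rewrite Cmod_R; lra.
Qed.

Lemma ccontinuous_vertical (x t : R) : ccontinuous (fun t => (x, t)) t.
Proof.
move=> eps he; exists eps; split=> // u hu.
have -> : ((x, u) - (x, t) = Ci * RtoC (u - t))%C by apply: C_eq => /=; ring.
by rewrite Cmod_mult Cmod_Ci Cmod_R; lra.
Qed.

(** The counterclockwise contour integral over the boundary, with [dz = dt] on the horizontal and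
    [dz = i dt] on the vertical sides. *)
Definition rect_int (f : C -> C) (a b c d : R) : C :=
  (CInt (fun t => f (t, c)) a b - CInt (fun t => f (t, d)) a b +
   Ci * (CInt (fun t => f (b, t)) c d - CInt (fun t => f (a, t)) c d))%C.

Definition diff_rect (f : C -> C) (a b c d : R) : Prop :=
  forall x y, a <= x <= b -> c <= y <= d -> exists l, cdiff f (x, y) l.

Lemma diff_rect_horizontal (f : C -> C) (a b c d y a' b' : R) : diff_rect f a b c d ->
  c <= y <= d -> a <= a' -> a' <= b' -> b' <= b ->
  is_CInt (fun t => f (t, y)) a' b' (CInt (fun t => f (t, y)) a' b').
Proof.
move=> hf hy h1 h2 h3; apply: is_CInt_CInt => // t ht.
have [l hl] := hf t y ltac:(lra) hy.
by apply: cdiff_ccontinuous hl _; exact: ccontinuous_horizontal.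
Qed.

Lemma diff_rect_vertical (f : C -> C) (a b c d x c' d' : R) : diff_rect f a b c d ->
  a <= x <= b -> c <= c' -> c' <= d' -> d' <= d ->
  is_CInt (fun t => f (x, t)) c' d' (CInt (fun t => f (x, t)) c' d').
Proof.
move=> hf hx h1 h2 h3; apply: is_CInt_CInt => // t ht.
have [l hl] := hf x t hx ltac:(lra).
by apply: cdiff_ccontinuous hl _; exact: ccontinuous_vertical.
Qed.

Lemma rect_int_split_h (f : C -> C) (a m b c d : R) : diff_rect f a b c d ->
  a <= m <= b -> c <= d -> rect_int f a b c d = (rect_int f a m c d + rect_int f m b c d)%C.
Proof.
move=> hf hm hcd; rewrite /rect_int.
have chas y : c <= y <= d ->
    CInt (fun t => f (t, y)) a b = (CInt (fun t => f (t, y)) a m + CInt (fun t => f (t, y)) m b)%C.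
  move=> hy; apply: (is_CInt_unique (fun t => f (t, y)) a b).
    by apply: (diff_rect_horizontal f a b c d) => //; lra.
  by apply: is_CInt_Chasles; apply: (diff_rect_horizontal f a b c d) => //; lra.
by rewrite !chas; [ring | lra | lra].
Qed.

Lemma rect_int_split_v (f : C -> C) (a b c m d : R) : diff_rect f a b c d ->
  c <= m <= d -> a <= b -> rect_int f a b c d = (rect_int f a b c m + rect_int f a b m d)%C.
Proof.
move=> hf hm hab; rewrite /rect_int.
have chas x : a <= x <= b ->
    CInt (fun t => f (x, t)) c d = (CInt (fun t => f (x, t)) c m + CInt (fun t => f (x, t)) m d)%C.
  move=> hx; apply: (is_CInt_unique (fun t => f (x, t)) c d).
    by apply: (diff_rect_vertical f a b c d) => //; lra.
  by apply: is_CInt_Chasles; apply: (diff_rect_vertical f a b c d) => //; lra.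
by rewrite !chas; [ring | lra | lra].
Qed.

Lemma diff_rect_sub (f : C -> C) (a b c d a' b' c' d' : R) : diff_rect f a b c d ->
  a <= a' -> b' <= b -> c <= c' -> d' <= d -> diff_rect f a' b' c' d'.
Proof. by move=> h h1 h2 h3 h4 x y hx hy; apply: h; lra. Qed.

(* The linear part of f at z0 integrates to zero around the rectangle. *)
Lemma rect_int_local (f : C -> C) (a b c d eps : R) (z0 l : C) :
  diff_rect f a b c d -> a <= b -> c <= d ->
  (forall x y, a <= x <= b -> c <= y <= d ->
     Cmod (f (x, y) - f z0 - l * ((x, y) - z0)) <= eps * ((b - a) + (d - c))) ->
  Cmod (rect_int f a b c d) <= 2 * eps * ((b - a) + (d - c)) ^ 2.
Proof.
move=> hf hab hcd hE.
set D := (b - a) + (d - c).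
(* Opposite sides are paired, so the linear part enters only through its constant difference between
   them; the two constants cancel in the total. *)
have i1 : is_CInt (fun t => f (t, c) - f (t, d) + l * Ci * RtoC (d - c))%C a b
    (CInt (fun t => f (t, c)) a b - CInt (fun t => f (t, d)) a b + RtoC (b - a) * (l * Ci * RtoC (d - c)))%C.
  apply: is_CInt_plus; last exact: is_CInt_const.
  by apply: is_CInt_minus; apply: (diff_rect_horizontal f a b c d) => //; lra.
have i2 : is_CInt (fun t => f (b, t) - f (a, t) - l * RtoC (b - a))%C c d
    (CInt (fun t => f (b, t)) c d - CInt (fun t => f (a, t)) c d - RtoC (d - c) * (l * RtoC (b - a)))%C.
  apply: is_CInt_minus; last exact: is_CInt_const.
  by apply: is_CInt_minus; apply: (diff_rect_vertical f a b c d) => //; lra.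
have b1 := is_CInt_bound _ _ _ _ (2 * eps * D) hab i1.
have b2 := is_CInt_bound _ _ _ _ (2 * eps * D) hcd i2.
have -> : rect_int f a b c d =
  ((CInt (fun t => f (t, c)) a b - CInt (fun t => f (t, d)) a b + RtoC (b - a) * (l * Ci * RtoC (d - c))) +
  Ci * (CInt (fun t => f (b, t)) c d - CInt (fun t => f (a, t)) c d - RtoC (d - c) * (l * RtoC (b - a))))%C.
  by rewrite /rect_int; ring.
apply: Rle_trans (Cmod_triangle _ _) _.
rewrite Cmod_mult Cmod_Ci Rmult_1_l.
suff : 2 * eps * D ^ 2 = 2 * eps * D * (b - a) + 2 * eps * D * (d - c).
  move=> ->; apply: Rplus_le_compat.
  - apply: b1 => t ht.
    have -> : (f (t, c) - f (t, d) + l * Ci * RtoC (d - c) =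
      (f (t, c) - f z0 - l * ((t, c) - z0)) - (f (t, d) - f z0 - l * ((t, d) - z0)))%C.
      have -> : ((t, c) = (t, d) - Ci * RtoC (d - c))%C by apply: C_eq => /=; ring.
      ring.
    apply: Rle_trans (Cmod_triangle _ _) _; rewrite Cmod_opp.
    by have := hE t c ltac:(lra) ltac:(lra); have := hE t d ltac:(lra) ltac:(lra); rewrite -/D; lra.
  - apply: b2 => t ht.
    have -> : (f (b, t) - f (a, t) - l * RtoC (b - a) =
      (f (b, t) - f z0 - l * ((b, t) - z0)) - (f (a, t) - f z0 - l * ((a, t) - z0)))%C.
      have -> : ((b, t) = (a, t) + RtoC (b - a))%C by apply: C_eq => /=; ring.
      ring.
    apply: Rle_trans (Cmod_triangle _ _) _; rewrite Cmod_opp.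
    by have := hE b t ltac:(lra) ltac:(lra); have := hE a t ltac:(lra) ltac:(lra); rewrite -/D; lra.
by rewrite /D; ring.
Qed.

Lemma rect_int_bisect (f : C -> C) (x y h k : R) : 0 <= h -> 0 <= k ->
  diff_rect f x (x + 2 * h) y (y + 2 * k) ->
  exists p : R * R, x <= p.1 <= x + h /\ y <= p.2 <= y + k /\
    Cmod (rect_int f x (x + 2 * h) y (y + 2 * k)) <= 4 * Cmod (rect_int f p.1 (p.1 + h) p.2 (p.2 + k)).
Proof.
move=> hh hk hf.
apply: NNPP => hno.
have small u v : x <= u <= x + h -> y <= v <= y + k ->
    4 * Cmod (rect_int f u (u + h) v (v + k)) < Cmod (rect_int f x (x + 2 * h) y (y + 2 * k)).
  by move=> hu hv; apply: Rnot_le_lt => hle; apply: hno; exists (u, v).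
have q1 := small x y ltac:(lra) ltac:(lra).
have q2 := small (x + h) y ltac:(lra) ltac:(lra).
have q3 := small x (y + k) ltac:(lra) ltac:(lra).
have q4 := small (x + h) (y + k) ltac:(lra) ltac:(lra).
have ex : x + h + h = x + 2 * h by ring.
have ey : y + k + k = y + 2 * k by ring.
rewrite ?ex ?ey in q1 q2 q3 q4.
have e : rect_int f x (x + 2 * h) y (y + 2 * k) =
  (rect_int f x (x + h) y (y + k) + rect_int f (x + h) (x + 2 * h) y (y + k) +
  (rect_int f x (x + h) (y + k) (y + 2 * k) + rect_int f (x + h) (x + 2 * h) (y + k) (y + 2 * k)))%C.
  rewrite (rect_int_split_v f _ _ y (y + k)) //; [|lra|lra].
  by congr (_ + _)%C; apply: rect_int_split_h; try lra; apply: diff_rect_sub hf _ _ _ _; lra.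
have t1 := Cmod_triangle (rect_int f x (x + h) y (y + k) + rect_int f (x + h) (x + 2 * h) y (y + k))
  (rect_int f x (x + h) (y + k) (y + 2 * k) + rect_int f (x + h) (x + 2 * h) (y + k) (y + 2 * k)).
have t2 := Cmod_triangle (rect_int f x (x + h) y (y + k)) (rect_int f (x + h) (x + 2 * h) y (y + k)).
have t3 := Cmod_triangle (rect_int f x (x + h) (y + k) (y + 2 * k)) (rect_int f (x + h) (x + 2 * h) (y + k) (y + 2 * k)).
rewrite -e in t1; lra.
Qed.

Lemma goursat (f : C -> C) (a b c d : R) : a <= b -> c <= d ->
  diff_rect f a b c d -> rect_int f a b c d = 0.
Proof.
move=> hab hcd hf.
set h := b - a; set k := d - c.
pose hn n := h / 2 ^ n; pose kn n := k / 2 ^ n.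
have p2 n : 0 < 2 ^ n by apply: pow_lt; lra.
have hn0 n : 0 <= hn n by apply: Rmult_le_pos; [rewrite /h; lra | left; exact: Rinv_0_lt_compat].
have kn0 n : 0 <= kn n by apply: Rmult_le_pos; [rewrite /k; lra | left; exact: Rinv_0_lt_compat].
have hnS n : hn n = 2 * hn n.+1 by rewrite /hn /=; have := p2 n => ?; field; lra.
have knS n : kn n = 2 * kn n.+1 by rewrite /kn /=; have := p2 n => ?; field; lra.
pose F n (p : R * R) := Cmod (rect_int f p.1 (p.1 + hn n) p.2 (p.2 + kn n)).
pose inside n (p : R * R) := a <= p.1 /\ p.1 + hn n <= b /\ c <= p.2 /\ p.2 + kn n <= d.
have ex_step n p : exists p', inside n p ->
    inside n.+1 p' /\ p.1 <= p'.1 <= p.1 + hn n.+1 /\ p.2 <= p'.2 <= p.2 + kn n.+1 /\ F n p <= 4 * F n.+1 p'.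
  case: (excluded_middle_informative (inside n p)) => hin; last by exists p.
  case: (hin) => i1 [i2 [i3 i4]].
  have [] := rect_int_bisect f p.1 p.2 (hn n.+1) (kn n.+1) (hn0 _) (kn0 _).
    by rewrite -hnS -knS; apply: diff_rect_sub hf _ _ _ _.
  rewrite -hnS -knS => p' [h1 [h2 h3]]; exists p' => _; split=> //.
  by rewrite hnS in i2; rewrite knS in i4; rewrite /inside; lra.
pose step n p := proj1_sig (constructive_indefinite_description _ (ex_step n p)).
have hstep n p : inside n p -> inside n.+1 (step n p) /\ p.1 <= (step n p).1 <= p.1 + hn n.+1 /\
    p.2 <= (step n p).2 <= p.2 + kn n.+1 /\ F n p <= 4 * F n.+1 (step n p).
  by rewrite /step; case: constructive_indefinite_description.
pose fix z n := if n is m.+1 then step m (z m) else (a, c).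
have zin n : inside n (z n).
  elim: n => [|n IH]; last by have [] := hstep n _ IH.
  by rewrite /inside /= /hn /kn /= /h /k; lra.
have zS n : (z n).1 <= (z n.+1).1 <= (z n).1 + hn n.+1 /\ (z n).2 <= (z n.+1).2 <= (z n).2 + kn n.+1 /\
    F n (z n) <= 4 * F n.+1 (z n.+1) by have [_ ?] := hstep n _ (zin n).
have zF n : F 0%N (z 0%N) <= 4 ^ n * F n (z n).
  elim: n => [|n IH]; first by rewrite /= Rmult_1_l; right.
  have [_ [_ h3]] := zS n.
  have p4 : 0 < 4 ^ n by apply: pow_lt; lra.
  by have := Rmult_le_compat_l _ _ _ (Rlt_le _ _ p4) h3; rewrite -tech_pow_Rmult; lra.
have lim0 q : is_lim_seq (fun n => q / 2 ^ n) 0.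
  apply: (is_lim_seq_ext (fun n => q * (/ 2) ^ n)); first by move=> n; rewrite pow_inv.
  have := is_lim_seq_mult' _ _ _ _ (is_lim_seq_const q) (is_lim_seq_geom (/ 2) ltac:(rewrite Rabs_pos_eq; lra)).
  by rewrite Rmult_0_r.
have [xi hxi] : ex_finite_lim_seq (fun n => (z n).1).
  apply: (ex_finite_lim_seq_incr _ b) => n; first by have [[? _] _] := zS n.
  by have [_ [? _]] := zin n; have := hn0 n; lra.
have [eta heta] : ex_finite_lim_seq (fun n => (z n).2).
  apply: (ex_finite_lim_seq_incr _ d) => n; first by have [_ [[? _] _]] := zS n.
  by have [_ [_ [_ ?]]] := zin n; have := kn0 n; lra.
have xlo n : (z n).1 <= xi by apply: is_lim_seq_incr_compare hxi _ n => m; have [[? _] _] := zS m.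
have ylo n : (z n).2 <= eta by apply: is_lim_seq_incr_compare heta _ n => m; have [_ [[? _] _]] := zS m.
have xhi n : xi <= (z n).1 + hn n.
  have hl := is_lim_seq_plus' _ _ _ _ hxi (lim0 h); rewrite Rplus_0_r in hl.
  apply: (is_lim_seq_decr_compare (fun n => (z n).1 + hn n) xi hl _ n) => m.
  by have [[_ ?] _] := zS m; rewrite (hnS m); lra.
have yhi n : eta <= (z n).2 + kn n.
  have hl := is_lim_seq_plus' _ _ _ _ heta (lim0 k); rewrite Rplus_0_r in hl.
  apply: (is_lim_seq_decr_compare (fun n => (z n).2 + kn n) eta hl _ n) => m.
  by have [_ [[_ ?] _]] := zS m; rewrite (knS m); lra.
have hx0 : a <= xi <= b by have := xlo 0%N; have := xhi 0%N; rewrite /= /hn /= /h; lra.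
have hy0 : c <= eta <= d by have := ylo 0%N; have := yhi 0%N; rewrite /= /kn /= /k; lra.
have [l hl] := hf xi eta hx0 hy0.
have F0 : F 0%N (z 0%N) = Cmod (rect_int f a b c d).
  rewrite /F /= /hn /kn /= /h /k.
  have -> : a + (b - a) / 1 = b by field.
  by have -> : c + (d - c) / 1 = d by field.
(* The factor [4^n] lost in [n] bisections is compensated by the square of the side lengths, which
   shrink like [2^-n]. *)
have key eps : 0 < eps -> Cmod (rect_int f a b c d) <= 2 * eps * (h + k) ^ 2.
  move=> he; have [dl [hdl H]] := hl eps he.
  have hlim := lim0 (h + k).
  move/is_lim_seq_spec: hlim => /(_ (mkposreal dl hdl))[n hn'].
  have := hn' n (le_n n); rewrite /= Rminus_0_r => /Rabs_lt_between[_ hsmall].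
  have sz : (h + k) / 2 ^ n = hn n + kn n by rewrite /hn /kn; have := p2 n => ?; field; lra.
  rewrite sz in hsmall.
  have [i1 [i2 [i3 i4]]] := zin n.
  have loc : F n (z n) <= 2 * eps * ((hn n) + (kn n)) ^ 2.
    have e1 : (z n).1 + hn n - (z n).1 = hn n by ring.
    have e2 : (z n).2 + kn n - (z n).2 = kn n by ring.
    rewrite /F -{2}e1 -{2}e2; apply: (rect_int_local f _ _ _ _ eps (xi, eta) l).
    - by apply: diff_rect_sub hf _ _ _ _.
    - by have := hn0 n; lra.
    - by have := kn0 n; lra.
    move=> x y hx hy; rewrite e1 e2.
    have hd : Cmod ((x, y) - (xi, eta)) <= hn n + kn n.
      apply: Rle_trans (Cmod_le_ReIm _) _; rewrite Re_minus Im_minus /=.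
      have q1 : Rabs (x - xi) <= hn n by apply: Rabs_le; have := xlo n; have := xhi n; lra.
      have q2 : Rabs (y - eta) <= kn n by apply: Rabs_le; have := ylo n; have := yhi n; lra.
      lra.
    have := H ((x, y) - (xi, eta))%C ltac:(lra).
    have -> : ((xi, eta) + ((x, y) - (xi, eta)) = (x, y))%C by ring.
    move=> h1; apply: Rle_trans h1 _.
    by apply: Rmult_le_compat_l; lra.
  rewrite -F0; apply: Rle_trans (zF n) _.
  have p4 : 0 < 4 ^ n by apply: pow_lt; lra.
  apply: Rle_trans (Rmult_le_compat_l _ _ _ (Rlt_le _ _ p4) loc) _.
  have e4 : 4 ^ n = 2 ^ n * 2 ^ n by rewrite -Rpow_mult_distr; have -> : 2 * 2 = 4 by ring.
  by rewrite -sz e4; right; have := p2 n => ?; field; lra.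
apply: Cmod_eq_0; apply: Rle_antisym; last exact: Cmod_ge_0.
apply: Rnot_lt_le => hpos.
have hq : 0 <= (h + k) ^ 2 by exact: pow2_ge_0.
(* This choice makes the right side at most half of the left; the [+ 1] covers a rectangle
   degenerated to a point. *)
have := key (Cmod (rect_int f a b c d) / (4 * ((h + k) ^ 2 + 1))) ltac:(apply: Rdiv_lt_0_compat; lra).
set q := (h + k) ^ 2 in hq *; set r := Cmod _ in hpos *.
have -> : 2 * (r / (4 * (q + 1))) * q = r / 2 * (q / (q + 1)) by field; lra.
have : q / (q + 1) <= 1 by apply/Rle_div_l; lra.
nra.
Qed.

(** * Cauchy estimates and unique continuation *)

Lemma cexp_periodic (x : R) : cexp (x, 2 * PI) = cexp (x, 0).
Proof. by rewrite /cexp /= cos_2PI sin_2PI cos_0 sin_0. Qed.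

Lemma Cmod_cexp_ln (r t : R) : 0 < r -> Cmod (cexp (ln r, t)) = r.
Proof. by move=> hr; rewrite Cmod_cexp exp_ln. Qed.

Lemma circle_ccontinuous (f : C -> C) (z : C) (x t : R) :
  (exists l, cdiff f (z + cexp (x, t))%C l) -> ccontinuous (fun t => f (z + cexp (x, t))%C) t.
Proof.
move=> [l hl]; apply: (cdiff_ccontinuous f (fun t => z + cexp (x, t))%C t l hl).
apply: (cdiff_ccontinuous (fun u => z + cexp u)%C (fun t => (x, t)) t (0 + cexp (x, t))).
  by apply: cdiff_plus; [exact: cdiff_const | exact: cdiff_cexp].
exact: ccontinuous_vertical.
Qed.

Lemma ccontinuous_mult_diff (f g : C -> C) (z : C) (x t : R) :
  (exists l, cdiff f (z + cexp (x, t))%C l) -> (forall u, exists l, cdiff g u l) ->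
  ccontinuous (fun t => f (z + cexp (x, t)) * g (x, t))%C t.
Proof.
move=> [l hl] hg; have [m hm] := hg (x, t).
apply: (cdiff_ccontinuous (fun u => f (z + cexp u) * g u)%C (fun t => (x, t)) t
  (l * (0 + cexp (x, t)) * g (x, t) + f (z + cexp (x, t)) * m)%C); last exact: ccontinuous_vertical.
apply: cdiff_mult => //.
apply: (cdiff_comp (fun u => z + cexp u)%C f) => //.
by apply: cdiff_plus; [exact: cdiff_const | exact: cdiff_cexp].
Qed.

(* In the logarithmic coordinate u = ln (zeta - z) an annulus becomes a rectangle, and
   Goursat's theorem there says that these integrals do not depend on the radius. *)
Lemma circle_int_const (f g : C -> C) (z : C) (rho r : R) : 0 < rho -> rho <= r ->
  (forall u, Cmod (u - z) <= r -> exists l, cdiff f u l) ->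
  (forall u, exists l, cdiff g u l) -> (forall x, g (x, 2 * PI) = g (x, 0)) ->
  CInt (fun t => f (z + cexp (ln rho, t)) * g (ln rho, t))%C 0 (2 * PI) =
  CInt (fun t => f (z + cexp (ln r, t)) * g (ln r, t))%C 0 (2 * PI).
Proof.
move=> hrho hr hf hg hper.
have hln : ln rho <= ln r.
  by case: hr => [hr|->]; [left; apply: ln_increasing | right].
have hpi : 0 <= 2 * PI by have := PI_RGT_0; lra.
pose k u := (f (z + cexp u) * g u)%C.
have hk : diff_rect k (ln rho) (ln r) 0 (2 * PI).
  move=> x y hx hy.
  have [|l hl] := hf (z + cexp (x, y))%C.
    have -> : (z + cexp (x, y) - z = cexp (x, y))%C by ring.
    rewrite Cmod_cexp -[X in _ <= X](exp_ln r); last lra.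
    by case: hx => _ [hx|hx] /=; [left; exact: exp_increasing | rewrite hx; right].
  have [m hm] := hg (x, y).
  exists (l * (0 + cexp (x, y)) * g (x, y) + f (z + cexp (x, y)) * m)%C.
  apply: cdiff_mult => //.
  apply: (cdiff_comp (fun u => z + cexp u)%C f) => //.
  by apply: cdiff_plus; [exact: cdiff_const | exact: cdiff_cexp].
have := goursat k _ _ _ _ hln hpi hk; rewrite /rect_int.
have -> : CInt (fun t => k (t, 2 * PI)) (ln rho) (ln r) = CInt (fun t => k (t, 0)) (ln rho) (ln r).
  by rewrite /CInt; congr pair; apply: RInt_ext => t _; rewrite /k cexp_periodic hper.
rewrite /k => h0.
set A := CInt _ _ _; set B := CInt _ _ _.
have {}h0 : (Ci * (B - A) = 0)%C by rewrite -h0 /A /B; ring.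
have -> : B = (A + (- Ci) * (Ci * (B - A)))%C.
  have e : (Ci * Ci = - (1))%C by apply: C_eq => /=; ring.
  have -> : (A + (- Ci) * (Ci * (B - A)) = A - (Ci * Ci) * (B - A))%C by ring.
  by rewrite e; ring.
by rewrite h0; ring.
Qed.

Lemma two_PI_pos : 0 < 2 * PI.
Proof. by have := PI_RGT_0; lra. Qed.

(** The integral does not depend on the radius, so it is computed on vanishing circles, where the
    integrand is uniformly close to [l]. The factor [g] is 1 for the mean value property and
    [1/(zeta - z)], in logarithmic coordinates, for the derivative. *)
Lemma circle_int_limit (f g : C -> C) (z l : C) (r : R) : 0 < r ->
  (forall u, Cmod (u - z) <= r -> exists l, cdiff f u l) ->
  (forall u, exists l, cdiff g u l) -> (forall x, g (x, 2 * PI) = g (x, 0)) ->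
  (forall eps, 0 < eps -> exists d, 0 < d /\ forall rho t, 0 < rho -> rho < d ->
     Cmod (f (z + cexp (ln rho, t)) * g (ln rho, t) - l)%C <= eps) ->
  is_CInt (fun t => f (z + cexp (ln r, t)) * g (ln r, t))%C 0 (2 * PI) (RtoC (2 * PI) * l)%C.
Proof.
move=> hr hf hg hper hlim.
have hpi := two_PI_pos.
have hint rho : 0 < rho -> rho <= r ->
    is_CInt (fun t => f (z + cexp (ln rho, t)) * g (ln rho, t))%C 0 (2 * PI)
      (CInt (fun t => f (z + cexp (ln rho, t)) * g (ln rho, t))%C 0 (2 * PI)).
  move=> h1 h2; apply: is_CInt_CInt; first lra.
  move=> t _; apply: ccontinuous_mult_diff => //.
  apply: hf; have -> : forall w : C, (z + w - z = w)%C by move=> w; ring.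
  by rewrite Cmod_cexp_ln.
apply: is_CInt_eq (hint r hr (Rle_refl r)).
set L := CInt _ _ _.
suff h0 : Cmod (L - RtoC (2 * PI) * l) = 0.
  have -> : L = (L - RtoC (2 * PI) * l + RtoC (2 * PI) * l)%C by ring.
  by rewrite (Cmod_eq_0 _ h0); ring.
apply: Rle_antisym; last exact: Cmod_ge_0.
apply: Rnot_lt_le => hpos.
set e := Cmod _ in hpos.
have [d [hd H]] := hlim (e / 2 / (2 * PI)) ltac:(apply: Rdiv_lt_0_compat; lra).
set rho := Rmin r (d / 2).
have hrho : 0 < rho by apply: Rmin_pos; lra.
have hrho1 : rho <= r by exact: Rmin_l.
have hrho2 : rho < d by have := Rmin_r r (d / 2); rewrite -/rho; lra.
have i1 := is_CInt_minus _ _ _ _ _ _ (hint rho hrho hrho1) (is_CInt_const l 0 (2 * PI)).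
rewrite (circle_int_const f g z rho r) // -/L Rminus_0_r in i1.
have := is_CInt_bound _ _ _ _ (e / 2 / (2 * PI)) (Rlt_le _ _ hpi) i1 (fun t _ => H rho t hrho hrho2).
rewrite -/e Rminus_0_r.
have -> : e / 2 / (2 * PI) * (2 * PI) = e / 2 by field; lra.
lra.
Qed.

Lemma circle_mean_value (f : C -> C) (z : C) (r : R) : 0 < r ->
  (forall u, Cmod (u - z) <= r -> exists l, cdiff f u l) ->
  is_CInt (fun t => f (z + cexp (ln r, t))%C) 0 (2 * PI) (RtoC (2 * PI) * f z)%C.
Proof.
move=> hr hf.
have hpi := two_PI_pos.
apply: (is_CInt_ext (fun t => f (z + cexp (ln r, t)) * 1)%C); first lra.
  by move=> t _; ring.
apply: (circle_int_limit f (fun=> RtoC 1)) => //.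
  by move=> u; exists (RtoC 0); exact: cdiff_const.
move=> eps he.
have [l hl] := hf z ltac:(have -> : (z - z = 0)%C by [ring]; rewrite Cmod_0; lra).
have [d [hd H]] := cdiff_bound _ _ _ hl.
have hl0 := Cmod_ge_0 l.
have hq : 0 < eps / (Cmod l + 1) by apply: Rdiv_lt_0_compat; lra.
exists (Rmin d (eps / (Cmod l + 1))); split; first exact: Rmin_pos.
move=> rho t h1 h2.
have h3 := Rlt_le_trans _ _ _ h2 (Rmin_l _ _); have h4 := Rlt_le_trans _ _ _ h2 (Rmin_r _ _).
have := H (cexp (ln rho, t)); rewrite Cmod_cexp_ln // => /(_ h3) h5.
rewrite Cmult_1_r; apply: Rle_trans h5 _.
have := Rmult_lt_compat_l (Cmod l + 1) _ _ ltac:(lra) h4.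
by have -> : (Cmod l + 1) * (eps / (Cmod l + 1)) = eps by [field; lra]; lra.
Qed.

Lemma cdiff_cexp_opp (u : C) : cdiff (fun u => cexp (- u))%C u (cexp (- u) * - (1))%C.
Proof. by apply: (cdiff_comp Copp cexp); [apply: cdiff_opp; exact: cdiff_id | exact: cdiff_cexp]. Qed.

(** The difference quotient, rather than [f] itself divided by [zeta - z], is integrated: it
    converges to the derivative as the circle shrinks. Subtracting [f z] accounts for the factor
    2. *)
Lemma cauchy_estimate (f : C -> C) (z l : C) (r B : R) : 0 < r ->
  (forall u, Cmod (u - z) <= r -> (exists l, cdiff f u l) /\ Cmod (f u) <= B) ->
  cdiff f z l -> Cmod l <= 2 * B / r.
Proof.
move=> hr hf hl.
have hpi := two_PI_pos.
have hz : Cmod (z - z) <= r by have -> : (z - z = 0)%C by [ring]; rewrite Cmod_0; lra.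
have i1 : is_CInt (fun t => (f (z + cexp (ln r, t)) - f z) * cexp (- (ln r, t)))%C 0 (2 * PI) (RtoC (2 * PI) * l)%C.
  apply: (circle_int_limit (fun u => f u - f z)%C (fun u => cexp (- u))%C) => //.
  - move=> u /hf[[m hm] _]; exists (m - 0)%C; apply: cdiff_minus => //; exact: cdiff_const.
  - by move=> u; exists (cexp (- u) * - (1))%C; exact: cdiff_cexp_opp.
  - by move=> x; rewrite /cexp /= !cos_neg !sin_neg cos_2PI sin_2PI cos_0 sin_0.
  move=> eps he; have [d [hd H]] := hl eps he.
  exists d; split=> // rho t h1 h2.
  have := H (cexp (ln rho, t)); rewrite Cmod_cexp_ln // => /(_ h2) h3.
  have e1 : (cexp (ln rho, t) * cexp (- (ln rho, t)) = 1)%C.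
    by rewrite -cexp_plus Cplus_opp_r cexp_0.
  have -> : ((f (z + cexp (ln rho, t)) - f z) * cexp (- (ln rho, t)) - l =
    (f (z + cexp (ln rho, t)) - f z - l * cexp (ln rho, t)) * cexp (- (ln rho, t)))%C.
    have -> : ((f (z + cexp (ln rho, t)) - f z - l * cexp (ln rho, t)) * cexp (- (ln rho, t)) =
      (f (z + cexp (ln rho, t)) - f z) * cexp (- (ln rho, t)) - l * (cexp (ln rho, t) * cexp (- (ln rho, t))))%C by ring.
    by rewrite e1; ring.
  rewrite Cmod_mult Cmod_cexp [Re (- _)%C]/= exp_Ropp exp_ln //.
  apply: (Rmult_le_reg_r rho) => //.
  by rewrite Rmult_assoc Rinv_l; lra.
have hb := is_CInt_bound _ _ _ _ (2 * B / r) (Rlt_le _ _ hpi) i1.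
have {}hb : Cmod (RtoC (2 * PI) * l) <= 2 * B / r * (2 * PI - 0).
  apply: hb => t _; rewrite Cmod_mult Cmod_cexp [Re (- _)%C]/= exp_Ropp exp_ln //.
  have h1 : Cmod (f (z + cexp (ln r, t))%C) <= B.
    apply: (proj2 (hf _ _)); have -> : forall w : C, (z + w - z = w)%C by move=> w; ring.
    by rewrite Cmod_cexp_ln //; right.
  have h2 := proj2 (hf _ hz).
  have h3 := Cmod_triangle (f (z + cexp (ln r, t))%C) (- f z); rewrite Cmod_opp in h3.
  apply: Rmult_le_compat_r; first by left; exact: Rinv_0_lt_compat.
  by rewrite /Cminus; lra.
rewrite Cmod_mult Cmod_R Rabs_pos_eq in hb; last lra.
apply: (Rmult_le_reg_l (2 * PI)) => //; lra.
Qed.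

Lemma is_derive_along (f : C -> C) (u s h l : C) (t : R) :
  cdiff f (s + RtoC t * h)%C l ->
  is_derive (fun t => Re (u * f (s + RtoC t * h))%C) t (Re (u * (l * h))%C).
Proof.
move=> hl; apply/is_derive_Reals => eps he.
have hu := Cmod_ge_0 u; have hh := Cmod_ge_0 h.
set q := eps / 2 / ((Cmod u + 1) * (Cmod h + 1)).
have hq : 0 < q by apply: Rdiv_lt_0_compat; [lra | apply: Rmult_lt_0_compat; lra].
have [d [hd H]] := hl q hq.
have hd' : 0 < d / (Cmod h + 1) by apply: Rdiv_lt_0_compat; lra.
exists (mkposreal _ hd') => v hv /= hvd.
have hva : 0 < Rabs v by exact: Rabs_pos_lt.
have hsm : Cmod (RtoC v * h) < d.
  rewrite Cmod_mult Cmod_R.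
  have := Rmult_lt_compat_r (Cmod h + 1) _ _ ltac:(lra) hvd.
  have -> : d / (Cmod h + 1) * (Cmod h + 1) = d by field; lra.
  nra.
have {}H := H _ hsm.
have ev : (s + RtoC t * h + RtoC v * h = s + RtoC (t + v) * h)%C by rewrite RtoC_plus; ring.
rewrite ev in H.
have -> : (Re (u * f (s + RtoC (t + v) * h))%C - Re (u * f (s + RtoC t * h))%C) / v - Re (u * (l * h))%C =
  Re (u * (f (s + RtoC (t + v) * h) - f (s + RtoC t * h) - l * (RtoC v * h)))%C / v.
  have -> : (u * (f (s + RtoC (t + v) * h) - f (s + RtoC t * h) - l * (RtoC v * h)) =
    u * f (s + RtoC (t + v) * h) - u * f (s + RtoC t * h) - RtoC v * (u * (l * h)))%C by ring.
  rewrite !Re_minus (Re_mult (RtoC v)) /= ; field => //.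
rewrite Rabs_div //.
apply/Rlt_div_l => //; apply: Rle_lt_trans (re_le_Cmod _) _.
rewrite Cmod_mult.
rewrite Cmod_mult Cmod_R in H.
apply: (Rle_lt_trans _ (Cmod u * (q * (Rabs v * Cmod h)))).
  by apply: Rmult_le_compat_l.
have e : eps / 2 * Rabs v = (Cmod u + 1) * (Cmod h + 1) * (q * Rabs v) by rewrite /q; field; split; lra.
have hqv : 0 < q * Rabs v by exact: Rmult_lt_0_compat.
have : Cmod u * Cmod h * (q * Rabs v) <= (Cmod u + 1) * (Cmod h + 1) * (q * Rabs v).
  by apply: Rmult_le_compat_r; [lra | nra].
nra.
Qed.

(** The real mean value theorem is applied to the real part of the conjugate of [D] times [f] along
    the segment, whose increment is [|D|^2]. *)
Lemma complex_mean_value (f f' : C -> C) (s h : C) (K : R) :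
  (forall t, 0 <= t <= 1 -> cdiff f (s + RtoC t * h)%C (f' (s + RtoC t * h)%C) /\
     Cmod (f' (s + RtoC t * h)%C) <= K) ->
  Cmod (f (s + h)%C - f s) <= K * Cmod h.
Proof.
move=> H.
set D := (f (s + h)%C - f s)%C.
pose g t := Re (Cconj D * f (s + RtoC t * h))%C.
have hder t : 0 <= t <= 1 -> is_derive g t (Re (Cconj D * (f' (s + RtoC t * h)%C * h))%C).
  by move=> /H[h1 _]; exact: is_derive_along.
have [t [ht hmv]] : exists t, Rmin 0 1 <= t <= Rmax 0 1 /\ g 1 - g 0 = Re (Cconj D * (f' (s + RtoC t * h)%C * h))%C * (1 - 0).
  apply: MVT_gen => t ht.
  - by apply: hder; rewrite Rmin_left ?Rmax_right in ht; lra.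
  - apply: derivable_continuous_pt; exists (Re (Cconj D * (f' (s + RtoC t * h)%C * h))%C).
    by apply/is_derive_Reals; apply: hder; rewrite Rmin_left ?Rmax_right in ht; lra.
rewrite Rmin_left ?Rmax_right in ht; [|lra|lra].
have e : g 1 - g 0 = Cmod D ^ 2.
  rewrite /g -Re_minus.
  have -> : (s + RtoC 1 * h = s + h)%C by ring.
  have -> : (s + RtoC 0 * h = s)%C by ring.
  have -> : (Cconj D * f (s + h) - Cconj D * f s = D * Cconj D)%C by rewrite /D; ring.
  by rewrite -Cmod2_conj.
rewrite e in hmv.
have [_ hK] := H t ht.
have h1 : Cmod D ^ 2 <= Cmod D * (K * Cmod h).
  rewrite hmv Rminus_0_r Rmult_1_r; apply: Rle_trans (Rle_abs _) _; apply: Rle_trans (re_le_Cmod _) _.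
  rewrite !Cmod_mult Cmod_conj; apply: Rmult_le_compat_l; first exact: Cmod_ge_0.
  by apply: Rmult_le_compat_r => //; exact: Cmod_ge_0.
have hh := Cmod_ge_0 h; have hD := Cmod_ge_0 D.
case: (Req_dec (Cmod D) 0) => hD0.
  rewrite hD0; apply: Rmult_le_pos => //.
  by apply: Rle_trans hK; exact: Cmod_ge_0.
apply: (Rmult_le_reg_l (Cmod D)); lra.
Qed.

(** Cauchy's estimate on circles of radius [r/2] bounds [f'] by [4 B / r]; a second one of radius
    [r/4] bounds [f''] by [32 B / r^2]. The constant depends only on [r] and [B], hence is common to
    all partial sums of a series. *)
Lemma taylor_order2 (f f' f'' : C -> C) (s h : C) (r B : R) : 0 < r -> 
  (forall u, cdiff f u (f' u)) -> (forall u, cdiff f' u (f'' u)) ->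
  (forall u, Cmod (u - s) <= r -> Cmod (f u) <= B) -> Cmod h <= r / 4 ->
  Cmod (f (s + h)%C - f s - f' s * h) <= 32 * B / r ^ 2 * Cmod h ^ 2.
Proof.
move=> hr hf hf' hB hh.
have near u v a b : Cmod (u - s) <= a -> Cmod (v - u) <= b -> Cmod (v - s) <= a + b.
  move=> h1 h2; have -> : (v - s = (v - u) + (u - s))%C by ring.
  by apply: Rle_trans (Cmod_triangle _ _) _; lra.
have b1 u : Cmod (u - s) <= r / 2 -> Cmod (f' u) <= 4 * B / r.
  move=> hu; have -> : 4 * B / r = 2 * B / (r / 2) by field; lra.
  apply: (cauchy_estimate f u) => //; first lra.
  move=> v hv; split; first by exists (f' v).
  by apply: hB; have := near u v _ _ hu hv; lra.
have b2 u : Cmod (u - s) <= r / 4 -> Cmod (f'' u) <= 32 * B / r ^ 2.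
  move=> hu; have -> : 32 * B / r ^ 2 = 2 * (4 * B / r) / (r / 4) by field; lra.
  apply: (cauchy_estimate f' u) => //; first lra.
  move=> v hv; split; first by exists (f'' v).
  by apply: b1; have := near u v _ _ hu hv; lra.
have h0 := Cmod_ge_0 h.
have along t : 0 <= t <= 1 -> Cmod (RtoC t * h) <= Cmod h.
  move=> ht; rewrite Cmod_mult Cmod_R Rabs_pos_eq; last lra.
  by nra.
have sub w : (s + w - s = w)%C by ring.
have K0 : 0 <= 32 * B / r ^ 2.
  have hss : Cmod (s - s) <= r / 4 by have -> : (s - s = 0)%C by [ring]; rewrite Cmod_0; lra.
  by apply: Rle_trans (b2 s hss); exact: Cmod_ge_0.
have b3 t : 0 <= t <= 1 -> Cmod (f' (s + RtoC t * h)%C - f' s) <= 32 * B / r ^ 2 * Cmod h.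
  move=> ht.
  apply: Rle_trans (complex_mean_value f' f'' s (RtoC t * h)%C (32 * B / r ^ 2) _) _.
    move=> x hx; split=> //; apply: b2; rewrite sub.
    rewrite Cmult_assoc -RtoC_mult; apply: Rle_trans (along _ _) hh; nra.
  by apply: Rmult_le_compat_l => //; exact: along.
have := complex_mean_value (fun u => f u - f' s * u)%C (fun u => f' u - f' s)%C s h (32 * B / r ^ 2 * Cmod h).
have -> : (f (s + h) - f' s * (s + h) - (f s - f' s * s) = f (s + h) - f s - f' s * h)%C by ring.
move=> hmv.
have -> : 32 * B / r ^ 2 * Cmod h ^ 2 = 32 * B / r ^ 2 * Cmod h * Cmod h by ring.
apply: hmv => t ht; split; last exact: b3.
have hs := cdiff_scal (f' s) _ _ _ (cdiff_id (s + RtoC t * h)%C).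
by rewrite Cmult_1_r in hs; apply: cdiff_minus.
Qed.

(** A quadratic remainder with a common constant survives pointwise limits. The derivatives at [s]
    are shown to be Cauchy by comparing increments at one small displacement. *)
Lemma cdiff_limit (f : nat -> C -> C) (l : nat -> C) (F : C -> C) (s : C) (r K : R) : 0 < r ->
  (forall n h, Cmod h <= r -> Cmod (f n (s + h)%C - f n s - l n * h) <= K * Cmod h ^ 2) ->
  (forall h, Cmod h <= r -> clim (fun n => f n (s + h)%C) (F (s + h)%C)) ->
  exists m, cdiff F s m.
Proof.
move=> hr hT hlim.
have hl0 : clim (fun n => f n s) (F s).
  by have := hlim 0; rewrite Cmod_0 Cplus_0_r => h; apply: h; lra.
have K0 : 0 <= K.
  have := hT 0%N (RtoC r); rewrite Cmod_R Rabs_pos_eq; last lra.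
  move=> /(_ (Rle_refl r)) h.
  have h1 := Rle_trans _ _ _ (Cmod_ge_0 _) h.
  have : 0 < r ^ 2 by apply: pow_lt.
  nra.
have [m hm] : exists m, clim l m.
  apply: clim_cauchy => eps he.
  (* The two remainders contribute [2 K rho^2 <= eps * rho / 2]; four approximation errors of
     [eps * rho / 8] supply the other half before division by [rho]. *)
  set rho := Rmin r (eps / (4 * (K + 1))).
  have hq : 0 < eps / (4 * (K + 1)) by apply: Rdiv_lt_0_compat; lra.
  have hrho : 0 < rho by exact: Rmin_pos.
  have hrho1 : rho <= r by exact: Rmin_l.
  have hrho2 : 4 * (K + 1) * rho <= eps.
    have := Rmult_le_compat_l (4 * (K + 1)) _ _ ltac:(lra) (Rmin_r r (eps / (4 * (K + 1)))).
    by rewrite -/rho; have -> : 4 * (K + 1) * (eps / (4 * (K + 1))) = eps by field; lra.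
  have cm : Cmod (RtoC rho) = rho by rewrite Cmod_R Rabs_pos_eq //; lra.
  have he8 : 0 < eps * rho / 8 by apply: Rdiv_lt_0_compat; [exact: Rmult_lt_0_compat | lra].
  have [N1 h1] := proj1 (clim_eps _ _) (hlim (RtoC rho) ltac:(rewrite cm; lra)) _ he8.
  have [N2 h2] := proj1 (clim_eps _ _) hl0 _ he8.
  exists (N1 + N2)%N => i j hi hij.
  have a1 := h1 i ltac:(lia); have a2 := h1 j ltac:(lia).
  have a3 := h2 i ltac:(lia); have a4 := h2 j ltac:(lia).
  have t1 := hT i (RtoC rho) ltac:(rewrite cm; lra).
  have t2 := hT j (RtoC rho) ltac:(rewrite cm; lra).
  rewrite cm in t1 t2.
  set A := f i (s + rho)%C in a1 t1; set B := f j (s + rho)%C in a2 t2.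
  have e : ((l j - l i) * RtoC rho = (A - f i s - l i * RtoC rho) + (- (B - f j s - l j * RtoC rho)) +
     ((B - F (s + rho)) + (- (A - F (s + rho))) + ((f i s - F s) + (- (f j s - F s)))))%C by ring.
  have : Cmod ((l j - l i) * RtoC rho) <= 2 * K * rho ^ 2 + eps * rho / 2.
    rewrite e.
    apply: Rle_trans (Cmod_triangle _ _) _.
    have u1 := Cmod_triangle (A - f i s - l i * RtoC rho) (- (B - f j s - l j * RtoC rho)).
    have u2 := Cmod_triangle ((B - F (s + rho)%C) + (- (A - F (s + rho)%C))) ((f i s - F s) + (- (f j s - F s))).
    have u3 := Cmod_triangle (B - F (s + rho)%C) (- (A - F (s + rho)%C)).
    have u4 := Cmod_triangle (f i s - F s) (- (f j s - F s)).
    rewrite !Cmod_opp in u1 u2 u3 u4; lra.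
  rewrite Cmod_mult cm => h.
  apply: (Rmult_le_reg_r rho) => //; nra.
exists m => eps he.
have hq : 0 < eps / (K + 1) by apply: Rdiv_lt_0_compat; lra.
exists (Rmin r (eps / (K + 1))); split; first exact: Rmin_pos.
move=> h hh.
have hh1 := Rlt_le_trans _ _ _ hh (Rmin_l _ _); have hh2 := Rlt_le_trans _ _ _ hh (Rmin_r _ _).
have hc := clim_minus _ _ _ _ (clim_minus _ _ _ _ (hlim h (Rlt_le _ _ hh1)) hl0) (clim_mult _ _ _ _ hm (clim_const h)).
have hb : Cmod (F (s + h)%C - F s - m * h) <= K * Cmod h ^ 2.
  by apply: (clim_bound _ _ _ _ 0 hc (is_lim_seq_const _)) => n _; apply: hT; lra.
apply: Rle_trans hb _.
have h0 := Cmod_ge_0 h.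
have := Rmult_lt_compat_l (K + 1) _ _ ltac:(lra) hh2.
have -> : (K + 1) * (eps / (K + 1)) = eps by field; lra.
nra.
Qed.

(* On the arc Re w <= r/8 of the circle |w| = r, powers of this polynomial in w tend to
   zero, while its value at the centre is 1. *)
Definition arc_kernel (r : R) (z u : C) : C :=
  (1 + RtoC (3 / 5 / r) * (u - z) + RtoC (1 / 2 / r ^ 2) * ((u - z) * (u - z)))%C.

Lemma arc_kernel_center (r : R) (z : C) : arc_kernel r z z = 1.
Proof. by rewrite /arc_kernel; ring. Qed.

Lemma arc_kernel_diff (r : R) (z u : C) : exists l, cdiff (arc_kernel r z) u l.
Proof.
have h1 : cdiff (fun u => u - z)%C u (1 - 0)%C by apply: cdiff_minus; [exact: cdiff_id | exact: cdiff_const].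
eexists; apply: cdiff_plus; first (apply: cdiff_plus; first exact: cdiff_const).
- exact: cdiff_scal h1.
- exact: cdiff_scal (cdiff_mult _ _ _ _ _ h1 h1).
Qed.

(** With [x = Re w / r] the squared modulus is [61/100 + 9/5 x + 2 x^2]. This is convex, so its
    maximum over [[-1, 1/8]] is at an endpoint; both values, 0.81 and about 0.866, are below
    [(19/20)^2]. *)
Lemma arc_kernel_small (r : R) (z w : C) : 0 < r -> Cmod w = r -> Re w <= r / 8 ->
  Cmod (arc_kernel r z (z + w)) <= 19 / 20.
Proof.
case: w => a b hr hw; rewrite /= => ha.
have e : a ^ 2 + b ^ 2 = r ^ 2 by rewrite -hw Cmod2_alt.
have ha' : - r <= a by nra.
set x := a / r; set y := b / r.
have hx1 : x <= 1 / 8 by apply/Rle_div_l; lra.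
have hx2 : - 1 <= x by apply/Rle_div_r; lra.
have exy : x ^ 2 + y ^ 2 = 1 by rewrite /x /y; apply: (Rmult_eq_reg_r (r ^ 2)); [rewrite -[RHS]Rmult_1_l|]; [field_simplify; lra | have := pow_lt r 2 hr; lra].
have -> : arc_kernel r z (z + (a, b)) = (1 + 3 / 5 * x + 1 / 2 * (x ^ 2 - y ^ 2), 3 / 5 * y + x * y).
  rewrite /arc_kernel; have -> : (z + (a, b) - z = (a, b))%C by ring.
  by apply: C_eq; rewrite /= /x /y; field; lra.
apply: Rsqr_incr_0_var; last lra.
rewrite !Rsqr_pow2 Cmod2_alt /=.
have y2 : y ^ 2 = 1 - x ^ 2 by lra.
have -> : (1 + 3 / 5 * x + 1 / 2 * (x * (x * 1) - y * (y * 1))) * ((1 + 3 / 5 * x + 1 / 2 * (x * (x * 1) - y * (y * 1))) * 1) +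
  (3 / 5 * y + x * y) * ((3 / 5 * y + x * y) * 1) =
  (1 + 3 / 5 * x + 1 / 2 * (x ^ 2 - y ^ 2)) ^ 2 + (3 / 5 + x) ^ 2 * y ^ 2 by ring.
rewrite y2; nra.
Qed.

Lemma diff_pow (f : C -> C) (u : C) (p : nat) : (exists l, cdiff f u l) ->
  exists l, cdiff (fun u => f u ^ p)%C u l.
Proof.
move=> [l hl]; elim: p => [|p [m hm]]; first by exists (RtoC 0); exact: cdiff_const.
by eexists; exact: cdiff_mult hl hm.
Qed.

(** The mean value property is applied to [G] times the p-th power of the kernel on the circle of
    radius [r = g/2] about [z]. [G] vanishes on the part beyond [beta]; elsewhere the displacement
    has real part at most [g/16 = r/8], so the kernel is small. Letting [p] grow gives [G z = 0]. *)
Lemma unique_continuation_step (G : C -> C) (Delta beta g : R) : 0 < g -> Delta + g <= beta ->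
  (forall s, half_plane Delta s -> exists l, cdiff G s l) ->
  (forall s, half_plane beta s -> G s = 0) ->
  forall s, half_plane (beta - g / 16) s -> G s = 0.
Proof.
move=> hg hbeta hG h0 z hz.
have hpi := two_PI_pos.
set r := g / 2; have hr : 0 < r by rewrite /r; lra.
have hin u : Cmod (u - z) <= r -> half_plane Delta u.
  move=> hu; have := Rle_trans _ _ _ (re_le_Cmod _) hu => /Rabs_le_between.
  by move: hz; rewrite Re_minus /half_plane /r; lra.
have sub w : (z + w - z = w)%C by ring.
have hcirc t : Cmod (z + cexp (ln r, t) - z) <= r by rewrite sub Cmod_cexp_ln //; right.
have [B hB] : exists B, forall t, 0 <= t <= 2 * PI -> Cmod (G (z + cexp (ln r, t))%C) <= B.
  have hcont t : 0 <= t <= 2 * PI -> continuity_pt (fun t => Cmod (G (z + cexp (ln r, t))%C)) t.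
    move=> _; apply/continuity_pt_filterlim.
    apply: (ccontinuous_continuous Cmod (fun t => G (z + cexp (ln r, t))%C)); first exact: Cmod_dist.
    by apply: circle_ccontinuous; apply: hG; apply: hin.
  have [M [hM _]] := continuity_ab_maj _ 0 (2 * PI) ltac:(lra) hcont.
  by exists (Cmod (G (z + cexp (ln r, M))%C)).
have B0 : 0 <= B by apply: Rle_trans (hB 0 ltac:(lra)); exact: Cmod_ge_0.
have key p : Cmod (G z) <= B * (19 / 20) ^ p.
  have := circle_mean_value (fun u => G u * arc_kernel r z u ^ p)%C z r hr.
  rewrite arc_kernel_center => hmv.
  have {}hmv := hmv _.
  have hd u : Cmod (u - z) <= r -> exists l, cdiff (fun u => G u * arc_kernel r z u ^ p)%C u l.
    move=> /hin/hG[l hl]; have [m hm] := diff_pow _ u p (arc_kernel_diff r z u).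
    by eexists; exact: cdiff_mult hl hm.
  have hb := is_CInt_bound _ _ _ _ (B * (19 / 20) ^ p) (Rlt_le _ _ hpi) (hmv hd).
  have {}hb := hb _.
  have hpt t : 0 <= t <= 2 * PI ->
      Cmod (G (z + cexp (ln r, t)) * arc_kernel r z (z + cexp (ln r, t)) ^ p)%C <= B * (19 / 20) ^ p.
    move=> ht.
    have hp0 : 0 <= (19 / 20) ^ p by apply: pow_le; lra.
    case: (Rlt_le_dec beta (Re (z + cexp (ln r, t))%C)) => hre.
      by rewrite h0 // Cmult_0_l Cmod_0; exact: Rmult_le_pos.
    rewrite Cmod_mult Cmod_pow; apply: Rmult_le_compat; [exact: Cmod_ge_0 | | exact: hB |].
      by apply: pow_le; exact: Cmod_ge_0.
    apply: pow_incr; split; first exact: Cmod_ge_0.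
    apply: arc_kernel_small => //; first exact: Cmod_cexp_ln.
    have er : r = g / 2 by [].
    by rewrite Re_plus in hre; rewrite /half_plane in hz; lra.
  have one p' : (RtoC 1 ^ p' = 1)%C by elim: p' => //= q ->; ring.
  have := hb hpt; rewrite one Cmult_1_r Cmod_mult Cmod_R Rabs_pos_eq; last lra.
  rewrite Rminus_0_r => h; apply: (Rmult_le_reg_l (2 * PI)) => //; lra.
have hl : is_lim_seq (fun p => B * (19 / 20) ^ p) 0.
  have := is_lim_seq_mult' _ _ _ _ (is_lim_seq_const B) (is_lim_seq_geom (19 / 20) ltac:(rewrite Rabs_pos_eq; lra)).
  by rewrite Rmult_0_r.
have hle : Rbar_le (Cmod (G z)) 0 by apply: is_lim_seq_le (is_lim_seq_const _) hl.
by apply: Cmod_eq_0; apply: Rle_antisym; [exact: hle | exact: Cmod_ge_0].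
Qed.

Lemma unique_continuation (G : C -> C) (Delta sigma : R) :
  (forall s, half_plane Delta s -> exists l, cdiff G s l) ->
  (forall s, half_plane sigma s -> G s = 0) ->
  forall s, half_plane Delta s -> G s = 0.
Proof.
move=> hG h0 s hs.
set g := (Re s - Delta) / 2.
have hg : 0 < g by rewrite /half_plane in hs; rewrite /g; lra.
(* Each step gains [g / 16]; the maximum preserves the margin [g] to the line of abscissa [Delta],
   and [s] lies at distance [2 g] from that line. *)
have P n : forall s, half_plane (Rmax (Delta + g) (sigma - INR n * (g / 16))) s -> G s = 0.
  elim: n => [|n IH] z hz.
    by apply: h0; move: hz; rewrite /half_plane /= Rmult_0_l Rminus_0_r; have := Rmax_r (Delta + g) sigma; lra.
  apply: (unique_continuation_step G Delta _ g hg _ hG IH); first exact: Rmax_l.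
  move: hz; rewrite /half_plane S_INR.
  have := Rmax_l (Delta + g) (sigma - (INR n + 1) * (g / 16)).
  have := Rmax_r (Delta + g) (sigma - (INR n + 1) * (g / 16)).
  have hmax : Rmax (Delta + g) (sigma - INR n * (g / 16)) = Delta + g \/
    Rmax (Delta + g) (sigma - INR n * (g / 16)) = sigma - INR n * (g / 16).
    by rewrite /Rmax; case: Rle_dec => _; [right | left].
  by case: hmax => -> *; lra.
have [n hn] := INR_unbounded ((sigma - (Delta + g)) / (g / 16)).
apply: (P n); rewrite /half_plane.
have : sigma - (Delta + g) < INR n * (g / 16) by apply/Rlt_div_l; lra.
by move=> h; apply: Rmax_lub_lt; rewrite /half_plane in hs; rewrite /g in h *; lra.
Qed.

(** * Means on vertical lines *)

(** The limit of averages over [[-T, T]], multiplied out by [2 T]; integrability for large [T] is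
    part of the notion. *)
Definition is_mean (g : R -> C) (l : C) : Prop :=
  forall eps, 0 < eps -> exists T0, 0 < T0 /\ forall T, T0 <= T ->
    exists I, is_CInt g (- T) T I /\ Cmod (I - RtoC (2 * T) * l) <= eps * (2 * T).

Lemma is_mean_ext (f g : R -> C) (l : C) : (forall t, f t = g t) -> is_mean f l -> is_mean g l.
Proof.
move=> h hf eps he; have [T0 [hT0 H]] := hf eps he.
exists T0; split=> // T hT; have [I [h1 h2]] := H T hT.
by exists I; split=> //; apply: is_CInt_ext h1 => //; lra.
Qed.

Lemma is_mean_plus (f g : R -> C) (l m : C) :
  is_mean f l -> is_mean g m -> is_mean (fun t => f t + g t)%C (l + m)%C.
Proof.
move=> hf hg eps he.
have [T1 [hT1 H1]] := hf (eps / 2) ltac:(lra).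
have [T2 [hT2 H2]] := hg (eps / 2) ltac:(lra).
exists (Rmax T1 T2); split; first by apply: Rlt_le_trans hT1 (Rmax_l _ _).
move=> T hT.
have [I [i1 b1]] := H1 T (Rle_trans _ _ _ (Rmax_l _ _) hT).
have [J [j1 b2]] := H2 T (Rle_trans _ _ _ (Rmax_r _ _) hT).
exists (I + J)%C; split; first exact: is_CInt_plus.
have -> : (I + J - RtoC (2 * T) * (l + m) = (I - RtoC (2 * T) * l) + (J - RtoC (2 * T) * m))%C by ring.
by apply: Rle_trans (Cmod_triangle _ _) _; lra.
Qed.

Lemma is_mean_scal (c : C) (f : R -> C) (l : C) : is_mean f l -> is_mean (fun t => c * f t)%C (c * l)%C.
Proof.
move=> hf eps he.
have hc := Cmod_ge_0 c.
have [T0 [hT0 H]] := hf (eps / (Cmod c + 1)) ltac:(apply: Rdiv_lt_0_compat; lra).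
exists T0; split=> // T hT; have [I [h1 h2]] := H T hT.
exists (c * I)%C; split; first exact: is_CInt_scal.
have -> : (c * I - RtoC (2 * T) * (c * l) = c * (I - RtoC (2 * T) * l))%C by ring.
rewrite Cmod_mult.
have -> : eps * (2 * T) = (Cmod c + 1) * (eps / (Cmod c + 1) * (2 * T)) by field; lra.
apply: Rmult_le_compat => //; [exact: Cmod_ge_0 | lra].
Qed.

Lemma is_mean_0 : is_mean (fun=> 0) 0.
Proof.
move=> eps he; exists 1; split; first lra.
move=> T hT; exists (RtoC (T - - T) * 0)%C; split; first exact: is_CInt_const.
have -> : (RtoC (T - - T) * 0 - RtoC (2 * T) * 0 = 0)%C by ring.
by rewrite Cmod_0; apply: Rmult_le_pos; lra.
Qed.

Lemma is_mean_csum (f : nat -> R -> C) (l : nat -> C) (r : seq nat) :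
  (forall k, k \in r -> is_mean (f k) (l k)) ->
  is_mean (fun t => \csum_(k <- r) f k t) (\csum_(k <- r) l k).
Proof.
elim: r => [|k r IHr] h.
  by rewrite big_nil; apply: is_mean_ext is_mean_0 => t; rewrite big_nil.
rewrite big_cons; apply: (is_mean_ext (fun t => f k t + \csum_(k <- r) f k t)%C).
  by move=> t; rewrite big_cons.
apply: is_mean_plus; first by apply: h; exact: mem_head.
by apply: IHr => j hj; apply: h; rewrite in_cons hj orbT.
Qed.

Lemma is_mean_ge0 (f : R -> C) (l : C) : is_mean f l -> (forall t, 0 <= Re (f t)) -> 0 <= Re l.
Proof.
move=> hf h0; apply: Rnot_lt_le => hneg.
have [T0 [hT0 H]] := hf (- Re l / 2) ltac:(lra).
have [I [[i1 _] b]] := H T0 (Rle_refl _).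
have hI : 0 <= Re I.
  have h := is_RInt_const (- T0) T0 (0 : R); rewrite /scal /= /mult /= Rmult_0_r in h.
  by apply: (is_RInt_le _ _ (- T0) T0 _ _ _ h i1) => [|t _]; [lra | exact: h0].
have h1 := Rle_trans _ _ _ (Rle_abs _) (Rle_trans _ _ _ (re_le_Cmod _) b).
rewrite Re_minus Re_mult [Re (RtoC _)]/= [Im (RtoC _)]/= in h1.
nra.
Qed.

Definition indic0 (x : R) : C := if Req_dec_T x 0 then RtoC 1 else RtoC 0.

Lemma indic0_eq (x : R) : x = 0 -> indic0 x = 1.
Proof. by rewrite /indic0; case: Req_dec_T. Qed.

Lemma indic0_neq (x : R) : x <> 0 -> indic0 x = 0.
Proof. by rewrite /indic0; case: Req_dec_T. Qed.

Lemma is_mean_exp (lam : R) : is_mean (fun t => cexp (Ci * RtoC (lam * t))) (indic0 lam).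
Proof.
case: (Req_dec lam 0) => hl; rewrite ?(indic0_eq _ hl) ?(indic0_neq _ hl).
  move=> eps he; exists 1; split; first lra.
  move=> T hT; exists (RtoC (T - - T) * 1)%C; split.
    apply: (is_CInt_ext (fun=> RtoC 1)); [lra | | exact: is_CInt_const].
    by move=> t _; rewrite hl Rmult_0_l Cmult_0_r cexp_0.
  have -> : (RtoC (T - - T) * 1 - RtoC (2 * T) * 1 = 0)%C.
    by rewrite -RtoC_mult -RtoC_mult -RtoC_minus; congr RtoC; ring.
  by rewrite Cmod_0; apply: Rmult_le_pos; lra.
have ha : 0 < Rabs lam by exact: Rabs_pos_lt.
move=> eps he.
have hT0 : 0 < 2 / (eps * Rabs lam) by apply: Rdiv_lt_0_compat; [lra | exact: Rmult_lt_0_compat].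
exists (2 / (eps * Rabs lam)); split=> // T hT.
have e t : cexp (Ci * RtoC (lam * t)) = (cos (lam * t), sin (lam * t)).
  rewrite /cexp.
  have -> : Re (Ci * RtoC (lam * t))%C = 0 by rewrite /=; ring.
  have -> : Im (Ci * RtoC (lam * t))%C = lam * t by rewrite /=; ring.
  by rewrite exp_0 !Rmult_1_l.
exists (sin (lam * T) / lam - sin (lam * - T) / lam, - cos (lam * T) / lam - - cos (lam * - T) / lam).
split.
  apply: (is_CInt_ext (fun t => (cos (lam * t), sin (lam * t)))); [lra | by move=> t _; rewrite e |].
  split; rewrite /=.
  - apply: (is_RInt_derive (fun t => sin (lam * t) / lam)) => x _.
      by auto_derive; [| field].
    by apply: (ex_derive_continuous (fun t => cos (lam * t))); auto_derive.
  - apply: (is_RInt_derive (fun t => - cos (lam * t) / lam)) => x _.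
      by auto_derive; [| field].
    by apply: (ex_derive_continuous (fun t => sin (lam * t))); auto_derive.
rewrite Cmult_0_r; set I := (_, _).
have -> : (I - 0 = I)%C by ring.
apply: Rle_trans (Cmod_le_ReIm _) _.
rewrite /I /=.
have -> : lam * - T = - (lam * T) by ring.
rewrite sin_neg cos_neg.
have -> : - cos (lam * T) / lam - - cos (lam * T) / lam = 0 by field.
rewrite Rabs_R0 Rplus_0_r.
have -> : sin (lam * T) / lam - - sin (lam * T) / lam = 2 * sin (lam * T) / lam by field.
rewrite Rabs_div // Rabs_mult (Rabs_pos_eq 2); last lra.
apply/Rle_div_l => //.
have hs : Rabs (sin (lam * T)) <= 1 by apply: Rabs_le; have := SIN_bound (lam * T); lra.
have h1 : 2 <= eps * Rabs lam * T.
  rewrite (Rmult_comm _ T); apply/Rle_div_l => //; exact: Rmult_lt_0_compat.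
lra.
Qed.

Lemma is_mean_approx (g : R -> C) (l : C) :
  (forall T, 0 < T -> exists I, is_CInt g (- T) T I) ->
  (forall eps, 0 < eps -> exists g', is_mean g' l /\ forall t, Cmod (g t - g' t) <= eps) ->
  is_mean g l.
Proof.
move=> hint happ eps he.
have [g' [hg' hd]] := happ (eps / 2) ltac:(lra).
have [T0 [hT0 H]] := hg' (eps / 2) ltac:(lra).
exists T0; split=> // T hT.
have [I hI] := hint T ltac:(lra).
have [J [j1 j2]] := H T hT.
exists I; split=> //.
have h1 := is_CInt_bound _ _ _ _ (eps / 2) (ltac:(lra) : - T <= T) (is_CInt_minus _ _ _ _ _ _ hI j1) (fun t _ => hd t).
have -> : (I - RtoC (2 * T) * l = (I - J) + (J - RtoC (2 * T) * l))%C by ring.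
by apply: Rle_trans (Cmod_triangle _ _) _; lra.
Qed.

Lemma is_mean_bounded_diff (f g : R -> C) (l : C) (K : R) :
  (forall T, 0 < T -> exists I J, is_CInt f (- T) T I /\ is_CInt g (- T) T J /\ Cmod (J - I) <= K) ->
  is_mean f l -> is_mean g l.
Proof.
move=> hK hf eps he.
have [T0 [hT0 H]] := hf (eps / 2) ltac:(lra).
have h0 : 0 < (Rabs K + 1) / eps.
  by apply: Rdiv_lt_0_compat => //; have := Rabs_pos K; lra.
exists (Rmax T0 ((Rabs K + 1) / eps)); split; first by apply: Rlt_le_trans hT0 (Rmax_l _ _).
move=> T hT.
have hT1 := Rle_trans _ _ _ (Rmax_l _ _) hT; have hT2 := Rle_trans _ _ _ (Rmax_r _ _) hT.
have [I [J [i1 [j1 b]]]] := hK T ltac:(lra).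
have [I' [i1' b']] := H T hT1.
rewrite -(is_CInt_unique _ _ _ _ _ i1 i1') in b'.
exists J; split=> //.
have -> : (J - RtoC (2 * T) * l = (J - I) + (I - RtoC (2 * T) * l))%C by ring.
apply: Rle_trans (Cmod_triangle _ _) _.
have : Rabs K + 1 <= T * eps by apply/Rle_div_l.
by have := Rle_abs K; lra.
Qed.

(* Goursat's theorem on [sigma, sigma'] x [-T, T]: the horizontal sides stay bounded as
   T tends to infinity, so the mean on a vertical line does not depend on the line. *)
Lemma is_mean_shift (h : C -> C) (sigma sigma' K : R) (l : C) : sigma <= sigma' ->
  (forall s, sigma <= Re s <= sigma' -> (exists m, cdiff h s m) /\ Cmod (h s) <= K) ->
  is_mean (fun t => h (sigma', t)) l -> is_mean (fun t => h (sigma, t)) l.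
Proof.
move=> hss hh.
apply: (is_mean_bounded_diff _ _ _ (2 * (K * (sigma' - sigma)))) => T hT.
have hd : diff_rect h sigma sigma' (- T) T by move=> x y hx hy; exact: (proj1 (hh (x, y) hx)).
exists (CInt (fun t => h (sigma', t)) (- T) T), (CInt (fun t => h (sigma, t)) (- T) T).
split; first by apply: (diff_rect_vertical h sigma sigma' (- T) T); try exact: hd; lra.
split; first by apply: (diff_rect_vertical h sigma sigma' (- T) T); try exact: hd; lra.
have := goursat h sigma sigma' (- T) T hss ltac:(lra) hd; rewrite /rect_int.
set A := CInt (fun t => h (t, - T)) _ _; set B := CInt (fun t => h (t, T)) _ _.
set V := CInt (fun t => h (sigma, t)) _ _; set V' := CInt (fun t => h (sigma', t)) _ _.
move=> h0.
have e : (Ci * (V - V') = A - B)%C.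
  have -> : (Ci * (V - V') = (A - B) - (A - B + Ci * (V' - V)))%C by ring.
  by rewrite h0; ring.
have -> : Cmod (V - V') = Cmod (Ci * (V - V')) by rewrite Cmod_mult Cmod_Ci Rmult_1_l.
rewrite e.
apply: Rle_trans (Cmod_triangle _ _) _; rewrite Cmod_opp.
have bA : Cmod A <= K * (sigma' - sigma).
  apply: (is_CInt_bound (fun t => h (t, - T))) => //.
    by apply: (diff_rect_horizontal h sigma sigma' (- T) T); try exact: hd; lra.
  by move=> t ht; exact: (proj2 (hh (t, - T) ht)).
have bB : Cmod B <= K * (sigma' - sigma).
  apply: (is_CInt_bound (fun t => h (t, T))) => //.
    by apply: (diff_rect_horizontal h sigma sigma' (- T) T); try exact: hd; lra.
  by move=> t ht; exact: (proj2 (hh (t, T) ht)).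
lra.
Qed.

Lemma cdiff_cexp_scal (lam : R) (s : C) :
  cdiff (fun s => cexp (RtoC lam * s))%C s (cexp (RtoC lam * s) * (RtoC lam * 1))%C.
Proof.
by apply: (cdiff_comp (fun s => RtoC lam * s)%C cexp); [apply: cdiff_scal; exact: cdiff_id | exact: cdiff_cexp].
Qed.

(** Injectivity of the logarithm: the frequency belonging to the pair [(n, d)] meets the k-th term
    of the series only if [d k = n], so means detect divisibility. *)
Lemma ln_ratio (d n k : nat) : (0 < d)%N -> (0 < n)%N -> (0 < k)%N ->
  ln (INR n) - ln (INR d) = ln (INR k) <-> (d * k = n)%N.
Proof.
move=> d0 n0 k0.
have e : ln (INR d) + ln (INR k) = ln (INR (d * k)%N).
  by rewrite mult_INR ln_mult //; exact: INR_gt0.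
split=> h; last by rewrite -h -e; ring.
apply: INR_eq; apply: ln_inv.
- by apply: INR_gt0; rewrite muln_gt0 d0.
- exact: INR_gt0.
- by rewrite -e; lra.
Qed.

Lemma dterm_exp (c : nat -> C) (x lam t : R) (k : nat) :
  (dterm c (x, t) k * cexp (RtoC lam * (x, t)))%C =
  (c k.+1 * npow k.+1 (RtoC x) * cexp (RtoC (lam * x)) * cexp (Ci * RtoC ((lam - ln (INR k.+1)) * t)))%C.
Proof.
rewrite /dterm !npow_cexp -!Cmult_assoc -!cexp_plus; congr (_ * cexp _)%C.
have -> : (x, t) = (RtoC x + Ci * RtoC t)%C by apply: C_eq => /=; ring.
rewrite !RtoC_mult RtoC_minus; ring.
Qed.

(** The value is the entry in row [n] and column [d] of convolution by [c_k k^(-sigma)]. It is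
    computed on a line far to the right, where the absolutely convergent series may be averaged
    termwise, and carried back to [sigma] by [is_mean_shift]. *)
Lemma mean_coefficient (F : C -> C) (c : nat -> C) (delta sigma1 M sigma : R) (d n : nat) :
  (forall s, half_plane delta s -> (exists l, cdiff F s l) /\ Cmod (F s) <= M) ->
  delta <= sigma1 ->
  (forall s, half_plane sigma1 s -> dconverges_abs c s /\ F s = dsum c s) ->
  delta < sigma -> (0 < d)%N -> (0 < n)%N ->
  is_mean (fun t => F (sigma, t) * cexp (Ci * RtoC ((ln (INR n) - ln (INR d)) * t)))%C
    (if (d %| n)%N then c (n %/ d)%N * npow (n %/ d)%N (RtoC sigma) else RtoC 0)%C.
Proof.
move=> hF hds hc hs d0 n0.
set lam := ln (INR n) - ln (INR d).
set q := (n %/ d)%N.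
set v := (if (d %| n)%N then c q else RtoC 0).
set sigma' := Rmax (sigma1 + 1) sigma.
have hss : sigma <= sigma' by exact: Rmax_r.
have hs1 : sigma1 < sigma' by have := Rmax_l (sigma1 + 1) sigma; rewrite -/sigma'; lra.
(* The full exponential of [lam s] replaces its imaginary part so that [h] is holomorphic; the
   factor [e^(lam sigma)] is divided out at the end. *)
pose h s := (F s * cexp (RtoC lam * s))%C.
have hh s : sigma <= Re s <= sigma' -> (exists m, cdiff h s m) /\ Cmod (h s) <= M * (exp (lam * sigma) + exp (lam * sigma')).
  move=> hres; have [[l hl] hb] := hF s ltac:(rewrite /half_plane; lra).
  split; first by eexists; exact: cdiff_mult hl (cdiff_cexp_scal lam s).
  rewrite /h Cmod_mult Cmod_cexp; apply: Rmult_le_compat => //; first exact: Cmod_ge_0.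
    by left; exact: exp_pos.
  have -> : Re (RtoC lam * s)%C = lam * Re s by rewrite Re_mult /=; ring.
  have p1 := exp_pos (lam * sigma); have p2 := exp_pos (lam * sigma').
  case: (Rle_lt_dec 0 lam) => hlam.
    have : lam * Re s <= lam * sigma' by apply: Rmult_le_compat_l; lra.
    by case=> [/exp_increasing|->]; lra.
  have : lam * Re s <= lam * sigma by nra.
  by case=> [/exp_increasing|->]; lra.
have hmean' : is_mean (fun t => h (sigma', t)) v.
  have hst t : half_plane sigma1 (sigma', t) by rewrite /half_plane /=.
  apply: is_mean_approx.
    move=> T hT; exists (CInt (fun t => h (sigma', t)) (- T) T).
    apply: is_CInt_CInt; first lra.
    move=> t _; have [[m hm] _] := hh (sigma', t) ltac:(rewrite /=; lra).
    by apply: cdiff_ccontinuous hm _; exact: ccontinuous_vertical.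
  move=> eps he.
  have [habs _] := hc _ (hst 0).
  have hl0 : 0 < exp (lam * sigma') by exact: exp_pos.
  have /is_lim_seq_spec/(_ (mkposreal (eps / exp (lam * sigma')) (Rdiv_lt_0_compat _ _ he hl0))) [K hK] := Series_lim _ habs.
  (* [K] terms make the tail small, and [n] more guarantee that the quotient [n / d] is among the
     indices. *)
  set N := (K + n)%N.
  exists (fun t => \csum_(0 <= k < N) (dterm c (sigma', t) k * cexp (RtoC lam * (sigma', t))))%C.
  split.
    have hval : v = \csum_(0 <= k < N) (c k.+1 * npow k.+1 (RtoC sigma') * cexp (RtoC (lam * sigma')) *
        indic0 (lam - ln (INR k.+1))).
      rewrite /v; case: (boolP (d %| n)%N) => hdn.
        have q0 : (0 < q)%N by rewrite divn_gt0 // dvdn_leq.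
        have elam : lam = ln (INR q) by apply/ln_ratio => //; rewrite mulnC divnK.
        have qn : (q <= n)%N by exact: leq_div.
        have hin : q.-1 \in index_iota 0 N by rewrite mem_index_iota /N; lia.
        rewrite (bigD1_seq _ hin (iota_uniq _ _)) big1 ?Cplus_0_r; last first.
          move=> k hk; case: (Req_dec (lam - ln (INR k.+1)) 0) => e; last by rewrite indic0_neq //; ring.
          have hk2 : (d * k.+1 = n)%N by apply/ln_ratio => //; rewrite -/lam; lra.
          by case/eqP: hk; rewrite /q -hk2 mulKn.
        rewrite prednK // indic0_eq; last lra.
        rewrite Cmult_1_r -Cmult_assoc npow_cexp -cexp_plus elam.
        have -> : (- (RtoC sigma' * RtoC (ln (INR q))) + RtoC (ln (INR q) * sigma') = 0)%C by rewrite RtoC_mult; ring.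
        by rewrite cexp_0 Cmult_1_r /= Cplus_0_r.
      rewrite big1 // => k _; case: (Req_dec (lam - ln (INR k.+1)) 0) => e; last by rewrite indic0_neq //; ring.
      have hk2 : (d * k.+1 = n)%N by apply/ln_ratio => //; rewrite -/lam; lra.
      by case/negP: hdn; rewrite -hk2 dvdn_mulr.
    rewrite hval; apply: is_mean_csum => k _.
    apply: is_mean_ext; first by move=> t; rewrite dterm_exp.
    by apply: is_mean_scal; exact: is_mean_exp.
  move=> t.
  have [ht he2] := hc _ (hst t).
  rewrite /h he2.
  have -> : \csum_(0 <= k < N) (dterm c (sigma', t) k * cexp (RtoC lam * (sigma', t))) =
    ((\csum_(0 <= k < N) dterm c (sigma', t) k) * cexp (RtoC lam * (sigma', t)))%C by rewrite big_distrl.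
  set S := \csum_(0 <= k < N) _.
  have -> : (dsum c (sigma', t) * cexp (RtoC lam * (sigma', t)) - S * cexp (RtoC lam * (sigma', t)) =
    (dsum c (sigma', t) - S) * cexp (RtoC lam * (sigma', t)))%C by ring.
  rewrite Cmod_mult Cmod_cexp.
  have -> : Re (RtoC lam * (sigma', t))%C = lam * sigma' by rewrite /=; ring.
  apply/Rle_div_r => //.
  apply: Rle_trans (dsum_tail_le _ _ N ht) _.
  have ek k : Cmod (dterm c (sigma', t) k) = Cmod (dterm c (sigma', 0) k).
    by rewrite /dterm !Cmod_mult !Cmod_npow.
  rewrite (Series_ext _ _ ek) (eq_bigr _ (fun k _ => ek k)).
  have := hK N ltac:(rewrite /N; lia) => /Rabs_lt_between /=; lra.
have hmean := is_mean_shift h sigma sigma' _ v hss hh hmean'.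
have := is_mean_scal (cexp (RtoC (- (lam * sigma)))) _ _ hmean.
set l := (cexp _ * v)%C.
have -> : l = (if (d %| n)%N then c q * npow q (RtoC sigma) else RtoC 0)%C.
  rewrite /l /v; case: (boolP (d %| n)%N) => hdn; last by ring.
  have q0 : (0 < q)%N by rewrite divn_gt0 // dvdn_leq.
  have elam : lam = ln (INR q) by apply/ln_ratio => //; rewrite mulnC divnK.
  rewrite Cmult_comm npow_cexp elam; congr (_ * cexp _)%C.
  by rewrite RtoC_opp RtoC_mult; ring.
apply: is_mean_ext => t.
rewrite /h (Cmult_comm (F _)) Cmult_assoc -cexp_plus Cmult_comm; congr (_ * cexp _)%C.
have -> : (sigma, t) = (RtoC sigma + Ci * RtoC t)%C by apply: C_eq => /=; ring.
rewrite RtoC_opp !RtoC_mult; ring.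
Qed.

Lemma Cconj_csum (f : nat -> C) (r : seq nat) :
  Cconj (\csum_(k <- r) f k) = \csum_(k <- r) Cconj (f k).
Proof. exact: (big_morph Cconj Cplus_conj (ltac:(apply: C_eq => /=; ring) : Cconj 0 = 0)). Qed.

Lemma Cconj_cexp (z : C) : Cconj (cexp z) = cexp (Cconj z).
Proof. by case: z => x y; apply: C_eq; rewrite /= ?cos_neg ?sin_neg; ring. Qed.

Definition trig (r : seq nat) (a : nat -> C) (t : R) : C :=
  \csum_(d <- r) (a d * cexp (- (Ci * RtoC (ln (INR d) * t)))).

Lemma trig_product (r : seq nat) (a e : nat -> C) (t : R) :
  (trig r a t * Cconj (trig r e t))%C =
  \csum_(n <- r) \csum_(d <- r) (Cconj (e n) * a d * cexp (Ci * RtoC ((ln (INR n) - ln (INR d)) * t))).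
Proof.
rewrite /trig Cconj_csum Cmult_comm big_distrl; apply: eq_bigr => n _.
rewrite big_distrr; apply: eq_bigr => d _ /=.
rewrite Cmult_conj Cconj_cexp.
have -> : Cconj (- (Ci * RtoC (ln (INR n) * t))) = (Ci * RtoC (ln (INR n) * t))%C by apply: C_eq => /=; ring.
have -> : (Ci * RtoC ((ln (INR n) - ln (INR d)) * t) = Ci * RtoC (ln (INR n) * t) + - (Ci * RtoC (ln (INR d) * t)))%C.
  by rewrite !RtoC_mult RtoC_minus; ring.
by rewrite cexp_plus; ring.
Qed.

Lemma mean_trig_sqr (r : seq nat) (a : nat -> C) : uniq r -> (forall n, n \in r -> (0 < n)%N) ->
  is_mean (fun t => trig r a t * Cconj (trig r a t))%C (RtoC (\rsum_(n <- r) (Cmod (a n) ^ 2))).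
Proof.
move=> hu hr.
have -> : RtoC (\rsum_(n <- r) (Cmod (a n) ^ 2)) =
    \csum_(n <- r) \csum_(d <- r) (Cconj (a n) * a d * indic0 (ln (INR n) - ln (INR d))).
  rewrite (big_morph RtoC RtoC_plus (erefl (RtoC 0))); apply: eq_big_seq => n hn.
  rewrite (bigD1_seq n hn hu) /= big_seq_cond big1 ?Cplus_0_r; last first.
    move=> d /andP[hd hdn]; case: (Req_dec (ln (INR n) - ln (INR d)) 0) => e; last by rewrite indic0_neq //; ring.
    case/eqP: hdn; apply: INR_eq; apply: ln_inv; try exact: INR_gt0 (hr _ _).
    lra.
  rewrite indic0_eq; last lra.
  by rewrite Cmod2_conj /=; ring.
apply: is_mean_ext; first by move=> t; rewrite trig_product.
apply: is_mean_csum => n _; apply: is_mean_csum => d _.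
by apply: is_mean_scal; exact: is_mean_exp.
Qed.

(** Pairing [F] times the polynomial of [a] with that of [e = b / M] gives the sum of [|b_n|^2]
    divided by [M]. Since [|F| <= M], the expression [M/2 (|X|^2 + |Y|^2) - Re (F X Cconj Y)] is
    pointwise nonnegative, and nonnegativity of its mean is the claim after multiplication by
    [2 M]. *)
Lemma divisors_mean_inequality (F : C -> C) (c : nat -> C) (delta sigma1 M sigma : R) (m : nat) (a : nat -> C) :
  0 < M ->
  (forall s, half_plane delta s -> (exists l, cdiff F s l) /\ Cmod (F s) <= M) ->
  delta <= sigma1 ->
  (forall s, half_plane sigma1 s -> dconverges_abs c s /\ F s = dsum c s) ->
  delta < sigma -> (0 < m)%N ->
  \rsum_(n <- divisors m) (Cmod (conv a (fun k => c k * npow k (RtoC sigma))%C n) ^ 2) <=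
  M ^ 2 * \rsum_(n <- divisors m) (Cmod (a n) ^ 2).
Proof.
move=> hM hF hds hc hs m0.
set D := divisors m.
have D0 n : n \in D -> (0 < n)%N by rewrite /D -dvdn_divisors // => /(dvdn_gt0 m0).
pose b n := conv a (fun k => c k * npow k (RtoC sigma))%C n.
set A := \rsum_(n <- D) (Cmod (a n) ^ 2); set B := \rsum_(n <- D) _.
pose e n := (RtoC (/ M) * b n)%C.
have m1 := mean_trig_sqr D a (divisors_uniq m) D0.
have m2 := mean_trig_sqr D e (divisors_uniq m) D0.
have m3 : is_mean (fun t => F (sigma, t) * (trig D a t * Cconj (trig D e t)))%C (\csum_(n <- D) (Cconj (e n) * b n)).
  have -> : \csum_(n <- D) (Cconj (e n) * b n) = \csum_(n <- D) \csum_(d <- D)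
      (Cconj (e n) * a d * (if (d %| n)%N then c (n %/ d)%N * npow (n %/ d)%N (RtoC sigma) else RtoC 0)).
    apply: eq_big_seq => n hn; have n0 := D0 n hn.
    have hnm : (n %| m)%N by rewrite dvdn_divisors.
    rewrite /b /conv big_distrr /=.
    transitivity (\csum_(d <- D | (d %| n)%N) (Cconj (e n) * (a d * (c (n %/ d)%N * npow (n %/ d)%N (RtoC sigma))))).
      rewrite -[RHS]big_filter; apply: perm_big; apply: uniq_perm.
      - exact: divisors_uniq.
      - by apply: filter_uniq; exact: divisors_uniq.
      move=> d; rewrite mem_filter -dvdn_divisors // -dvdn_divisors //.
      by case: (boolP (d %| n)%N) => //= hd; rewrite (dvdn_trans hd hnm).
    rewrite big_mkcond; apply: eq_bigr => d _.
    by case: ifP => _; ring.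
  apply: (is_mean_ext (fun t => \csum_(n <- D) \csum_(d <- D) (Cconj (e n) * a d *
      (F (sigma, t) * cexp (Ci * RtoC ((ln (INR n) - ln (INR d)) * t)))))).
    move=> t; rewrite trig_product big_distrr; apply: eq_bigr => n _.
    by rewrite big_distrr; apply: eq_bigr => d _ /=; ring.
  apply: is_mean_csum => n hn; apply: is_mean_csum => d hd; apply: is_mean_scal.
  by apply: mean_coefficient hF hds hc hs (D0 d hd) (D0 n hn).
have hmean := is_mean_plus _ _ _ _ (is_mean_scal (RtoC (M / 2)) _ _ (is_mean_plus _ _ _ _ m1 m2)) (is_mean_scal (- (1)) _ _ m3).
have := is_mean_ge0 _ _ hmean.
have eB : \csum_(n <- D) (Cconj (e n) * b n) = RtoC (/ M * B).
  rewrite /B (big_distrr (/ M)) /= (big_morph RtoC RtoC_plus (erefl (RtoC 0))); apply: eq_bigr => n _.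
  rewrite RtoC_mult Cmod2_conj /e /b Cmult_conj.
  have -> : Cconj (RtoC (/ M)) = RtoC (/ M) by apply: C_eq => /=; ring.
  ring.
have eE : \rsum_(n <- D) (Cmod (e n) ^ 2) = / M ^ 2 * B.
  rewrite /B big_distrr; apply: eq_bigr => n _ /=.
  rewrite /e /b Cmod_mult Cmod_R Rabs_pos_eq; last by left; exact: Rinv_0_lt_compat.
  by field; lra.
rewrite eB eE -/A => h.
have {}h := h _.
have hpt t : 0 <= Re (RtoC (M / 2) * (trig D a t * Cconj (trig D a t) + trig D e t * Cconj (trig D e t)) +
    - (1) * (F (sigma, t) * (trig D a t * Cconj (trig D e t))))%C.
  set X := trig D a t; set Y := trig D e t.
  rewrite -!Cmod2_conj -RtoC_plus -RtoC_mult Re_plus.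
  have [_ hb] := hF (sigma, t) hs.
  have h1 : Re (- (1) * (F (sigma, t) * (X * Cconj Y)))%C = - Re (F (sigma, t) * (X * Cconj Y))%C by rewrite /=; ring.
  rewrite h1 [Re (RtoC _)]/=.
  have h2 := Rle_trans _ _ _ (Rle_abs _) (re_le_Cmod (F (sigma, t) * (X * Cconj Y))%C).
  rewrite !Cmod_mult Cmod_conj in h2.
  have hX := Cmod_ge_0 X; have hY := Cmod_ge_0 Y.
  have h3 : Cmod (F (sigma, t)) * (Cmod X * Cmod Y) <= M * (Cmod X * Cmod Y).
    by apply: Rmult_le_compat_r => //; exact: Rmult_le_pos.
  have h4 : M * (Cmod X * Cmod Y) <= M * ((Cmod X ^ 2 + Cmod Y ^ 2) / 2).
    apply: Rmult_le_compat_l; first lra.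
    by have := pow2_ge_0 (Cmod X - Cmod Y); lra.
  lra.
move: (h hpt).
have -> : Re (RtoC (M / 2) * (RtoC A + RtoC (/ M ^ 2 * B)) + - (1) * RtoC (/ M * B))%C = M / 2 * (A + / M ^ 2 * B) - / M * B.
  by rewrite /=; ring.
move=> h1.
have h2 := Rmult_le_compat_l (2 * M) _ _ ltac:(lra) h1.
have e2 : 2 * M * (M / 2 * (A + / M ^ 2 * B) - / M * B) = M ^ 2 * A - B by field; lra.
by rewrite e2 in h2; lra.
Qed.

(** * Multiplicative weights *)

Lemma coprime_gcd (m n : nat) : coprime m n -> Nat.gcd m n = 1%N.
Proof.
move=> /eqP h.
have h1 : (Nat.gcd m n %| gcdn m n)%N.
  rewrite dvdn_gcd; apply/andP; split; apply/dvdnP.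
    by have [k hk] := Nat.gcd_divide_l m n; exists k.
  by have [k hk] := Nat.gcd_divide_r m n; exists k.
by move: h1; rewrite h dvdn1 => /eqP.
Qed.

Lemma big_divisors_prime_power (T : Type) (idx : T) (op : Monoid.com_law idx) (F : nat -> T)
    (p k m : nat) : prime p -> (0 < m)%N -> coprime p m ->
  \big[op/idx]_(n <- divisors (p ^ k * m)) F n =
  \big[op/idx]_(0 <= j < k.+1) \big[op/idx]_(n <- divisors m) F (p ^ j * n)%N.
Proof.
move=> hp m0 hpm.
have pk0 j : (0 < p ^ j)%N by rewrite expn_gt0 prime_gt0.
have pm0 : (0 < p ^ k * m)%N by rewrite muln_gt0 pk0.
have cop n : n \in divisors m -> coprime p n.
  by rewrite -dvdn_divisors // => hn; exact: coprime_dvdr hn hpm.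
have pos n : n \in divisors m -> (0 < n)%N.
  by rewrite -dvdn_divisors // => /(dvdn_gt0 m0).
have logE j n : n \in divisors m -> logn p (p ^ j * n) = j.
  move=> hn; rewrite lognM //; last exact: pos.
  by rewrite pfactorK // (logn_coprime (cop _ hn)) addn0.
transitivity (\big[op/idx]_(n <- [seq (p ^ j * n)%N | j <- index_iota 0 k.+1, n <- divisors m]) F n); last first.
  by rewrite big_allpairs_dep.
apply: perm_big; apply: uniq_perm; first exact: divisors_uniq.
  apply: allpairs_uniq; [exact: iota_uniq | exact: divisors_uniq |].
  move=> [j n] [j' n'] hin hin' /= e.
  have h1 : n \in divisors m by have /allpairsP[[? ?] /= [_ ? [_ ->]]] := hin.
  have h2 : n' \in divisors m by have /allpairsP[[? ?] /= [_ ? [_ ->]]] := hin'.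
  have e1 := logE j _ h1; rewrite e logE // in e1.
  by move: e; rewrite e1 => /eqP; rewrite eqn_pmul2l // => /eqP ->.
move=> n; rewrite -dvdn_divisors //; apply/idP/allpairsP.
- move=> hn; have n0 := dvdn_gt0 pm0 hn.
  have [q hq hnq] := pfactor_coprime hp n0.
  exists (logn p n, q) => /=; split; last by rewrite {1}hnq mulnC.
    rewrite mem_index_iota /= ltnS -(@dvdn_Pexp2l p) ?prime_gt1 //.
    rewrite -(@Gauss_dvdl _ _ m); last exact: coprimeXl.
    by apply: dvdn_trans hn; rewrite [X in (_ %| X)%N]hnq dvdn_mull.
  rewrite -dvdn_divisors //.
  rewrite -(@Gauss_dvdr q (p ^ k)); last by rewrite coprime_sym; exact: coprimeXl.
  by apply: dvdn_trans hn; rewrite [X in (_ %| X)%N]hnq dvdn_mulr.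
- move=> [[j q] /= []]; rewrite mem_index_iota /= ltnS => hj hq ->.
  by apply: dvdn_mul; [exact: dvdn_exp2l | rewrite dvdn_divisors].
Qed.

(** Abel summation with decreasing weights and nonnegative partial sums; keeping the boundary term
    [u K] times the last partial sum is what makes the induction close. *)
Lemma abel_nonneg (u S : nat -> R) (K : nat) :
  (forall j, 0 <= u j) -> (forall j, u j.+1 <= u j) ->
  (forall i, (i <= K)%N -> 0 <= \rsum_(0 <= j < i.+1) S j) ->
  u K * (\rsum_(0 <= j < K.+1) S j) <= \rsum_(0 <= j < K.+1) (u j * S j).
Proof.
move=> u0 ud; elim: K => [|K IH] hT; first by rewrite !big_nat1; right.
rewrite big_nat_recr //= [X in _ <= X]big_nat_recr //=.
have h1 := IH (fun i hi => hT i (leqW hi)).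
have h2 := hT K (leqnSn K).
have := Rmult_le_compat_r _ _ _ h2 (ud K); lra.
Qed.

(* A multiplicative weight decreasing along the powers of each prime is a positive
   combination of indicators of divisor sets. *)
Lemma weighted_divisors_ge0 (v : nat -> R) (m : nat) (g : nat -> R) :
  (forall n, (0 < n)%N -> 0 <= v n) ->
  (forall m n, (0 < m)%N -> (0 < n)%N -> coprime m n -> v (m * n)%N = v m * v n) ->
  (forall p k, prime p -> v (p ^ k.+1)%N <= v (p ^ k)%N) ->
  (0 < m)%N -> (forall d, (d %| m)%N -> 0 <= \rsum_(n <- divisors d) g n) ->
  0 <= \rsum_(n <- divisors m) (v n * g n).
Proof.
move=> v0 vmul vdec; elim/ltn_ind: m g => m IH g m0 hg.
case: (ltnP 1 m) => m1; last first.
  have e : m = 1%N by lia.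
  have := hg 1%N (dvd1n _); rewrite e /= !big_seq1 => h.
  by apply: Rmult_le_pos => //; exact: v0.
have hp := pdiv_prime m1; set p := pdiv m in hp.
have [q hq hmq] := pfactor_coprime hp m0.
set k := logn p m in hmq.
have q0 : (0 < q)%N by move: m0; rewrite hmq muln_gt0 => /andP[].
have k0 : (0 < k)%N by rewrite /k logn_gt0 mem_primes hp m0 pdiv_dvd.
have qm : (q < m)%N.
  rewrite [X in (_ < X)%N]hmq -[X in (X < _)%N]muln1 ltn_pmul2l //.
  by rewrite -(expn0 p) ltn_exp2l // prime_gt1.
have em : m = (p ^ k * q)%N by rewrite {1}hmq mulnC.
have pj0 j : (0 < p ^ j)%N by rewrite expn_gt0 prime_gt0.
pose S j := \rsum_(n <- divisors q) (v n * g (p ^ j * n)%N).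
rewrite em big_divisors_prime_power //.
have -> : \big[Rplus/0]_(0 <= j < k.+1) \big[Rplus/0]_(n <- divisors q) (v (p ^ j * n)%N * g (p ^ j * n)%N) =
    \rsum_(0 <= j < k.+1) (v (p ^ j)%N * S j).
  apply: eq_bigr => j _; rewrite /S big_distrr; apply: eq_big_seq => n.
  rewrite -dvdn_divisors // => hn /=; have n0 := dvdn_gt0 q0 hn.
  by rewrite vmul // ?Rmult_assoc //; apply: coprimeXl; exact: coprime_dvdr hn hq.
(* The induction hypothesis for [q] is applied to [g] summed over [p^0, ..., p^i]: for [d] dividing
   [q], this sum over the divisors of [d] is the sum of [g] over the divisors of [p^i d], which
   divides [m]. *)
have hT i : (i <= k)%N -> 0 <= \rsum_(0 <= j < i.+1) S j.
  move=> hi; rewrite /S exchange_big /=.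
  under eq_bigr do rewrite -big_distrr.
  apply: (IH q qm (fun n => \rsum_(0 <= j < i.+1) g (p ^ j * n)%N)) => // d hd.
  rewrite exchange_big /= -(big_divisors_prime_power _ _ Rplus g p i d) //.
  - apply: hg; rewrite em; apply: dvdn_mul => //; exact: dvdn_exp2l.
  - exact: dvdn_gt0 q0 hd.
  - exact: coprime_dvdr hd hq.
apply: Rle_trans (abel_nonneg (fun j => v (p ^ j)%N) S k _ _ hT).
- by apply: Rmult_le_pos; [exact: v0 | exact: hT].
- by move=> j; exact: v0.
- by move=> j; exact: vdec.
Qed.

Lemma exp_INR_mul (x : R) (m n : nat) : (0 < m)%N -> (0 < n)%N ->
  exp (x * ln (INR (m * n)%N)) = exp (x * ln (INR m)) * exp (x * ln (INR n)).
Proof.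
move=> m0 n0; rewrite -exp_plus mult_INR ln_mult; [|exact: INR_gt0..].
by congr exp; ring.
Qed.

Lemma conv_twist (a c : nat -> C) (s : C) (n : nat) : (0 < n)%N ->
  conv (fun d => a d * npow d s)%C (fun k => c k * npow k s)%C n = (conv a c n * npow n s)%C.
Proof.
move=> n0; rewrite /conv big_distrl; apply: eq_big_seq => d; rewrite -dvdn_divisors // => hd /=.
have d0 := dvdn_gt0 n0 hd.
have q0 : (0 < n %/ d)%N by rewrite divn_gt0 // dvdn_leq.
have -> : npow n s = (npow d s * npow (n %/ d)%N s)%C.
  by rewrite -npow_mult // mulnC divnK.
ring.
Qed.

(** [F] is not controlled on the line of abscissa [delta], but the inequality for [sigma > delta] is
    a finite sum continuous in [sigma]. Twisting [a] by [n^(-sigma)] pulls the powers out of the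
    convolution. *)
Lemma divisors_boundary_inequality (F : C -> C) (c : nat -> C) (delta sigma1 M : R) (m : nat) (a : nat -> C) :
  0 < M ->
  (forall s, half_plane delta s -> (exists l, cdiff F s l) /\ Cmod (F s) <= M) ->
  delta <= sigma1 ->
  (forall s, half_plane sigma1 s -> dconverges_abs c s /\ F s = dsum c s) ->
  (0 < m)%N ->
  0 <= \rsum_(n <- divisors m)
    (exp (- (2 * delta) * ln (INR n)) * (M ^ 2 * Cmod (a n) ^ 2 - Cmod (conv a c n) ^ 2)).
Proof.
move=> hM hF hds hc m0.
pose G x := \rsum_(n <- divisors m) (exp (- (2 * x) * ln (INR n)) * (M ^ 2 * Cmod (a n) ^ 2 - Cmod (conv a c n) ^ 2)).
have hG x : delta < x -> 0 <= G x.
  move=> hx.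
  have := divisors_mean_inequality F c delta sigma1 M x m (fun d => a d * npow d (RtoC x))%C hM hF hds hc hx m0.
  have sq n : Cmod (npow n (RtoC x)) ^ 2 = exp (- (2 * x) * ln (INR n)).
    by rewrite Cmod_npow /= Rmult_1_r -exp_plus; congr exp; ring.
  have -> : G x = M ^ 2 * (\rsum_(n <- divisors m) (Cmod (a n * npow n (RtoC x)) ^ 2)) +
      (- 1) * \rsum_(n <- divisors m) (Cmod (conv (fun d => a d * npow d (RtoC x))%C (fun k => c k * npow k (RtoC x))%C n) ^ 2).
    rewrite !big_distrr -big_split; apply: eq_big_seq => n; rewrite -dvdn_divisors // => hn /=.
    rewrite conv_twist; last exact: dvdn_gt0 m0 hn.
    by rewrite !Cmod_mult -sq; ring.
  lra.
have hl : is_lim_seq (fun n => G (delta + / INR n.+1)) (G delta).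
  apply: is_lim_seq_rsum => n.
  have hx : is_lim_seq (fun j => delta + / INR j.+1) delta.
    have h0 : is_lim_seq (fun j => / INR j.+1) 0.
      have h1 := proj1 (is_lim_seq_incr_1 INR p_infty) is_lim_seq_INR.
      exact: (is_lim_seq_inv _ _ h1).
    by have := is_lim_seq_plus' _ _ _ _ (is_lim_seq_const delta) h0; rewrite Rplus_0_r.
  apply: (is_lim_seq_continuous (fun x => exp (- (2 * x) * ln (INR n)) * (M ^ 2 * Cmod (a n) ^ 2 - Cmod (conv a c n) ^ 2)) _ delta _ hx).
  apply/continuity_pt_filterlim; apply: (ex_derive_continuous (K := R_AbsRing) (V := R_NormedModule)).
  by auto_derive.
have h : Rbar_le 0 (G delta).
  apply: is_lim_seq_le (is_lim_seq_const 0) hl => n; apply: hG.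
  by have : 0 < / INR n.+1 by [apply: Rinv_0_lt_compat; exact: INR_gt0]; lra.
exact: h.
Qed.

Lemma convolution_norm_le (w : nat -> R) (F : C -> C) (c a : nat -> C) (delta sigma1 M : R) :
  pos_weight w -> multiplicative w ->
  (forall p k : nat, is_prime p -> (1 <= k)%coq_nat ->
     w (Nat.pow p (Nat.sub k 1)) * Rpower (INR p) (- (2 * delta)) >= w (Nat.pow p k)) ->
  0 < M ->
  (forall s, half_plane delta s -> (exists l, cdiff F s l) /\ Cmod (F s) <= M) ->
  delta <= sigma1 ->
  (forall s, half_plane sigma1 s -> dconverges_abs c s /\ F s = dsum c s) ->
  in_H w a -> c 0%N = 0 -> normH w (conv a c) <= M * normH w a.
Proof.
move=> hw hmul hdec hM hF hds hc ha c0.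
have powE p k : Nat.pow p k = (p ^ k)%N by elim: k => //= k ->; rewrite expnS.
(* With [n^(2 delta)] absorbed into the weight, the hypothesis on prime powers says that [v]
   decreases along them; [g] carries the inverse factor, so [v n * g n] involves only [w]. *)
pose v n := w n * exp (2 * delta * ln (INR n)).
pose g n := exp (- (2 * delta) * ln (INR n)) * (M ^ 2 * Cmod (a n) ^ 2 - Cmod (conv a c n) ^ 2).
have N0 := normH_ge0 w a.
have vg n : v n * g n = M ^ 2 * (Cmod (a n) ^ 2 * w n) - Cmod (conv a c n) ^ 2 * w n.
  rewrite /v /g.
  have e : exp (2 * delta * ln (INR n)) * exp (- (2 * delta) * ln (INR n)) = 1.
    by rewrite -exp_plus -exp_0; congr exp; ring.
  set x := exp _ in e *; set y := exp _ in e *.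
  transitivity (x * y * (w n * (M ^ 2 * Cmod (a n) ^ 2 - Cmod (conv a c n) ^ 2))); first ring.
  by rewrite e; ring.
have pos m : (0 < m)%N -> 0 <= \rsum_(n <- divisors m) (v n * g n).
  move=> m0; apply: weighted_divisors_ge0 => //.
  - by move=> n n0; apply: Rmult_le_pos; left; [exact: hw | exact: exp_pos].
  - move=> i j i0 j0 hij.
    rewrite /v exp_INR_mul //.
    have -> : w (i * j)%N = w i * w j by apply: hmul; [lia | lia | exact: coprime_gcd].
    ring.
  - move=> p k hp.
    have := hdec p k.+1 ltac:(by apply/is_primeP) ltac:(lia).
    have -> : Nat.sub k.+1 1 = k by lia.
    rewrite !powE /Rpower => h.
    have p0 := prime_gt0 hp.
    rewrite /v {2}expnS exp_INR_mul ?expn_gt0 ?p0 // (Rmult_comm (exp (_ * ln (INR p)))) -Rmult_assoc.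
    have e : exp (- (2 * delta) * ln (INR p)) * exp (2 * delta * ln (INR p)) = 1.
      by rewrite -exp_plus -exp_0; congr exp; ring.
    have hx := exp_pos (2 * delta * ln (INR (p ^ k)%N)); have hy := exp_pos (2 * delta * ln (INR p)).
    have h1 := Rmult_le_compat_r _ _ _ (Rlt_le _ _ hy) (Rge_le _ _ h).
    rewrite (Rmult_assoc (w (p ^ k)%N)) e Rmult_1_r in h1.
    have h2 := Rmult_le_compat_r _ _ _ (Rlt_le _ _ hx) h1.
    lra.
  - move=> d hd; apply: divisors_boundary_inequality hM hF hds hc _.
    exact: dvdn_gt0 m0 hd.
have hsum K : \rsum_(0 <= k < K) sqterm w (conv a c) k <= (M * normH w a) ^ 2.
  (* Every [n] from 1 to [K] divides the factorial of [K], so the sum over its divisors dominates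
     the partial sum for the convolution while staying below the full norm for [a]. *)
  set m := (\prod_(1 <= i < K.+1) i)%N.
  have m0 : (0 < m)%N by rewrite /m big_nat; apply: prodn_cond_gt0 => i /andP[].
  have hdiv i : (0 < i)%N -> (i <= K)%N -> (i %| m)%N.
    move=> i0 iK; rewrite /m (bigD1_seq i) ?iota_uniq ?mem_index_iota ?i0 ?ltnS //=.
    exact: dvdn_mulr.
  have h := pos m m0.
  have split_sum : \rsum_(n <- divisors m) (v n * g n) =
      M ^ 2 * (\rsum_(n <- divisors m) (Cmod (a n) ^ 2 * w n)) + (- 1) * \rsum_(n <- divisors m) (Cmod (conv a c n) ^ 2 * w n).
    rewrite !big_distrr -big_split; apply: eq_bigr => n _ /=; rewrite vg; ring.
  rewrite split_sum in h.
  have dm n : n \in divisors m -> (0 < n)%N /\ (n <= m)%N.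
    by rewrite -dvdn_divisors // => hn; split; [exact: dvdn_gt0 m0 hn | exact: dvdn_leq].
  have range (x : nat -> nat -> R) : \rsum_(n <- divisors m) x n n = \rsum_(1 <= n < m.+1) (if (n %| m)%N then x n n else 0).
    rewrite -[RHS]big_mkcond -[RHS]big_filter; apply: perm_big; apply: uniq_perm.
    - exact: divisors_uniq.
    - by apply: filter_uniq; exact: iota_uniq.
    move=> n; rewrite mem_filter mem_index_iota -dvdn_divisors //.
    case: (boolP (n %| m)%N) => //= hn.
    by rewrite (dvdn_gt0 m0 hn) ltnS dvdn_leq.
  have up : \rsum_(n <- divisors m) (Cmod (a n) ^ 2 * w n) <= normH w a ^ 2.
    apply: (Rle_trans _ (\rsum_(0 <= k < m) sqterm w a k)); last first.
      by rewrite -pnorm_sqr //; apply: pow_incr; split; [exact: pnorm_ge0 | exact: pnorm_le_normH].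
    rewrite (range (fun n _ => Cmod (a n) ^ 2 * w n)) /sqterm (big_shift _ _ _ (fun n => Cmod (a n) ^ 2 * w n)).
    apply: rsum_le => n; rewrite mem_index_iota => /andP[n1 _] _.
    case: ifP => _; first by right.
    by apply: Rmult_le_pos; [exact: pow2_ge_0 | left; exact: hw].
  have lo : \rsum_(0 <= k < K) sqterm w (conv a c) k <= \rsum_(n <- divisors m) (Cmod (conv a c n) ^ 2 * w n).
    rewrite (range (fun n _ => Cmod (conv a c n) ^ 2 * w n)) /sqterm (big_shift _ _ _ (fun n => Cmod (conv a c n) ^ 2 * w n)).
    have Km : (K <= m)%N.
      case: (posnP K) => [->//|K0]; apply: dvdn_leq => //; exact: hdiv.
    rewrite (big_cat_nat (ltac:(lia) : 1 <= K.+1)%N (ltac:(lia) : K.+1 <= m.+1)%N) /=.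
    rewrite -[X in X <= _]Rplus_0_r; apply: Rplus_le_compat.
      apply: rsum_le => n; rewrite mem_index_iota => /andP[n1 nK] _.
      by rewrite hdiv //; right.
    rewrite big_nat; apply: rsum_ge0 => n /andP[n1 _]; case: ifP => _; last by right.
    by apply: Rmult_le_pos; [exact: pow2_ge_0 | left; apply: hw; lia].
  have h2 := Rmult_le_compat_l (M ^ 2) _ _ (pow2_ge_0 M) up.
  rewrite Rpow_mult_distr; lra.
apply: (proj2 (in_H_bound w _ _ hw (conv_0 a c c0) _)) => K.
rewrite /pnorm -(sqrt_pow2 (M * normH w a)); last by apply: Rmult_le_pos; lra.
exact: sqrt_le_1_alt.
Qed.

(** * The two norm inequalities *)

(** The partial sums are entire and uniformly bounded on a disc about [s], so [taylor_order2] gives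
    all of them one quadratic remainder, and [cdiff_limit] passes to the sum. *)
Lemma dsum_holomorphic (Delta M : R) (c : nat -> C) : 0 <= M ->
  (forall N, (0 < N)%N -> bounded_dseries Delta M (proj N c)) ->
  forall s, half_plane Delta s -> exists l, cdiff (dsum c) s l.
Proof.
move=> M0 hb s hs.
have [hpart hsum] := dseries_of_projections Delta M c M0 hb.
set r := (Re s - Delta) / 4.
have hr : 0 < r by rewrite /half_plane in hs; rewrite /r; lra.
have near u : Cmod (u - s) <= r -> half_plane (Delta + 2 * r) u.
  move=> hu; have := proj1 (Rabs_le_between _ _) (Rle_trans _ _ _ (re_le_Cmod _) hu).
  by rewrite Re_minus /half_plane => h; have er : 4 * r = Re s - Delta by [rewrite /r; field]; lra.
set B := 4 * (M * (2 + 3 / r)).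
pose f n u := \csum_(0 <= k < n) dterm c u k.
pose f' n u := \csum_(0 <= k < n) (c k.+1 * (- RtoC (ln (INR k.+1)) * npow k.+1 u)).
pose f'' n u := \csum_(0 <= k < n) (c k.+1 * (- RtoC (ln (INR k.+1)) * (- RtoC (ln (INR k.+1)) * npow k.+1 u))).
have hf n u : cdiff (f n) u (f' n u).
  apply: (cdiff_csum (fun k u => dterm c u k) (fun k u => c k.+1 * (- RtoC (ln (INR k.+1)) * npow k.+1 u))%C) => k.
  by apply: cdiff_scal; exact: cdiff_npow.
have hf' n u : cdiff (f' n) u (f'' n u).
  apply: (cdiff_csum (fun k u => c k.+1 * (- RtoC (ln (INR k.+1)) * npow k.+1 u))%C
    (fun k u => c k.+1 * (- RtoC (ln (INR k.+1)) * (- RtoC (ln (INR k.+1)) * npow k.+1 u)))%C) => k.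
  by apply: cdiff_scal; apply: cdiff_scal; exact: cdiff_npow.
apply: (cdiff_limit f (fun n => f' n s) (dsum c) s (r / 4) (32 * B / r ^ 2)); first lra.
- move=> n h hh; apply: (taylor_order2 (f n) (f' n) (f'' n)) => // u hu.
  by apply: hpart => //; exact: near.
- move=> h hh; apply: (proj1 (hsum _ _)).
  have hh' : half_plane (Delta + 2 * r) (s + h)%C.
    by apply: near; have -> : (s + h - s = h)%C by [ring]; lra.
  by move: hh'; rewrite /half_plane; lra.
Qed.

Lemma convolution_bound_ge0 (w : nat -> R) (c : nat -> C) (M : R) : pos_weight w ->
  (forall a, in_H w a -> in_H w (conv a c) /\ normH w (conv a c) <= M * normH w a) -> 0 <= M.
Proof.
move=> hw hT.
have [_ h] := hT _ (in_H_unit_coef w hw).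
have h1 := coef_le_normH w unit_coef 1 hw (in_H_unit_coef w hw) isT.
rewrite /unit_coef /= Cmod_1 Rmult_1_l -/unit_coef in h1.
have h2 : 0 < sqrt (w 1%N) by apply: sqrt_lt_R0; exact: hw.
have h3 := Rle_trans _ _ _ (normH_ge0 w _) h.
apply: Rnot_lt_le => hneg.
nra.
Qed.

Lemma Lub_Rbar_le (E : R -> Prop) (B : Rbar) : (forall x, E x -> Rbar_le x B) -> Rbar_le (Lub_Rbar E) B.
Proof. by move=> h; have [_ lub] := Lub_Rbar_correct E; apply: lub. Qed.

Lemma multiplier_half_plane_bound (w : nat -> R) (sigma0 : R) (phi : C -> C) :
  pos_weight w ->
  (forall sigma : R, sigma0 < sigma -> ex_series (fun k => wterm w sigma k.+1)) ->
  is_multiplier w sigma0 phi ->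
  forall Delta Delta' : R,
  (forall sigma' : R, Delta' < sigma' -> ex_series (fun k => wterm w sigma' k.+1)) ->
  (forall N : nat, (1 <= N)%coq_nat -> forall sigma : R, Delta < sigma ->
     ex_series (fun k => wterm_P w N sigma k.+1)) ->
  (forall a, in_H w a -> forall s, half_plane Delta' s -> dconverges_abs a s) /\
  (forall N : nat, (1 <= N)%coq_nat -> forall a, in_HN w N a ->
     forall s, half_plane Delta s -> dconverges_abs a s) /\
  is_rkhs (half_plane Delta') (in_H w) (ip w) dsum /\
  (exists c, is_dseries_of w sigma0 phi c /\
     (is_finite (opnorm w sigma0 phi) /\
      forall N : nat, (1 <= N)%coq_nat ->
        Rbar_le (sup_on (half_plane Delta) (dsum (proj N c))) (opnorm w sigma0 phi)) /\
     (forall s, half_plane Delta s -> dconverges c s) /\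
     Rbar_le (sup_norm sigma0 phi Delta) (opnorm w sigma0 phi)).
Proof.
move=> hw hs hphi Delta Delta' hs' hsN.
split; first by move=> a ha s /hs' hss; exact: (proj1 (in_H_evaluation _ _ _ hw ha hss)).
split.
  by move=> N hN a ha s /(hsN N hN) hss; exact: (proj1 (in_HN_evaluation _ _ _ _ hw ha hss)).
split; first exact: H_rkhs.
have [c [hser [fin hT]]] := multiplier_convolution w sigma0 phi hw hs hphi.
have hcH := proj1 hser.
exists c; split=> //.
set M := real (opnorm w sigma0 phi) in hT.
have finM : opnorm w sigma0 phi = Rbar.Finite M by rewrite -fin.
rewrite finM.
have M0 : 0 <= M by exact: convolution_bound_ge0 hT.
have hb N : (0 < N)%N -> bounded_dseries Delta M (proj N c).
  move=> hN s hss; have hex := hsN N ltac:(lia) _ hss; split.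
    exact: (proj1 (in_HN_evaluation _ _ _ _ hw (proj1 (proj_norm_le w N c hw hcH)) hex)).
  exact: proj_dsum_bound hT hex.
split.
  split=> // N hN; apply: Lub_Rbar_le => x [s [hss ->]].
  exact: (proj2 (hb N ltac:(lia) s hss)).
have [_ hsum] := dseries_of_projections Delta M c M0 hb.
have hol := dsum_holomorphic Delta M c M0 hb.
split; first by move=> s /hsum[h _]; exact: ex_series_csums h.
have hcont : is_continuation sigma0 phi Delta (dsum c).
  split; last by move=> s _ hss; rewrite (proj2 hser).
  by move=> s /hol[l hl]; exists l; apply/is_derive_cdiff.
rewrite /sup_norm; case: excluded_middle_informative => [hex|hno]; last first.
  by case: hno; exists (dsum c).
case: constructive_indefinite_description => F [hF1 hF2] /=.
apply: Lub_Rbar_le => x [s [hss ->]] /=.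
have -> : F s = dsum c s; last exact: (proj2 (hsum s hss)).
have -> : F s = (F s - dsum c s + dsum c s)%C by ring.
(* The supremum is taken over whichever continuation was chosen; it coincides with the sum of the
   series where both half planes overlap, hence throughout. *)
rewrite (unique_continuation (fun s => F s - dsum c s)%C Delta (Rmax Delta sigma0)) ?Cplus_0_l //.
- move=> z hz; have [l hl] := hol z hz; have [l' /is_derive_cdiff hl'] := hF1 z hz.
  by exists (l' - l)%C; exact: cdiff_minus.
- move=> z hz.
  have h1 : half_plane Delta z by apply: Rle_lt_trans (Rmax_l _ _) hz.
  have h2 : half_plane sigma0 z by apply: Rle_lt_trans (Rmax_r _ _) hz.
  by rewrite hF2 // (proj2 hser) //; ring.
Qed.

Lemma multiplier_norm_le_sup (w : nat -> R) (sigma0 : R) (phi : C -> C) :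
  pos_weight w ->
  (forall sigma : R, sigma0 < sigma -> ex_series (fun k => wterm w sigma k.+1)) ->
  is_multiplier w sigma0 phi ->
  forall delta : R, multiplicative w ->
  (forall p k : nat, is_prime p -> (1 <= k)%coq_nat ->
     w (Nat.pow p (Nat.sub k 1)) * Rpower (INR p) (- (2 * delta)) >= w (Nat.pow p k)) ->
  Rbar_le (opnorm w sigma0 phi) (sup_norm sigma0 phi delta).
Proof.
move=> hw hs hphi delta hmul hdec.
rewrite /sup_norm; case: excluded_middle_informative => [hex|_]; last by case: (opnorm _ _ _).
case: constructive_indefinite_description => F [hF1 hF2] /=.
have [c [hser _]] := multiplier_convolution w sigma0 phi hw hs hphi.
have [ub _] := Lub_Rbar_correct (fun x => exists s, half_plane delta s /\ x = Cmod (F s)).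
rewrite -/(sup_on (half_plane delta) F) in ub.
case E : (sup_on (half_plane delta) F) => [L| |]; rewrite E in ub; last first.
- have hin : half_plane delta (RtoC (delta + 1)) by rewrite /half_plane /=; lra.
  by case: (ub _ (ex_intro _ _ (conj hin erefl))).
- by case: (opnorm _ _ _).
have hFL s : half_plane delta s -> Cmod (F s) <= L by move=> hss; apply: (ub (Cmod (F s))); exists s.
apply: Lub_Rbar_le => x [a [b [hab [hn ->]]]] /=.
have hin : half_plane delta (RtoC (delta + 1)) by rewrite /half_plane /=; lra.
have L0 : 0 <= L by apply: Rle_trans (hFL _ hin); exact: Cmod_ge_0.
rewrite (normH_ext w b (conv a c)); last exact: mult_graph_conv hser hab.
(* The supremum may be 0, while the norm inequality requires a strictly positive bound; [L + eps] is
   used instead. *)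
apply: le_epsilon => eps he.
apply: (Rle_trans _ ((L + eps) * normH w a)); last first.
  by have := normH_ge0 w a; nra.
apply: (convolution_norm_le w F c a delta (Rmax delta sigma0)) => //.
- lra.
- move=> s hss; split; last by have := hFL s hss; lra.
  by have [l /is_derive_cdiff hl] := hF1 s hss; exists l.
- exact: Rmax_l.
- move=> s hss.
  have h1 : half_plane delta s by apply: Rle_lt_trans (Rmax_l _ _) hss.
  have h2 : half_plane sigma0 s by apply: Rle_lt_trans (Rmax_r _ _) hss.
  split; first exact: (proj1 (in_H_evaluation _ _ _ hw (proj1 hser) (hs _ h2))).
  by rewrite hF2 // (proj2 hser).
- exact: (proj1 hab).
- exact: (proj1 (proj1 hser)).
Qed.

End HilbertDirichlet.

Import HilbertDirichlet.

Theorem theorem1p4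
  (w : nat -> R) (sigma0 : R) (phi : C -> C)
  (w_pos : forall n : nat, (1 <= n)%nat -> 0 < w n)
  (sigma0_ge0 : 0 <= sigma0)
  (w_summable : forall sigma : R, sigma0 < sigma ->
     ex_series (fun k : nat => wterm w sigma (S k)))
  (phi_mult : is_multiplier w sigma0 phi) :
  (* (A) *)
  (forall Delta Delta' : R, 0 <= Delta -> Delta <= Delta' ->
     (forall sigma' : R, Delta' < sigma' ->
        ex_series (fun k : nat => wterm w sigma' (S k))) ->
     (forall N : nat, (1 <= N)%nat -> forall sigma : R, Delta < sigma ->
        ex_series (fun k : nat => wterm_P w N sigma (S k))) ->
     (* (1) *)
     (forall a : nat -> C, in_H w a ->
        forall s : C, half_plane Delta' s -> dconverges_abs a s) /\
     (* (2) *)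
     (forall N : nat, (1 <= N)%nat -> forall a : nat -> C, in_HN w N a ->
        forall s : C, half_plane Delta s -> dconverges_abs a s) /\
     (* (3) *)
     is_rkhs (half_plane Delta') (in_H w) (ip w) dsum /\
     (exists c : nat -> C, is_dseries_of w sigma0 phi c /\
        (* (4) *)
        (is_finite (opnorm w sigma0 phi) /\
         forall N : nat, (1 <= N)%nat ->
           Rbar_le (sup_on (half_plane Delta) (dsum (proj N c)))
                   (opnorm w sigma0 phi)) /\
        (* (5) *)
        (forall s : C, half_plane Delta s -> dconverges c s) /\
        Rbar_le (sup_norm sigma0 phi Delta) (opnorm w sigma0 phi))) /\
  (* (B) *)
  (forall delta : R, 0 <= delta ->
     multiplicative w ->
     (forall p k : nat, is_prime p -> (1 <= k)%nat ->
        w (p ^ (k - 1))%nat * Rpower (INR p) (- (2 * delta)) >= w (p ^ k)%nat) ->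
     Rbar_le (opnorm w sigma0 phi) (sup_norm sigma0 phi delta)).
Proof.
pose proof (pos_weight_of_le w w_pos) as hw.
split.
- intros Delta Delta' _ _ hs' hsN.
  exact (multiplier_half_plane_bound w sigma0 phi hw w_summable phi_mult Delta Delta' hs' hsN).
- intros delta _ hmul hdec.
  exact (multiplier_norm_le_sup w sigma0 phi hw w_summable phi_mult delta hmul hdec).
Qed.
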